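(* Consider regular expression separation: given finite sets $\mathit{P}$ and $\mathit{N}$ of finite words over a finite alphabet $\Sigma$ and a regular tree grammar $\mathcal{G}$ over syntax trees of (extended) regular expressions, synthesize a regular expression $e\in L(\mathcal{G})$ with $\mathit{P}\subseteq L(e)$ and $\mathit{N}\cap L(e)=\emptyset$, or declare none exists. This problem is decidable in time $\mathcal{O}(2^{\mathrm{poly}(mn^2)}\cdot|\mathcal{G}|)$, where $n=\max_{w\in\mathit{P}\cup\mathit{N}}|w|$ and $m=|\mathit{P}|+|\mathit{N}|$.
   Context: Extended regular expressions over $\Sigma$: $e::=a\in\Sigma\mid e\cdot e'\mid e+e'\mid e\cap e'\mid e^*\mid\neg e$, with the standard languages: $L(a)=\{a\}$, concatenation, union, intersection, Kleene star, and $L(\neg e)=\Sigma^*\setminus L(e)$. Expressions are represented as syntax trees over the corresponding ranked alphabet. $L(\mathcal{G})$ is the tree language of the regular tree grammar $\mathcal{G}$ and $|\mathcal{G}|$ its size. *)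

(* Defs.v *)
From HB Require Import structures.
From mathcomp Require Import all_boot all_order all_algebra.
From Stdlib Require List Relation_Operators.

Set Implicit Arguments.
Unset Strict Implicit.
Unset Printing Implicit Defensive.

(** * Extended regular expressions *)

Inductive ere (A : Type) : Type :=
| Leaf of A
| Cat of ere A & ere A
| Alt of ere A & ere A
| Cap of ere A & ere A
| Star of ere A
| Neg of ere A.

Fixpoint ere_map (A B : Type) (f : A -> B) (e : ere A) : ere B :=
  match e with
  | Leaf a => Leaf (f a)
  | Cat e1 e2 => Cat (ere_map f e1) (ere_map f e2)
  | Alt e1 e2 => Alt (ere_map f e1) (ere_map f e2)
  | Cap e1 e2 => Cap (ere_map f e1) (ere_map f e2)
  | Star e1 => Star (ere_map f e1)
  | Neg e1 => Neg (ere_map f e1)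
  end.

Fixpoint ere_size (A : Type) (e : ere A) : nat :=
  match e with
  | Leaf _ => 1
  | Cat e1 e2 | Alt e1 e2 | Cap e1 e2 => (ere_size e1 + ere_size e2).+1
  | Star e1 | Neg e1 => (ere_size e1).+1
  end.

Fixpoint lang (S : eqType) (e : ere S) (w : seq S) : Prop :=
  match e with
  | Leaf a => w = [:: a]
  | Cat e1 e2 => exists u v, [/\ w = u ++ v, lang e1 u & lang e2 v]
  | Alt e1 e2 => lang e1 w \/ lang e2 w
  | Cap e1 e2 => lang e1 w /\ lang e2 w
  | Star e1 => exists ws, w = flatten ws /\ forall u, u \in ws -> lang e1 u
  | Neg e1 => ~ lang e1 w
  end.

(** * Regular tree grammars over syntax trees of expressions *)

(** A tree over the ranked alphabet of expressions, with the elements of [V]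
    added as nullary symbols, is an expression over the leaves [S + V]. *)
Definition form (S V : Type) := ere (S + V).

Record rtg (S : Type) : Type := RTG {
  nonterm : finType;
  start : nonterm;
  prods : seq (nonterm * form S nonterm)
}.

Inductive step (S : Type) (G : rtg S) :
    form S (nonterm G) -> form S (nonterm G) -> Prop :=
| step_prod X t of List.In (X, t) (prods G) : step (Leaf (inr X)) t
| step_catl s s' t of step s s' : step (Cat s t) (Cat s' t)
| step_catr s t t' of step t t' : step (Cat s t) (Cat s t')
| step_altl s s' t of step s s' : step (Alt s t) (Alt s' t)
| step_altr s t t' of step t t' : step (Alt s t) (Alt s t')
| step_capl s s' t of step s s' : step (Cap s t) (Cap s' t)
| step_capr s t t' of step t t' : step (Cap s t) (Cap s t')
| step_star s s' of step s s' : step (Star s) (Star s')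
| step_neg s s' of step s s' : step (Neg s) (Neg s').

Definition tree_lang (S : Type) (G : rtg S) (e : ere S) : Prop :=
  Relation_Operators.clos_refl_trans (form S (nonterm G)) (@step S G)
    (Leaf (inr (start G))) (ere_map inl e).

Definition rtg_size (S : Type) (G : rtg S) : nat :=
  #|nonterm G| + \sum_(r <- prods G) (ere_size r.2).+1.

(** * Separation *)

(** Finite sets of words are given as duplicate-free lists. *)
Definition separates (S : eqType) (P N : seq (seq S)) (e : ere S) : Prop :=
  (forall w, w \in P -> lang e w) /\ (forall w, w \in N -> ~ lang e w).

Definition solution (S : eqType) (P N : seq (seq S)) (G : rtg S) (e : ere S) :
  Prop := tree_lang G e /\ separates P N e.

(** * A unit-cost random access machine *)

(** Programs are while-programs over registers and an indirectly addressed
    memory of natural numbers. As usual for the unit-cost measure, arithmetic is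
    limited to addition and truncated subtraction; multiplication would make
    numbers of exponential length available in polynomial time. *)
Inductive aexp : Type :=
| Num of nat
| Reg of nat
| Deref of aexp
| Plus of aexp & aexp
| Minus of aexp & aexp.

Inductive com : Type :=
| Skip
| Assign of nat & aexp
| Store of aexp & aexp
| Seq of com & com
| If of aexp & com & com
| While of aexp & com.

Record state : Type := State { regs : nat -> nat; mem : nat -> nat }.

Definition upd (f : nat -> nat) (x v : nat) : nat -> nat :=
  fun y => if y == x then v else f y.

Fixpoint aeval (s : state) (a : aexp) : nat :=
  match a with
  | Num n => n
  | Reg x => regs s x
  | Deref b => mem s (aeval s b)
  | Plus b c => aeval s b + aeval s c
  | Minus b c => aeval s b - aeval s c
  end.

Fixpoint acost (a : aexp) : nat :=
  match a with
  | Num _ | Reg _ => 1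
  | Deref b => (acost b).+1
  | Plus b c | Minus b c => (acost b + acost c).+1
  end.

(** [exec c s t s']: started in [s], the program [c] halts in [s'] after [t]
    time units. A condition holds when its value is nonzero. *)
Inductive exec : com -> state -> nat -> state -> Prop :=
| exec_skip s : exec Skip s 1 s
| exec_assign s x a :
    exec (Assign x a) s (acost a).+1 (State (upd (regs s) x (aeval s a)) (mem s))
| exec_store s a b :
    exec (Store a b) s (acost a + acost b).+1
      (State (regs s) (upd (mem s) (aeval s a) (aeval s b)))
| exec_seq c1 c2 s s1 s2 t1 t2 of exec c1 s t1 s1 & exec c2 s1 t2 s2 :
    exec (Seq c1 c2) s (t1 + t2) s2
| exec_if_true a c1 c2 s s' t of aeval s a != 0 & exec c1 s t s' :
    exec (If a c1 c2) s ((acost a).+1 + t) s'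
| exec_if_false a c1 c2 s s' t of aeval s a == 0 & exec c2 s t s' :
    exec (If a c1 c2) s ((acost a).+1 + t) s'
| exec_while_true a c s s1 s2 t1 t2 of
    aeval s a != 0 & exec c s t1 s1 & exec (While a c) s1 t2 s2 :
    exec (While a c) s ((acost a).+1 + t1 + t2) s2
| exec_while_false a c s of aeval s a == 0 :
    exec (While a c) s (acost a).+1 s.

Lemma exec_det c s t1 s1 t2 s2 :
  exec c s t1 s1 -> exec c s t2 s2 -> t1 = t2 /\ s1 = s2.
Proof.
move=> H1; elim: H1 t2 s2 => {c s t1 s1};
  intros; match goal with H : exec _ _ _ _ |- _ => inversion H; subst end;
  repeat match goal with
  | H : is_true (?b != 0), H' : is_true (?b == 0) |- _ => by rewrite H' in H
  | IH : forall t s', exec ?c ?s t s' -> _, H : exec ?c ?s _ _ |- _ =>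
      case: (IH _ _ H) => ? ?; subst; clear H
  end; by [].
Qed.

(** * Input and output conventions *)

(** Letters and nonterminals are encoded by their rank in the enumeration of
    their type; trees are written in prefix order. *)
Definition code (T : finType) (x : T) : nat := enum_rank x.

Fixpoint enc_form (S V : finType) (t : form S V) : seq nat :=
  match t with
  | Leaf (inl a) => [:: 0; code a]
  | Leaf (inr X) => [:: 1; code X]
  | Cat t1 t2 => 2 :: enc_form t1 ++ enc_form t2
  | Alt t1 t2 => 3 :: enc_form t1 ++ enc_form t2
  | Cap t1 t2 => 4 :: enc_form t1 ++ enc_form t2
  | Star t1 => 5 :: enc_form t1
  | Neg t1 => 6 :: enc_form t1
  end.

Definition enc_seq (T : Type) (enc : T -> seq nat) (s : seq T) : seq nat :=
  size s :: flatten (map enc s).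

Definition enc_words (S : finType) : seq (seq S) -> seq nat :=
  enc_seq (enc_seq (fun a => [:: code a])).

Definition enc_rtg (S : finType) (G : rtg S) : seq nat :=
  #|nonterm G| :: code (start G)
    :: enc_seq (fun r => code r.1 :: enc_form r.2) (prods G).

Definition encode (S : finType) (P N : seq (seq S)) (G : rtg S) : seq nat :=
  #|S| :: enc_words P ++ enc_words N ++ enc_rtg G.

Definition init (input : seq nat) : state :=
  State (fun _ => 0) (fun i => nth 0 input i).

(** The linked representation of a syntax tree: a node at address [p] stores its
    symbol in cell [p] and the addresses of its children in the next cells.
    Equal subtrees may share cells; this cannot be avoided within the time bound,
    since all trees of [tree_lang G] may have size exponential in [rtg_size G]. *)
Fixpoint tree_at (S : finType) (h : nat -> nat) (p : nat) (e : ere S) : Prop :=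
  match e with
  | Leaf a => h p = 0 /\ h p.+1 = code a
  | Cat e1 e2 => [/\ h p = 2, tree_at h (h p.+1) e1 & tree_at h (h p.+2) e2]
  | Alt e1 e2 => [/\ h p = 3, tree_at h (h p.+1) e1 & tree_at h (h p.+2) e2]
  | Cap e1 e2 => [/\ h p = 4, tree_at h (h p.+1) e1 & tree_at h (h p.+2) e2]
  | Star e1 => h p = 5 /\ tree_at h (h p.+1) e1
  | Neg e1 => h p = 6 /\ tree_at h (h p.+1) e1
  end.

(** Register 0 holds the verdict and register 1 the address of the expression. *)
Definition answers (S : finType) (P N : seq (seq S)) (G : rtg S) (s : state) :
  Prop :=
  (regs s 0 = 1 /\ exists e, tree_at (mem s) (regs s 1) e /\ solution P N G e)
  \/ (regs s 0 = 0 /\ ~ exists e, solution P N G e).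

(* Main.v *)
Require Import Defs.
From mathcomp Require Import all_boot all_order all_algebra.
From mathcomp Require Import zify.
From Stdlib Require Relation_Operators Operators_Properties.
Import Defs.

(* The expression [e] matters only through the set of infixes of the given words
   that it matches. Lay the words out as one text, the prefix of the input that
   encodes them: with [S - 1] cells, [e] is represented by a Boolean [S x S]
   matrix, and the six operations act on matrices (concatenation as a product,
   star as a closure, negation as a complement among the pairs [i <= j]). A
   matrix is coded by a number below [W = 2 ^ (S * S)], and [S] is linear in
   [m * n ^ 2] because [P] and [N] have no repetitions.

   The grammar is cut into rules [g <- o a b], one for each symbol of a right-hand
   side, and the derivable pairs (node, value) are found by saturation. A new
   fact for a node is queued, and when it leaves the queue only the rules reading
   that node are revisited. A node gets at most [W] facts, so this costs
   [O (W ^ c)] for each rule, which keeps the total linear in the grammar. Every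
   fact stores how it was first derived, which makes it the root of a linked tree
   of an expression with that value. *)

Set Implicit Arguments.
Unset Strict Implicit.
Unset Printing Implicit Defensive.

Definition tri T c s (Q : state -> Prop) :=
  exists t s', [/\ exec c s t s', t <= T & Q s'].

(* The time of a program whose loops run at most [W] times each. *)
Fixpoint cst W c :=
  match c with
  | Skip => 1
  | Assign _ a => (acost a).+1
  | Store a b => (acost a + acost b).+1
  | Seq c1 c2 => cst W c1 + cst W c2
  | If a c1 c2 => (acost a).+1 + (cst W c1 + cst W c2)
  | While a c => W.+1 * ((acost a).+1 + cst W c)
  end.

(** Coefficient and degree of a monomial in [W] above [cst W c]. Degrees are added where a maximum
    would do: for a fixed program any constant degree is good enough. *)
Fixpoint cst_coef c :=
  match c with
  | Skip => 1
  | Assign _ a => (acost a).+1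
  | Store a b => (acost a + acost b).+1
  | Seq c1 c2 => cst_coef c1 + cst_coef c2
  | If a c1 c2 => (acost a).+1 + (cst_coef c1 + cst_coef c2)
  | While a c => 2 * ((acost a).+1 + cst_coef c)
  end.

Fixpoint cst_deg c :=
  match c with
  | Seq c1 c2 | If _ c1 c2 => cst_deg c1 + cst_deg c2
  | While _ c => (cst_deg c).+1
  | _ => 0
  end.

Lemma cst_le W c : 0 < W -> cst W c <= cst_coef c * W ^ cst_deg c.
Proof.
move=> W0; elim: c => /= [|n a|a b|c1 IH1 c2 IH2|a c1 IH1 c2 IH2|a c IH];
  rewrite ?expn0 ?muln1 //.
- rewrite mulnDl leq_add // (leq_trans IH1, leq_trans IH2) // leq_mul2l.
    by rewrite leq_pexp2l ?leq_addr ?orbT.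
  by rewrite leq_pexp2l ?leq_addl ?orbT.
- rewrite mulnDl leq_add //.
    by rewrite -{1}[_.+1]muln1 leq_mul2l expn_gt0 W0 orbT.
  rewrite mulnDl leq_add // (leq_trans IH1, leq_trans IH2) // leq_mul2l.
    by rewrite leq_pexp2l ?leq_addr ?orbT.
  by rewrite leq_pexp2l ?leq_addl ?orbT.
- have H : (acost a).+1 + cst W c <= ((acost a).+1 + cst_coef c) * W ^ cst_deg c.
    rewrite mulnDl leq_add //.
    by rewrite -{1}[_.+1]muln1 leq_mul2l expn_gt0 W0 orbT.
  apply: (leq_trans (leq_mul (leqnn _) H)).
  rewrite expnSr; move: (_.+1 + _) (W ^ _) => x w.
  have -> : 2 * x * (w * W) = 2 * W * (x * w) by nia.
  by rewrite leq_mul2r; apply/orP; right; lia.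
Qed.

Lemma tri_weak T T' c s (Q Q' : state -> Prop) :
  tri T c s Q -> T <= T' -> (forall s', Q s' -> Q' s') -> tri T' c s Q'.
Proof.
move=> [t [s' [X L q]]] L' H; exists t, s'; split=> //; last exact: H.
exact: leq_trans L L'.
Qed.

Lemma tri_seq T1 T2 c1 c2 s Q :
  tri T1 c1 s (fun s1 => tri T2 c2 s1 Q) -> tri (T1 + T2) (Seq c1 c2) s Q.
Proof.
move=> [t1 [s1 [X1 L1 [t2 [s2 [X2 L2 q]]]]]].
by exists (t1 + t2), s2; split; [apply: exec_seq X1 X2 | apply: leq_add |].
Qed.

Lemma tri_loop T1 T2 a c s Q : aeval s a != 0 ->
  tri T1 c s (fun s1 => tri T2 (While a c) s1 Q) ->
  tri ((acost a).+1 + T1 + T2) (While a c) s Q.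
Proof.
move=> n0 [t1 [s1 [X1 L1 [t2 [s2 [X2 L2 q]]]]]].
exists ((acost a).+1 + t1 + t2), s2; split=> //; last by rewrite !leq_add.
exact: exec_while_true X1 X2.
Qed.

Lemma tri_done a c s (Q : state -> Prop) : aeval s a = 0 -> Q s ->
  tri (acost a).+1 (While a c) s Q.
Proof.
move=> n0 q; exists (acost a).+1, s; split=> //.
by apply: exec_while_false; rewrite n0.
Qed.

(** * Interleaved arrays *)

(** Multiplication by [2 ^ n] through nested doublings, since [aexp] has no product. For [n = 4] the
    cost is that of 16 copies of [e], a constant. *)
Fixpoint dbn n e := if n is m.+1 then Plus (dbn m e) (dbn m e) else e.

(* Cell [i] of array [k < 16] lives at address [B + 16 i + k], where [B] is kept
   in register 2; cells [B + 16 i, B + 16 i + 1, ...] of the arrays [0, 1, ...]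
   are thus consecutive, as [tree_at] requires. *)
Definition adr k e := Plus (Plus (Reg 2) (Num k)) (dbn 4 e).
Definition Ar k e := Deref (adr k e).
Definition Put k e v := Store (adr k e) v.

Definition ar s k i := mem s (regs s 2 + 16 * i + k).
Definition setr s x v := State (upd (regs s) x v) (mem s).
Definition seta s k i v :=
  State (regs s) (upd (mem s) (regs s 2 + 16 * i + k) v).

Lemma aeval_dbn s n e : aeval s (dbn n e) = aeval s e * 2 ^ n.
Proof. by elim: n => [|n IH] /=; rewrite ?muln1 // IH addnn -mul2n mulnCA -expnS. Qed.

Lemma aeval_adr s k e : aeval s (adr k e) = regs s 2 + 16 * aeval s e + k.
Proof.
by rewrite -[LHS]/(_ + k + aeval s (dbn 4 e)) aeval_dbn addnAC [16 * _]mulnC.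
Qed.

Lemma arE s k i : ar s k i = mem s (regs s 2 + 16 * i + k).
Proof. by []. Qed.

Definition Pt e := adr 0 e.

Lemma aeval_Pt s e : aeval s (Pt e) = regs s 2 + 16 * aeval s e.
Proof. by rewrite aeval_adr addn0. Qed.

Lemma aeval_Ar s k e : aeval s (Ar k e) = ar s k (aeval s e).
Proof. by rewrite -[LHS]/(mem s (aeval s (adr k e))) aeval_adr. Qed.

Lemma regs_setr s x v y : regs (setr s x v) y = if y == x then v else regs s y.
Proof. by []. Qed.

Lemma mem_setr s x v : mem (setr s x v) = mem s.
Proof. by []. Qed.

Lemma ar_setr s x v k i : x != 2 -> ar (setr s x v) k i = ar s k i.
Proof. by rewrite /ar /= /upd eq_sym => /negbTE ->. Qed.

Lemma regs_seta s k i v : regs (seta s k i v) = regs s.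
Proof. by []. Qed.

Lemma ar_seta s k0 i0 v k i : k < 16 -> k0 < 16 ->
  ar (seta s k0 i0 v) k i = if (k == k0) && (i == i0) then v else ar s k i.
Proof.
move=> kL k0L; rewrite /ar /= /upd; congr (if _ then _ else _).
by apply/eqP/andP => [H|[/eqP -> /eqP ->]] //; split; apply/eqP; lia.
Qed.

Lemma mem_seta s k i v a : a < regs s 2 -> mem (seta s k i v) a = mem s a.
Proof. by move=> L; rewrite /= /upd; case: eqP => // E; lia. Qed.

Definition stE := (regs_setr, mem_setr, regs_seta, aeval_Ar, aeval_Pt).

(** * Frames *)

Fixpoint aeqb a b :=
  match a, b with
  | Num m, Num n => m == n
  | Reg m, Reg n => m == n
  | Deref a, Deref b => aeqb a b
  | Plus a a', Plus b b' => aeqb a b && aeqb a' b'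
  | Minus a a', Minus b b' => aeqb a b && aeqb a' b'
  | _, _ => false
  end.

Lemma aeqb_eq a b : aeqb a b -> a = b.
Proof.
elim: a b => [n|x|a IH|a IH a' IH'|a IH a' IH'] [m|y|b|b b'|b b'] //=.
- by move/eqP->.
- by move/eqP->.
- by move/IH->.
- by move/andP=> [/IH -> /IH' ->].
- by move/andP=> [/IH -> /IH' ->].
Qed.

(** A syntactic certificate that the value is a multiple of [2 ^ n]. With [n = 4] it fixes the
    residue modulo 16 of a store address relative to the base, hence the array that is written. *)
Fixpoint is_dbn n e :=
  if n is m.+1 then if e is Plus a b then aeqb a b && is_dbn m a else false
  else true.

Lemma is_dbnP s n e : is_dbn n e -> exists i, aeval s e = i * 2 ^ n.
Proof.
elim: n e => [|n IH] e /=; first by exists (aeval s e); rewrite muln1.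
case: e => //= a b /andP[/aeqb_eq <- /IH[i ->]]; exists i.
by rewrite addnn -mul2n expnS mulnCA.
Qed.

Fixpoint wr c :=
  match c with
  | Assign x _ => [:: x]
  | Seq c1 c2 | If _ c1 c2 => wr c1 ++ wr c2
  | While _ c => wr c
  | _ => [::]
  end.

Fixpoint wa c :=
  match c with
  | Store (Plus (Plus _ (Num k)) _) _ => [:: k]
  | Seq c1 c2 | If _ c1 c2 => wa c1 ++ wa c2
  | While _ c => wa c
  | _ => [::]
  end.

(** Every store has the shape of [adr] with a literal array index, and the base in register 2 never
    moves. This makes the effect on memory readable from the syntax. *)
Fixpoint okc c :=
  match c with
  | Skip => true
  | Assign x _ => x != 2
  | Store (Plus (Plus (Reg 2) (Num k)) e) _ => (k < 16) && is_dbn 4 e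
  | Store _ _ => false
  | Seq c1 c2 | If _ c1 c2 => okc c1 && okc c2
  | While _ c => okc c
  end.

(** The disjunct [ks == [::]] serves the measuring phase: there register 2 is still 0, so no cell
    lies below the base, but nothing is stored and all of memory is kept. *)
Definition frl (rs ks : seq nat) s s' :=
  [/\ forall x, x \notin rs -> regs s' x = regs s x,
      forall k i, k < 16 -> k \notin ks -> ar s' k i = ar s k i &
      forall a, (ks == [::]) || (a < regs s 2) -> mem s' a = mem s a].

Definition fr c := frl (wr c) (wa c).

Lemma frl_sub rs ks rs' ks' s s' :
  {subset rs <= rs'} -> {subset ks <= ks'} -> frl rs ks s s' -> frl rs' ks' s s'.
Proof.
move=> sr sk [H1 H2 H3]; split=> [x nx|k i kL nk|a Ha].
- by apply: H1; apply: contra nx; apply: sr.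
- by apply: H2 => //; apply: contra nk; apply: sk.
- apply: H3; case/orP: Ha => [/eqP k0|->]; rewrite ?orbT //.
  by case: ks sk {H2} => // k l /(_ k); rewrite k0 inE eqxx => /(_ isT).
Qed.

Lemma frl_refl rs ks s : frl rs ks s s. Proof. by []. Qed.

Lemma frl_trans rs ks s s1 s2 : 2 \notin rs ->
  frl rs ks s s1 -> frl rs ks s1 s2 -> frl rs ks s s2.
Proof.
move=> n2 [A1 A2 A3] [B1 B2 B3]; split=> [x nx|k i kL nk|a Ha].
- by rewrite B1 // A1.
- by rewrite B2 // A2.
- by rewrite B3 ?A3 // A1.
Qed.

Lemma okc_wr c : okc c -> 2 \notin wr c.
Proof.
elim: c => //= [x _|c1 IH1 c2 IH2|a c1 IH1 c2 IH2].
- by rewrite inE eq_sym.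
- by case/andP=> /IH1 ? /IH2 ?; rewrite mem_cat negb_or; apply/andP.
- by case/andP=> /IH1 ? /IH2 ?; rewrite mem_cat negb_or; apply/andP.
Qed.

Lemma exec_fr c s t s' : okc c -> exec c s t s' -> fr c s s'.
Proof.
move=> ok X; elim: X ok => {c s t s'}
  [||s a b|c1 c2 s s1 s2 t1 t2 _ IH1 _ IH2|a c1 c2 s s' t _ _ IH
  |a c1 c2 s s' t _ _ IH|a c s s1 s2 t1 t2 _ _ IH1 _ IH2|].
- by move=> s _; apply: frl_refl.
- move=> s x a /= x2; split=> [y|k i kL _|//].
    by rewrite inE => /negbTE ny; rewrite /= /upd ny.
  by rewrite -[State _ _]/(setr s x (aeval s a)) ar_setr.
- case: a => //= -[] //= -[] //= [] // [] // [] // [] // k e /andP[kL D].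
  split=> // [k' i k'L|x /= xL].
    rewrite inE => nk; rewrite /ar /= /upd; case: eqP => // E; exfalso.
    (* Relative to the base, the two addresses are congruent to [k'] and [k] modulo 16, and both
       indices are below 16. *)
    have [j Ej] := @is_dbnP s 4 e D; rewrite Ej in E.
    by move/eqP: nk; apply; lia.
  by rewrite /upd; case: eqP => // E; lia.
- move=> /= /andP[ok1 ok2].
  have n2 : 2 \notin wr c1 ++ wr c2 by rewrite (okc_wr (c := Seq c1 c2)) //= ok1.
  apply: (frl_trans (s1 := s1)) => //.
    by apply: frl_sub (IH1 ok1) => x; rewrite mem_cat => ->.
  by apply: frl_sub (IH2 ok2) => x; rewrite mem_cat orbC => ->.
- move=> /= /andP[ok1 ok2].
  by apply: frl_sub (IH ok1) => x; rewrite mem_cat => ->.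
- move=> /= /andP[ok1 ok2].
  by apply: frl_sub (IH ok2) => x; rewrite mem_cat orbC => ->.
- move=> /= ok; apply: (frl_trans (s1 := s1)); last exact: IH2.
    exact: okc_wr.
  exact: IH1.
- by move=> *; apply: frl_refl.
Qed.

#[global] Opaque setr seta ar Ar Pt.

Lemma frR c s s' x : fr c s s' -> x \notin wr c -> regs s' x = regs s x.
Proof. by case=> H _ _; apply: H. Qed.

Lemma frA c s s' k i :
  fr c s s' -> (k < 16) && (k \notin wa c) -> ar s' k i = ar s k i.
Proof. by case=> _ H _ /andP[]; apply: H. Qed.

Arguments frA {c s s' k i}.

Lemma frM c s s' a : fr c s s' -> a < regs s 2 -> mem s' a = mem s a.
Proof. by case=> _ _ H L; apply: H; rewrite L orbT. Qed.

Lemma frM0 c s s' a : fr c s s' -> wa c = [::] -> mem s' a = mem s a.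
Proof. by case=> _ _ H L; apply: H; rewrite L. Qed.

Lemma frW c' c s s' :
  all (fun x => x \in wr c') (wr c) && all (fun k => k \in wa c') (wa c) ->
  fr c s s' -> fr c' s s'.
Proof. by case/andP=> /allP H /allP H'; apply: frl_sub. Qed.

(** * Proof rules *)

Definition trw W c := tri (cst W c) c.

Section Rules.
Variable W : nat.
Implicit Types (s : state) (Q : state -> Prop).

Lemma trw_skip s Q : Q s -> trw W Skip s Q.
Proof. by move=> q; exists 1, s; split=> //; apply: exec_skip. Qed.

Lemma trw_set s x a Q : Q (setr s x (aeval s a)) -> trw W (Assign x a) s Q.
Proof. by move=> q; do 2 eexists; split; [apply: exec_assign| |apply: q]. Qed.

Lemma trw_put s k e v Q :
  Q (seta s k (aeval s e) (aeval s v)) -> trw W (Put k e v) s Q.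
Proof.
move=> q; do 2 eexists; split; [apply: exec_store|by []|].
by rewrite aeval_adr.
Qed.

Lemma trw_seq s c1 c2 Q :
  trw W c1 s (fun s1 => trw W c2 s1 Q) -> trw W (Seq c1 c2) s Q.
Proof. exact: tri_seq. Qed.

Lemma trw_if s a c1 c2 Q :
  (aeval s a != 0 -> trw W c1 s Q) -> (aeval s a = 0 -> trw W c2 s Q) ->
  trw W (If a c1 c2) s Q.
Proof.
move=> H1 H2; case: (eqVneq (aeval s a) 0) => [a0|a0].
  have [t [s' [X L q]]] := H2 a0; exists ((acost a).+1 + t), s'; split=> //=.
    by apply: exec_if_false => //; rewrite a0.
  by rewrite leq_add2l (leq_trans L) // leq_addl.
have [t [s' [X L q]]] := H1 a0; exists ((acost a).+1 + t), s'; split=> //=.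
  exact: exec_if_true.
by rewrite leq_add2l (leq_trans L) // leq_addr.
Qed.

Lemma trw_conseq s c (P Q : state -> Prop) : okc c ->
  trw W c s P -> (forall s', fr c s s' -> P s' -> Q s') -> trw W c s Q.
Proof.
move=> ok [t [s' [X L p]]] H; exists t, s'; split=> //.
by apply: H => //; apply: exec_fr X.
Qed.

Lemma trw_while s a c n (I : nat -> state -> Prop) Q :
  okc c -> n <= W -> I n s ->
  (forall k s', k < n -> fr (While a c) s s' -> I k.+1 s' ->
     aeval s' a != 0 /\ trw W c s' (I k)) ->
  (forall s', fr (While a c) s s' -> I 0 s' -> aeval s' a = 0 /\ Q s') ->
  trw W (While a c) s Q.
Proof.
move=> ok nW I0 st en; rewrite /trw /=.
have: tri (n.+1 * ((acost a).+1 + cst W c)) (While a c) s Q.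
  have: fr (While a c) s s by apply: frl_refl.
  move: {-2}n {-2}s (leqnn n) I0 => m.
  elim: m => [|m IH] s1 mn I1 F1.
    have [a0 q] := en _ F1 I1.
    apply: tri_weak (tri_done c a0 q) _ _ => //.
    by rewrite mul1n leq_addr.
  have [a0 H] := st _ _ mn F1 I1; rewrite mulSn.
  apply: tri_loop a0 _; apply: (trw_conseq ok H) => s2 F2 I2.
  by apply: (IH s2 (ltnW mn) I2); apply: frl_trans (okc_wr ok) F1 F2.
move=> H; apply: tri_weak H _ _ => //.
by rewrite leq_mul2r ltnS nW orbT.
Qed.

Definition For x e c :=
  Seq (Assign x (Num 0))
    (While (Minus e (Reg x)) (Seq c (Assign x (Plus (Reg x) (Num 1))))).

Lemma trw_for s x e c n (I : nat -> state -> Prop) Q :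
  okc (For x e c) && (x \notin wr c) -> n <= W ->
  (forall s', fr (For x e c) s s' -> aeval s' e = n) ->
  I 0 (setr s x 0) ->
  (forall k s', k < n -> fr (For x e c) s s' -> regs s' x = k -> I k s' ->
     trw W c s' (fun s2 => I k.+1 (setr s2 x k.+1))) ->
  (forall s', fr (For x e c) s s' -> I n s' -> Q s') ->
  trw W (For x e c) s Q.
Proof.
case/andP=> ok nx nW He I0 st en.
have okF := ok; case/and3P: ok => x2 ok _.
apply: trw_seq; apply: trw_set.
have F0 : fr (For x e c) s (setr s x 0).
  split=> // [y|k i kL nk]; last by rewrite ar_setr.
  by rewrite regs_setr [wr _]/= inE negb_or => /andP[/negbTE ->].
have tr s1 : fr (While (Minus e (Reg x)) (Seq c (Assign x (Plus (Reg x) (Num 1)))))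
    (setr s x 0) s1 -> fr (For x e c) s s1.
  move=> F; apply: frl_trans F0 _; first exact: okc_wr okF.
  by apply: frl_sub F => // y; rewrite /= inE => ->; rewrite orbT.
(* The rule for [While] counts down and the loop variable counts up, hence [n - k]. *)
apply: (@trw_while _ _ _ n (fun k s' => I (n - k) s' /\ regs s' x = n - k)) => //.
- by apply/andP.
- by rewrite subnn; split; [exact: I0 | rewrite regs_setr eqxx].
- move=> k s1 kn /tr F1 [I1 x1].
  have E1 := He _ F1; split; first by rewrite /= E1 x1; lia.
  apply: trw_seq; have st1 := st (n - k.+1) s1 _ F1 x1 I1.
  apply: (trw_conseq ok (st1 _)) => [|s2 F2 I2]; first by lia.
  apply: trw_set; rewrite /= (frR F2) // x1.
  have -> : n - k.+1 + 1 = n - k by lia.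
  split; last by rewrite regs_setr eqxx.
  by move: I2; have -> : (n - k.+1).+1 = n - k by lia.
- move=> s1 /tr F1 [I1 x1]; rewrite subn0 in I1 x1; split; last exact: en.
  by rewrite /= He // x1 subnn.
Qed.

End Rules.
Arguments For : simpl never.

(** * Matrices of matched infixes *)

(** Binary with [f n] as the lowest bit: halving the number moves on to [n.+1], which is how
    [decode] reads it, and [pack] rebuilds it by doubling from the highest index down. *)
Fixpoint enc (f : nat -> bool) n c :=
  if c is c'.+1 then f n + 2 * enc f n.+1 c' else 0.

Lemma enc_lt f n c : enc f n c < 2 ^ c.
Proof.
elim: c n => //= c IH n; move: (IH n.+1); rewrite expnS; case: (f n) => /=; lia.
Qed.

Lemma enc_false n c : enc (fun=> false) n c = 0.
Proof. by elim: c n => //= c IH n; rewrite IH. Qed.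

Lemma has_iotaS p n : has p (iota 0 n.+1) = has p (iota 0 n) || p n.
Proof. by rewrite -addn1 iotaD has_cat /= orbF. Qed.

Section Matrices.
Variables (txt : nat -> nat) (S : nat).

(* The matrix of [e^*] from the matrix [f] of [e]; the fuel [c] has to be at
   least the column [j]. *)
Fixpoint sta (f : nat -> nat -> bool) c i j :=
  (i == j) ||
  (if c is c'.+1 then has (fun k => sta f c' i k && f k j) (iota 0 j) else false).

(* Symbols are numbered as in [enc_form], with 1 for chain productions. *)
Definition opm o x (f g : nat -> nat -> bool) i j :=
  match o with
  | 0 => (j == i.+1) && (txt i == x)
  | 1 => f i j
  | 2 => has (fun k => f i k && g k j) (iota 0 S)
  | 3 => f i j || g i j
  | 4 => f i j && g i j
  | 5 => sta f j i j
  | _ => (i <= j) && ~~ f i j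
  end.

Definition flat (f : nat -> nat -> bool) n := f (n %/ S) (n %% S).

Definition encm f := enc (flat f) 0 (S * S).

Lemma flatE f i j : j < S -> flat f (i * S + j) = f i j.
Proof.
move=> jS; have S0 : 0 < S by lia.
by rewrite /flat divnMDl // divn_small // addn0 modnMDl modn_small.
Qed.

Lemma encm_lt f : encm f < 2 ^ (S * S).
Proof. exact: enc_lt. Qed.

Lemma staS f c i j :
  sta f c.+1 i j = (i == j) || has (fun k => sta f c i k && f k j) (iota 0 j).
Proof. by []. Qed.

Lemma sta_fuel f c i j : j <= c -> sta f c i j = sta f j i j.
Proof.
elim: c {-2}c (leqnn c) i j => [|n IH] [|c] cn i [|j] // jc.
rewrite !staS; congr (_ || _); apply: eq_in_has => k; rewrite mem_iota add0n => kj.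
by rewrite IH ?[sta f j i k]IH //; lia.
Qed.

(** The recursion without fuel. Entry [(i, j)] needs only entries [(i, k)] with [k < j], so a row of
    the closure can be filled from left to right in place. *)
Lemma staE f i j :
  sta f j i j = (i == j) || has (fun k => sta f k i k && f k j) (iota 0 j).
Proof.
case: j => // j; rewrite staS; congr (_ || _); apply: eq_in_has => k.
by rewrite mem_iota add0n => kj; rewrite sta_fuel.
Qed.

Section Expr.
Variable Sigma : finType.
Implicit Types (e : ere Sigma) (w : seq Sigma).

Fixpoint mt e : nat -> nat -> bool :=
  match e with
  | Leaf a => opm 0 (code a) (fun _ _ => false) (fun _ _ => false)
  | Cat e1 e2 => opm 2 0 (mt e1) (mt e2)
  | Alt e1 e2 => opm 3 0 (mt e1) (mt e2)
  | Cap e1 e2 => opm 4 0 (mt e1) (mt e2)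
  | Star e1 => opm 5 0 (mt e1) (mt e1)
  | Neg e1 => opm 6 0 (mt e1) (mt e1)
  end.

Definition val e := encm (mt e).

Lemma sta_le (f : nat -> nat -> bool) c i j :
  (forall i j, f i j -> i <= j) -> sta f c i j -> i <= j.
Proof.
move=> fle; elim: c j => [|c IH] j /=; first by rewrite orbF => /eqP ->.
case/orP=> [/eqP -> //|/hasP[k _ /andP[/IH ik /fle kj]]].
exact: leq_trans ik kj.
Qed.

(** The product ranges over all [k < S]; this confines the split point to the infix, and so to the
    word that contains it. *)
Lemma mt_le e i j : mt e i j -> i <= j.
Proof.
elim: e i j => [a|e1 IH1 e2 IH2|e1 IH1 e2 IH2|e1 IH1 e2 IH2|e1 IH1|e1 IH1] i j /=.
- by case/andP=> /eqP -> _.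
- by case/hasP=> k _ /andP[/IH1 ik /IH2]; apply: leq_trans.
- by case/orP=> [/IH1|/IH2].
- by case/andP=> /IH1.
- exact: sta_le.
- by case/andP.
Qed.

Definition located i w := map txt (iota i (size w)) = map (@code Sigma) w.

Lemma located_cat i u v :
  located i (u ++ v) <-> located i u /\ located (i + size u) v.
Proof.
rewrite /located size_cat iotaD !map_cat; split=> [/eqP|[-> ->] //].
by rewrite eqseq_cat ?size_map ?size_iota // => /andP[/eqP -> /eqP ->].
Qed.

Lemma located_split i j k w : located i w -> j = i + size w -> i <= k <= j ->
  exists u v, [/\ w = u ++ v, located i u, located k v, k = i + size u &
                  j = k + size v].
Proof.
move=> lw ej /andP[ik kj]; exists (take (k - i) w), (drop (k - i) w).
have sz : size (take (k - i) w) = k - i by rewrite size_takel //; lia.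
have sz' : size (drop (k - i) w) = j - k by rewrite size_drop; lia.
move: lw; rewrite -{1}(cat_take_drop (k - i) w) => /located_cat[l1].
have eik : i + (k - i) = k by lia.
by rewrite sz eik => l2; split; rewrite ?cat_take_drop ?sz ?sz' //; lia.
Qed.

(** [sta] peels off the last factor, which is nonempty because [k < j]. Conversely, a list of
    factors is consumed from its end and empty factors are dropped. *)
Lemma sta_lang e i w :
  (forall i w, i + size w < S -> located i w ->
     mt e i (i + size w) <-> lang e w) ->
  i + size w < S -> located i w ->
  sta (mt e) (i + size w) i (i + size w) <-> lang (Star e) w.
Proof.
move=> IH jS lw; split.
  suff H c j w' : j < S -> located i w' -> i + size w' = j ->
      sta (mt e) c i j -> lang (Star e) w' by apply: (H _ _ w jS lw).
  elim: c j w' => [|c IHc] j {}w {lw} {}jS lw ej /=.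
    rewrite orbF => /eqP ij; exists [::]; split=> //; apply/size0nil; lia.
  case/orP=> [/eqP ij|/hasP[k]]; first by exists [::]; split=> //; apply/size0nil; lia.
  rewrite mem_iota /= => kj /andP[sk mk].
  have ik : i <= k by apply: sta_le sk; apply: mt_le.
  have [|u [v [ew lu lv ek ej']]] := located_split (k := k) lw (esym ej).
    by rewrite ik ltnW.
  have [|ws [eu Hws]] := IHc k u _ lu (esym ek) sk; first by lia.
  exists (rcons ws v); rewrite ew eu -cats1 flatten_cat /= cats0; split=> // z.
  rewrite mem_cat inE => /orP[/Hws //|/eqP ->].
  by apply/(IH k); rewrite -?ej'.
case=> ws [ew Hws]; move: jS lw; rewrite ew => {w ew}.
elim/last_ind: ws Hws => [|ws v IHws] Hws /=.
  by rewrite addn0 staE eqxx.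
rewrite -cats1 flatten_cat /= cats0 => jS /located_cat[l1 l2].
have Hv : lang e v by apply: Hws; rewrite mem_rcons inE eqxx.
have {}IHws : sta (mt e) (i + size (flatten ws)) i (i + size (flatten ws)).
  apply: IHws => //; first by move=> u uws; apply: Hws; rewrite mem_rcons inE uws orbT.
  by apply: leq_ltn_trans jS; rewrite leq_add2l size_cat leq_addr.
(* An empty last factor leaves the infix unchanged, so the induction hypothesis already gives the
   entry. *)
case: (posnP (size v)) => [v0|v0]; first by rewrite (size0nil v0) cats0.
rewrite staE; apply/orP; right; apply/hasP; exists (i + size (flatten ws)).
  by rewrite mem_iota /= add0n size_cat ltn_add2l -[X in X < _]addn0 ltn_add2l.
rewrite IHws size_cat addnA /=; apply/(IH (i + size (flatten ws))) => //.
by rewrite -addnA -size_cat.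
Qed.

(** A text of [S - 1] cells has [S] positions, the end included. The bound makes the end of [w], and
    with it every split point inside [w], an index of the matrix. *)
Lemma mt_lang e i w : i + size w < S -> located i w ->
  mt e i (i + size w) <-> lang e w.
Proof.
elim: e i w => [a|e1 IH1 e2 IH2|e1 IH1 e2 IH2|e1 IH1 e2 IH2|e1 IH1|e1 IH1] i w wS lw.
- rewrite /= -addn1 eqn_add2l; case: w wS lw => [|b [|c w]] //= _ [->].
  by split=> [/eqP/ord_inj/enum_rank_inj -> //|[->]].
- rewrite /=; split=> [/hasP[k _ /andP[m1 m2]]|[u [v [ew L1 L2]]]].
    have [|u [v [ew lu lv ek ej]]] := located_split (k := k) lw erefl.
      by rewrite (mt_le m1) (mt_le m2).
    exists u, v; split=> //.
      by apply/(IH1 i u) => //; rewrite -?ek //; lia.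
    by apply/(IH2 k v) => //; rewrite -?ej //; lia.
  move: wS lw; rewrite ew size_cat => wS /located_cat[lu lv].
  apply/hasP; exists (i + size u); first by rewrite mem_iota; lia.
  apply/andP; split; first by apply/(IH1 i u) => //; lia.
  by rewrite addnA; apply/(IH2 (i + size u) v) => //; lia.
- rewrite /=; split=> [/orP[/IH1|/IH2]|[/IH1|/IH2]] H; rewrite ?H ?orbT //;
  by [left; apply: H | right; apply: H].
- rewrite /=; split=> [/andP[/IH1 H1 /IH2 H2]|[/IH1 H1 /IH2 H2]].
    by split; [apply: H1|apply: H2].
  by rewrite H1 ?H2.
- exact: sta_lang.
- rewrite /= leq_addr /=; split=> [/negP n L|n]; first by apply: n; apply/IH1.
  by apply/negP => /IH1; auto.
Qed.

End Expr.
End Matrices.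

(** * Evaluating one operation on encoded matrices *)

Notation "c ;; d" := (Seq c d) (at level 95, right associativity).
Notation "x :== a" := (Assign x a) (at level 94).

(* Subtraction is truncated, so this is nonzero iff the values differ. *)
Definition Diff a b := Plus (Minus a b) (Minus b a).

(** There is no division: 2 is subtracted from register 20 as long as possible while register 21
    counts. What is left in register 20 is the bit, and the count is the half to go on with. *)
Definition decode v k :=
  20 :== Reg v;;
  For 22 (Reg 5) (
    21 :== Num 0;;
    While (Minus (Reg 20) (Num 1)) (
      20 :== Minus (Reg 20) (Num 2);;
      21 :== Plus (Reg 21) (Num 1));;
    Put k (Reg 22) (Reg 20);;
    20 :== Reg 21).

(** One entry of a Boolean product: register 25 holds the offset [i * S] of the row, and register 28
    runs down column [j] in strides of [S]. With array 14 as first factor and bound [j] it is the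
    recursion for the star, reading the row under construction. *)
Definition scan k1 k2 bnd :=
  26 :== Num 0;;
  28 :== Reg 24;;
  For 27 (Reg bnd) (
    If (Ar k1 (Plus (Reg 25) (Reg 27)))
      (If (Ar k2 (Reg 28)) (26 :== Num 1) Skip) Skip;;
    28 :== Plus (Reg 28) (Reg 4)).

(** The tests run downwards from 5 because truncated subtraction only tells whether the operation
    number exceeds a constant. In the case of a letter, [Deref (Reg 23)] reads the text itself: its
    cell [i] is memory cell [i]. *)
Definition bitc :=
  let n := Plus (Reg 25) (Reg 24) in
  If (Minus (Reg 9) (Num 5))
    (If (Minus (Reg 23) (Reg 24)) (26 :== Num 0) (26 :== Minus (Num 1) (Ar 12 n)))
  (If (Minus (Reg 9) (Num 4))
    (If (Diff (Reg 23) (Reg 24)) (scan 14 12 24) (26 :== Num 1))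
  (If (Minus (Reg 9) (Num 3))
    (If (Ar 12 n) (26 :== Ar 13 n) (26 :== Num 0))
  (If (Minus (Reg 9) (Num 2))
    (If (Ar 12 n) (26 :== Num 1) (26 :== Ar 13 n))
  (If (Minus (Reg 9) (Num 1))
    (scan 12 13 4)
  (If (Reg 9)
    (26 :== Ar 12 n)
    (If (Diff (Reg 24) (Plus (Reg 23) (Num 1))) (26 :== Num 0)
      (If (Diff (Deref (Reg 23)) (Reg 19)) (26 :== Num 0) (26 :== Num 1)))))))).

Definition bits :=
  25 :== Num 0;;
  For 23 (Reg 4) (
    For 24 (Reg 4) (bitc;; Put 14 (Plus (Reg 25) (Reg 24)) (Reg 26));;
    25 :== Plus (Reg 25) (Reg 4)).

Definition pack :=
  29 :== Num 0;;
  22 :== Reg 5;;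
  While (Reg 22) (
    22 :== Minus (Reg 22) (Num 1);;
    29 :== Plus (Plus (Reg 29) (Reg 29)) (Ar 14 (Reg 22))).

Definition calc := decode 17 12;; decode 18 13;; bits;; pack.

Ltac sim := rewrite ?stE /= ?stE /= ?ar_setr //=.

Section Calc.
Variables (inp : nat -> nat) (S B : nat).

Definition env s :=
  [/\ 0 < S <= B, regs s 2 = B, regs s 4 = S,
      regs s 5 = S * S /\ regs s 6 = 2 ^ (S * S) &
      forall a, a < B -> mem s a = inp a].

Definition oke c := all (fun x => x \notin wr c) [:: 2; 4; 5; 6].

Lemma env_fr c s s' : fr c s s' -> oke c -> env s -> env s'.
Proof.
move=> F /and4P[n2 n4 n5 /andP[n6 _]] [e1 e2 e3 [e4 e5] e6]; split=> //.
- by rewrite (frR F).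
- by rewrite (frR F).
- by rewrite !(frR F).
- by move=> a aB; rewrite (frM F) ?e2 // e6.
Qed.

Lemma env_setr s x v : x \notin [:: 2; 4; 5; 6] -> env s -> env (setr s x v).
Proof.
rewrite !inE !negb_or ![x == _]eq_sym => /and4P[/negbTE n2 /negbTE n4 /negbTE n5 /negbTE n6].
by case=> e1 e2 e3 [e4 e5] e6; split; rewrite ?regs_setr ?n2 ?n4 ?n5 ?n6.
Qed.

Lemma env_seta s k i v : env s -> env (seta s k i v).
Proof.
case=> e1 e2 e3 e4 e5; split=> // a aB.
by rewrite mem_seta ?e2 // e5.
Qed.

Lemma S_W : S * S <= 2 ^ (S * S).
Proof. by rewrite ltnW // ltn_expl. Qed.

Lemma decode_spec v k f s : v \notin [:: 20; 21; 22] -> k < 16 -> 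
  okc (decode v k) -> env s -> regs s v = enc f 0 (S * S) ->
  trw (2 ^ (S * S)) (decode v k) s
    (fun s' => forall n, n < S * S -> ar s' k n = f n).
Proof.
move=> nv kL ok E Ev; have E0 := E; case: E0 => _ e2 e4 [e5 e6] em.
apply: trw_seq; apply: trw_set.
apply: (trw_for (n := S * S) (I := fun n s' =>
  regs s' 20 = enc f n (S * S - n) /\ forall m, m < n -> ar s' k m = f m)).
- by move: ok; rewrite /decode /= !andbT.
- exact: S_W.
- move=> s1 F; rewrite /= (frR F) //.
- by sim; rewrite Ev subn0; split.
- move=> k0 s1 kL1 F x1 [t1 H1].
  apply: trw_seq; apply: trw_set; sim.
  move: t1; have -> : S * S - k0 = (S * S - k0.+1).+1 by lia.
  set h := enc f k0.+1 (S * S - k0.+1); rewrite -[enc _ _ _]/(f k0 + 2 * h) => t1.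
  apply: trw_seq; apply: (trw_while (n := h)
    (I := fun r s' => regs s' 20 = f k0 + 2 * r /\ regs s' 21 + r = h)) => //.
  + by apply: leq_trans (ltnW (enc_lt _ _ _)) _; rewrite leq_pexp2l // leq_subr.
  + move=> r s2 rn F2 [t2 h2]; split; first by rewrite /= t2; lia.
    by apply: trw_seq; do 2 (apply: trw_set; sim); split; lia.
  + move=> s2 F2 [t2 h2]; split; first by rewrite /= t2; case: (f k0).
    apply: trw_seq; apply: trw_put; apply: trw_set; sim.
    split; first by lia.
    move=> m ml; sim; rewrite ar_seta // eqxx (frR F2) // stE /= x1 t2 muln0 addn0.
    case: eqP => [->//|/eqP nm]; rewrite (frA F2) ?kL //; sim; rewrite // H1 //.
    by rewrite ltn_neqAle nm -ltnS.
- by move=> s1 _ [_ H1].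
Qed.

Lemma idx_lt i j : i < S -> j < S -> i * S + j < S * S.
Proof. by move=> iS jS; rewrite (leq_trans (n := i.+1 * S)) ?leq_mul2r ?iS ?orbT //; lia. Qed.

Lemma scan_spec k1 k2 bnd n i j (f g : nat -> bool) s :
  (k1 < 16) && (k2 < 16) -> bnd \in [:: 4; 24] -> env s -> regs s bnd = n ->
  n <= S -> regs s 25 = i * S -> regs s 24 = j ->
  (forall k, k < n -> ar s k1 (i * S + k) = f k) ->
  (forall k, k < n -> ar s k2 (k * S + j) = g k) ->
  trw (2 ^ (S * S)) (scan k1 k2 bnd) s
    (fun s' => regs s' 26 = has (fun k => f k && g k) (iota 0 n)).
Proof.
move=> /andP[k1L k2L] bb E En nS Ei Ej Hf Hg; case: (E) => /andP[S0 _] _ e4 _ _.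
have nb : (bnd == 26 = false) * (bnd == 27 = false) * (bnd == 28 = false).
  by move: bb; rewrite !inE => /orP[] /eqP ->.
do 2 (apply: trw_seq; apply: trw_set; sim).
apply: (trw_for (n := n) (I := fun k s' =>
  regs s' 26 = has (fun k => f k && g k) (iota 0 k) /\ regs s' 28 = k * S + j)) => //.
- by apply: leq_trans nS _; apply: leq_trans S_W; rewrite leq_pmulr.
- by move=> s1 F; rewrite /= (frR F) /= ?stE ?inE ?nb.
- move=> k s1 kn F x1 [h1 m1]; apply: trw_seq; rewrite has_iotaS.
  have E1 : ar s1 k1 (i * S + k) = f k by rewrite (frA F) ?k1L //; sim; rewrite Hf.
  have E2 : ar s1 k2 (k * S + j) = g k by rewrite (frA F) ?k2L //; sim; rewrite Hg.
  have x4 : regs s1 4 = S by rewrite (frR F) //; sim.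
  have x25 : regs s1 25 = i * S by rewrite (frR F) //; sim.
  apply: trw_if; sim; rewrite x1 x25 E1 => fk.
    apply: trw_if; sim; rewrite m1 E2 => gk.
      apply: trw_set; apply: trw_set; sim; rewrite m1 x4.
      by split; [case: (f k) fk (g k) gk => // _ []; rewrite // orbT | lia].
    apply: trw_skip; apply: trw_set; sim; rewrite m1 x4.
    by split; [rewrite h1; case: (g k) gk => // _; rewrite andbF orbF | lia].
  apply: trw_skip; apply: trw_set; sim; rewrite m1 x4.
  by split; [rewrite h1; case: (f k) fk => // _; rewrite orbF | lia].
- by move=> s1 _ [].
Qed.

Lemma Diff_eq0 s a b : (aeval s (Diff a b) == 0) = (aeval s a == aeval s b).
Proof. by rewrite /=; lia. Qed.

(** Array 14 is assumed correct only up to the current entry in row-major order. By [staE] this is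
    enough for the star. *)
Lemma bitc_spec o x i j (f g : nat -> nat -> bool) s :
  env s -> o <= 6 -> regs s 9 = o -> regs s 19 = x -> i < S -> j < S ->
  regs s 23 = i -> regs s 24 = j -> regs s 25 = i * S ->
  (forall n, n < S * S -> ar s 12 n = flat S f n) ->
  (forall n, n < S * S -> ar s 13 n = flat S g n) ->
  (forall n, n < i * S + j -> ar s 14 n = flat S (opm inp S o x f g) n) ->
  trw (2 ^ (S * S)) bitc s (fun s' => regs s' 26 = opm inp S o x f g i j).
Proof.
move=> E o6 r9 r19 iS jS r23 r24 r25 b1 b2 b3.
have ij := idx_lt iS jS.
have B1 : ar s 12 (i * S + j) = f i j by rewrite b1 ?flatE.
have B2 : ar s 13 (i * S + j) = g i j by rewrite b2 ?flatE.
case: (E) => /andP[S0 SB] _ e4 _ em.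
have Lf k : k < S -> ar s 12 (i * S + k) = f i k.
  by move=> kS; rewrite b1 ?flatE ?idx_lt.
apply: trw_if => /= [|]; rewrite r9 => H5.
  have -> : o = 6 by lia.
  apply: trw_if; rewrite /= r23 r24 => D; apply: trw_set; sim.
    by have -> : i <= j = false by lia.
  rewrite r24 r25 B1; have -> : i <= j by lia.
  by case: (f i j).
apply: trw_if => /= [|]; rewrite r9 => H4.
  have eo : o = 5 by lia.
  rewrite {}eo in b3 *; apply: trw_if; rewrite -?Diff_eq0; sim; rewrite r23 r24 => D; last first.
    by apply: trw_set; sim; rewrite staE; have -> : i == j by lia.
  apply: (trw_conseq (P := fun s' => regs s' 26 = has (fun k => sta f k i k && f k j) (iota 0 j))) => //.
    apply: (scan_spec (i := i) (j := j)) => //; first by lia.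
      by move=> k kj; rewrite b3 ?flatE //; lia.
    by move=> k kj; rewrite b1 ?flatE ?idx_lt //; lia.
  by move=> s1 _ ->; rewrite staE; have -> : i == j = false by lia.
apply: trw_if => /= [|]; rewrite r9 => H3.
  have -> : o = 4 by lia.
  apply: trw_if; sim; rewrite r24 r25 B1 => D; apply: trw_set; sim.
    by rewrite r24 r25 B2; case: (f i j) D.
  by case: (f i j) D.
apply: trw_if => /= [|]; rewrite r9 => H2.
  have -> : o = 3 by lia.
  apply: trw_if; sim; rewrite r24 r25 B1 => D; apply: trw_set; sim.
    by case: (f i j) D.
  by rewrite r24 r25 B2; case: (f i j) D.
apply: trw_if => /= [|]; rewrite r9 => H1.
  have -> : o = 2 by lia.
  apply: (scan_spec (i := i) (j := j)) => // k kS.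
  by rewrite b2 ?flatE ?idx_lt.
apply: trw_if => /= [|]; rewrite r9 => H0.
  have -> : o = 1 by lia.
  by apply: trw_set; sim; rewrite r24 r25 B1.
rewrite H0; apply: trw_if; rewrite /= r23 r24 => D.
  by apply: trw_set; sim; have -> : j == i.+1 = false by lia.
have ej : j == i.+1 by lia.
have mi : mem s i = inp i by apply: em; lia.
apply: trw_if; rewrite /= r23 r19 mi => D'; apply: trw_set; sim; rewrite ej /=.
  by have -> : inp i == x = false by lia.
by have -> : inp i == x by lia.
Qed.

Lemma bits_spec o x (f g : nat -> nat -> bool) s :
  env s -> o <= 6 -> regs s 9 = o -> regs s 19 = x ->
  (forall n, n < S * S -> ar s 12 n = flat S f n) ->
  (forall n, n < S * S -> ar s 13 n = flat S g n) ->
  trw (2 ^ (S * S)) bits s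
   (fun s' => forall n, n < S * S -> ar s' 14 n = flat S (opm inp S o x f g) n).
Proof.
move=> E o6 r9 r19 b1 b2; case: (E) => /andP[S0 SB] _ e4 _ em.
set F := flat S _.
have SW : S <= 2 ^ (S * S) by apply: leq_trans S_W; rewrite leq_pmulr.
apply: trw_seq; apply: trw_set.
apply: (trw_for (n := S) (I := fun i s' => regs s' 25 = i * S /\
   forall n, n < i * S -> ar s' 14 n = F n)) => //.
- by move=> s1 Fr; rewrite /= (frR Fr).
- move=> i s1 iS F1 r23 [r25 h1]; apply: trw_seq.
  apply: (trw_for (n := S) (I := fun j s' =>
     forall n, n < i * S + j -> ar s' 14 n = F n)) => //.
  + by move=> s2 F2; rewrite /= (frR F2) // (frR F1).
  + by move=> n; rewrite addn0; sim; apply: h1.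
  + move=> j s2 jS F2 r24 h2; apply: trw_seq.
    have r25' : regs s2 25 = i * S by rewrite (frR F2).
    apply: (trw_conseq (P := fun s' => regs s' 26 = opm inp S o x f g i j)) => //.
      apply: bitc_spec => //.
      * by apply: env_fr F2 _ _ => //; apply: env_fr F1 _ _.
      * by rewrite (frR F2) // (frR F1).
      * by rewrite (frR F2) // (frR F1).
      * by rewrite (frR F2).
      * by move=> n nS; rewrite (frA F2) // (frA F1) //; sim; apply: b1.
      * by move=> n nS; rewrite (frA F2) // (frA F1) //; sim; apply: b2.
    move=> s3 F3 x3; apply: trw_put => n nL; sim; rewrite ar_seta //.
    rewrite eqxx x3 !(frR F3) // r25' r24 /=.
    case: eqP => [->|/eqP ne]; first by rewrite /F flatE.
    by rewrite (frA F3) // h2 //; lia.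
  + move=> s2 F2 h2; apply: trw_set; sim.
    have -> : regs s2 25 = i * S by rewrite (frR F2) //; sim.
    have -> : regs s2 4 = S by rewrite (frR F2) //; sim; rewrite (frR F1).
    split; first by lia.
    by move=> n nL; sim; apply: h2; lia.
- by move=> s1 _ [].
Qed.

Lemma pack_spec f s : env s -> (forall n, n < S * S -> ar s 14 n = flat S f n) ->
  trw (2 ^ (S * S)) pack s (fun s' => regs s' 29 = encm S f).
Proof.
move=> E b3; case: (E) => _ _ _ [e5 e6] _.
do 2 (apply: trw_seq; apply: trw_set; sim).
apply: (trw_while (n := S * S) (I := fun n s' => n <= S * S /\ regs s' 22 = n /\
   regs s' 29 = enc (flat S f) n (S * S - n))) => //.
- exact: S_W.
- by sim; rewrite subnn e5.
- move=> n s1 nS F [_ [r22 r29]]; split; first by rewrite /= r22.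
  apply: trw_seq; do 2 (apply: trw_set; sim); rewrite r22 r29 subn1 /=.
  rewrite (frA F) //; sim; rewrite b3 //; split; first by apply: ltnW.
  split=> //; have -> : S * S - n = (S * S - n.+1).+1 by lia.
  by rewrite /=; lia.
- by move=> s1 F [_ [r22 r29]]; rewrite /= r22 r29 subn0.
Qed.

Lemma calc_spec o x (f g : nat -> nat -> bool) s :
  env s -> o <= 6 -> regs s 9 = o -> regs s 19 = x ->
  regs s 17 = encm S f -> regs s 18 = encm S g ->
  trw (2 ^ (S * S)) calc s (fun s' => regs s' 29 = encm S (opm inp S o x f g)).
Proof.
move=> E o6 r9 r19 r17 r18.
apply: trw_seq; apply: (trw_conseq _ (decode_spec (f := flat S f) _ _ _ E _)) => // s1 F1 b1.
have E1 := env_fr F1 isT E.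
apply: trw_seq; apply: (trw_conseq _ (decode_spec (f := flat S g) _ _ _ E1 _)) => //.
  by rewrite (frR F1).
move=> s2 F2 b2; have E2 := env_fr F2 isT E1.
apply: trw_seq; apply: (trw_conseq _ (bits_spec (o := o) (x := x) (f := f) (g := g) E2 _ _ _ _ _)) => //.
- by rewrite (frR F2) // (frR F1).
- by rewrite (frR F2) // (frR F1).
- by move=> n nS; rewrite (frA F2) // b1.
by move=> s3 F3 b3; apply: pack_spec => //; apply: env_fr F3 _ _.
Qed.

End Calc.

(** * Big-step derivations of tree grammars *)

(* The value for [o = 1] serves chain productions. *)
Definition app A o (e1 e2 : ere A) :=
  match o with
  | 1 => e1
  | 2 => Cat e1 e2
  | 3 => Alt e1 e2
  | 4 => Cap e1 e2
  | 5 => Star e1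
  | _ => Neg e1
  end.

Section Grammar.
Variables (Sigma : finType) (G : rtg Sigma).
Implicit Types (t : form Sigma (nonterm G)) (e : ere Sigma).

Inductive gen : form Sigma (nonterm G) -> ere Sigma -> Prop :=
| gen_leaf a : gen (Leaf (inl a)) (Leaf a)
| gen_prod X t e of List.In (X, t) (prods G) & gen t e : gen (Leaf (inr X)) e
| gen_cat t1 t2 e1 e2 of gen t1 e1 & gen t2 e2 : gen (Cat t1 t2) (Cat e1 e2)
| gen_alt t1 t2 e1 e2 of gen t1 e1 & gen t2 e2 : gen (Alt t1 t2) (Alt e1 e2)
| gen_cap t1 t2 e1 e2 of gen t1 e1 & gen t2 e2 : gen (Cap t1 t2) (Cap e1 e2)
| gen_star t e of gen t e : gen (Star t) (Star e)
| gen_neg t e of gen t e : gen (Neg t) (Neg e).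

Lemma gen_app o t1 t2 e1 e2 :
  gen t1 e1 -> gen t2 e2 -> gen (app o t1 t2) (app o e1 e2).
Proof. by case: o => [|[|[|[|[|[|o]]]]]] //= g1 g2; constructor. Qed.

Lemma gen_id e : gen (ere_map inl e) e.
Proof. by elim: e => /= *; constructor. Qed.

(** Expansion of the source preserves [gen]; a rewriting sequence is therefore absorbed step by
    step, backwards from its final tree. *)
Lemma gen_step t t' e : step t t' -> gen t' e -> gen t e.
Proof.
move=> st; elim: st e => {t t'} [X t Xt|||||||| ] *;
  first exact: gen_prod Xt _.
all: match goal with H : gen (_ _) _ |- _ => inversion H; subst end.
all: by constructor; auto.
Qed.

Local Notation steps := (Relation_Operators.clos_refl_trans _ (@step Sigma G)).

Lemma steps_map (f : form Sigma (nonterm G) -> form Sigma (nonterm G)) t t' :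
  (forall t t', step t t' -> step (f t) (f t')) -> steps t t' -> steps (f t) (f t').
Proof.
move=> H; elim=> *; [apply: Relation_Operators.rt_step; exact: H|
  exact: Relation_Operators.rt_refl|apply: Relation_Operators.rt_trans; eassumption].
Qed.

Lemma gen_steps t e : gen t e -> steps t (ere_map inl e).
Proof.
elim=> {t e} [a|X t e Xt _ IH|t1 t2 e1 e2 _ IH1 _ IH2|t1 t2 e1 e2 _ IH1 _ IH2
  |t1 t2 e1 e2 _ IH1 _ IH2|t e _ IH|t e _ IH] /=.
- exact: Relation_Operators.rt_refl.
- by apply: Relation_Operators.rt_trans IH; apply/Relation_Operators.rt_step/step_prod.
- apply: (Relation_Operators.rt_trans _ _ _ (Cat (ere_map inl e1) t2)).
    by apply: (steps_map (f := fun t => Cat t t2)) IH1 => *; apply: step_catl.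
  by apply: (steps_map (f := Cat _)) IH2 => *; apply: step_catr.
- apply: (Relation_Operators.rt_trans _ _ _ (Alt (ere_map inl e1) t2)).
    by apply: (steps_map (f := fun t => Alt t t2)) IH1 => *; apply: step_altl.
  by apply: (steps_map (f := Alt _)) IH2 => *; apply: step_altr.
- apply: (Relation_Operators.rt_trans _ _ _ (Cap (ere_map inl e1) t2)).
    by apply: (steps_map (f := fun t => Cap t t2)) IH1 => *; apply: step_capl.
  by apply: (steps_map (f := Cap _)) IH2 => *; apply: step_capr.
- by apply: steps_map IH => *; apply: step_star.
- by apply: steps_map IH => *; apply: step_neg.
Qed.

Lemma tree_lang_gen e : tree_lang G e <-> gen (Leaf (inr (start G))) e.
Proof.
split=> [H|]; last exact: gen_steps.
have {H} := Operators_Properties.clos_rt_rt1n _ _ _ _ H.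
move: (gen_id e); move: (Leaf _) (ere_map _ _) => t u gu H.
by elim: H gu => // t1 t2 t3 st _ IH /IH; apply: gen_step.
Qed.

End Grammar.

(** * The table of derived facts *)

(** A chain production adds no symbol, so its record copies the three cells of the fact it comes
    from. Every other record holds its symbol and then the letter or the addresses of the argument
    records. *)
Definition wit :=
  If (Diff (Reg 9) (Num 1))
    (Put 0 (Reg 30) (Reg 9);;
     If (Reg 9) (Put 1 (Reg 30) (Pt (Plus (Reg 15) (Reg 17))))
       (Put 1 (Reg 30) (Reg 19));;
     Put 2 (Reg 30) (Pt (Plus (Reg 16) (Reg 18))))
    (Put 0 (Reg 30) (Ar 0 (Plus (Reg 15) (Reg 17)));;
     Put 1 (Reg 30) (Ar 1 (Plus (Reg 15) (Reg 17)));;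
     Put 2 (Reg 30) (Ar 2 (Plus (Reg 15) (Reg 17)))).

(** Register 14 holds the offset of the node and register 29 the value. Array 3 flags the facts
    already present; array 10 is the queue, which receives the node only. *)
Definition add :=
  30 :== Plus (Reg 14) (Reg 29);;
  If (Ar 3 (Reg 30)) Skip
    (wit;; Put 3 (Reg 30) (Num 1);; Put 10 (Reg 13) (Reg 14);;
     13 :== Plus (Reg 13) (Num 1)).

Definition derive := calc;; add.

Section Facts.
Variables (Sigma : finType) (G : rtg Sigma).
Variables (inp : nat -> nat) (S B : nat).
Implicit Types (e : ere Sigma) (nd : seq (form Sigma (nonterm G))).

Local Notation W := (2 ^ (S * S)).
Local Notation env := (env inp S B).
Local Notation val := (@val inp S Sigma).
Local Notation mt := (@mt inp S Sigma).

Lemma val_lt e : val e < W.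
Proof. exact: encm_lt. Qed.

Lemma val_app o x e1 e2 : 0 < o <= 6 ->
  val (app o e1 e2) = encm S (opm inp S o x (mt e1) (mt e2)).
Proof. by case: o => [|[|[|[|[|[|[|o]]]]]]]. Qed.

Definition pr s f := ar s 3 f != 0.

(* Unlike in [tree_at], all nodes have to be facts of the table: since facts are
   never overwritten, such trees survive later additions. *)
Inductive htree s : nat -> ere Sigma -> Prop :=
| htree_leaf f a of pr s f & ar s 0 f = 0 & ar s 1 f = code a :
    htree s f (Leaf a)
| htree_app o f f1 f2 e1 e2 of 1 < o <= 6 & pr s f & ar s 0 f = o &
    ar s 1 f = B + 16 * f1 & ar s 2 f = B + 16 * f2 &
    htree s f1 e1 & htree s f2 e2 :
    htree s f (app o e1 e2).

Lemma htree_pr s f e : htree s f e -> pr s f.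
Proof. by case. Qed.

Lemma htree_ext s s' f e :
  (forall f, pr s f -> pr s' f) ->
  (forall k f, k < 3 -> pr s f -> ar s' k f = ar s k f) ->
  htree s f e -> htree s' f e.
Proof.
move=> H1 H2; elim=> {f e} [f a pf h0 h1|o f f1 f2 e1 e2 ol pf h0 h1 h2 _ IH1 _ IH2].
  by apply: htree_leaf; rewrite ?H2 //; apply: H1.
by apply: (htree_app (f1 := f1) (f2 := f2)); rewrite ?H2 //; apply: H1.
Qed.

(** For chain productions: a record with the same three cells shares the children of the
    original. *)
Lemma htree_copy s s' f f' e : htree s f e ->
  (forall f e, htree s f e -> htree s' f e) -> pr s' f' ->
  (forall k, k < 3 -> ar s' k f' = ar s k f) -> htree s' f' e.
Proof.
move=> H; case: H f' => {f e} [f a _ h0 h1|o f f1 f2 e1 e2 ol _ h0 h1 h2 H1 H2] f' E pf' H.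
  by apply: htree_leaf; rewrite ?H.
by apply: (htree_app (f1 := f1) (f2 := f2)); rewrite ?H //; apply: E.
Qed.

Lemma htree_at s f e : regs s 2 = B -> htree s f e ->
  tree_at (mem s) (B + 16 * f) e.
Proof.
move=> sB; elim=> {f e} [f a _|o f f1 f2 e1 e2 ol _]; rewrite !arE sB addn0 addn1.
  by [].
rewrite addn2 => h0 h1 h2 _ H1 _ H2.
by case: o ol h0 => [|[|[|[|[|[|[|o]]]]]]] //= _ h0; rewrite h0 h1 ?h2.
Qed.

Lemma idW g v g' v' : v < W -> v' < W -> g * W + v = g' * W + v' -> g = g' /\ v = v'.
Proof.
move=> vW vW' E; have W0 : 0 < W by rewrite expn_gt0.
have := congr1 (fun n => n %/ W) E; have := congr1 (fun n => n %% W) E.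
by rewrite !modnMDl !modn_small // !divnMDl // !divn_small // !addn0.
Qed.

Local Notation node nd g := (nth (Leaf (inr (start G))) nd g).

(** [nd] is a ghost list giving the form that each node stands for. [q] is the whole history of the
    queue, since a pop only advances the head in register 12. By [f_count] each occurrence of [g] in
    [q] is paid for by one of its [W] facts becoming present, so [g] is queued at most [W] times. *)
Record facts nd q s : Prop := Facts {
  f_env : env s;
  f_sound : forall g v, v < W -> pr s (g * W + v) -> g < size nd /\
    exists e, [/\ gen (node nd g) e, v = val e & htree s (g * W + v) e];
  f_size : regs s 13 = size q;
  f_queue : forall i, i < size q -> ar s 10 i = nth 0 q i * W;
  f_nodes : forall g, g \in q -> g < size nd;
  f_count : forall g, \sum_(v < W) ~~ pr s (g * W + v) + count_mem g q <= W
}.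

Definition okf c := [&& oke c, 13 \notin wr c & all (fun k => k \notin wa c) [:: 0; 1; 2; 3; 10]].

Lemma fr_pr c s s' f : fr c s s' -> 3 \notin wa c -> pr s' f = pr s f.
Proof. by move=> F n3; rewrite /pr (frA F). Qed.

Lemma fr_htree c s s' f e : fr c s s' -> all (fun k => k \notin wa c) [:: 0; 1; 2; 3] ->
  htree s f e -> htree s' f e.
Proof.
move=> F /allP n.
apply: htree_ext => [g|k g k3 _]; first by rewrite (fr_pr _ F) // n.
by rewrite (frA F) //; move: k3; case: k => [|[|[|k]]] // _; rewrite n.
Qed.

Lemma facts_fr c nd q s s' : fr c s s' -> okf c -> facts nd q s -> facts nd q s'.
Proof.
move=> F /and3P[oe n13 nw] [H1 H2 H3 H4 H5 H6].
have n := allP nw.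
have P f : pr s' f = pr s f by rewrite (fr_pr _ F) // n.
split=> //.
- exact: env_fr F oe H1.
- move=> g v vW; rewrite P => /H2 - /(_ vW) [gn [e [ge ve he]]]; split=> //.
  exists e; split=> //; apply: fr_htree F _ he.
  by apply/allP => k kk; apply: n; move: kk; rewrite /= !inE => /or4P[] ->; rewrite ?orbT.
- by rewrite (frR F).
- by move=> i iq; rewrite (frA F) ?n // H4.
- by move=> g; under eq_bigr do rewrite P.
Qed.

Definition witness_ready s o x a b e :=
  [\/ o = 0 /\ exists2 c, e = Leaf c & x = code c,
      o = 1 /\ htree s a e |
      1 < o <= 6 /\ exists e1 e2, [/\ e = app o e1 e2, htree s a e1 & htree s b e2]].

(** The record is written before its flag is set. So the conclusion speaks of later states [s2] in
    which [f] is present, its cells are as [wit] left them, and older trees survive. *)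
Lemma wit_spec o x a b v1 v2 f e s :
  regs s 2 = B -> regs s 9 = o -> regs s 19 = x -> regs s 15 = a ->
  regs s 16 = b -> regs s 17 = v1 -> regs s 18 = v2 -> regs s 30 = f ->
  witness_ready s o x (a + v1) (b + v2) e -> ~~ pr s f ->
  trw W wit s (fun s' =>
    (forall k f', k < 3 -> f' != f -> ar s' k f' = ar s k f') /\
    (forall s2, pr s2 f -> (forall k, k < 3 -> ar s2 k f = ar s' k f) ->
      (forall f' e', htree s f' e' -> htree s2 f' e') -> htree s2 f e)).
Proof.
move=> r2 r9 r19 ra rb r1 r2' rf [[o0 [c ec xc]]|[o1 ht]|[ol [e1 [e2 [ee h1 h2]]]]] npf.
- apply: trw_if => /=; rewrite r9 o0 // => _.
  apply: trw_seq; apply: trw_put; apply: trw_seq; apply: trw_if; sim; rewrite r9 o0 // => _.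
  do 2 (apply: trw_put; sim); rewrite rf; split=> [k f' k3 nf|s2 p2 H2 _].
    by rewrite !ar_seta ?(negbTE nf) ?andbF //; lia.
  have H0 := H2 0 isT; have H1 := H2 1 isT.
  rewrite !ar_seta // eqxx /= in H0 H1.
  by rewrite ec; apply: htree_leaf; rewrite ?H0 ?H1 //; sim; rewrite ?r9 ?o0 ?r19.
- apply: trw_if; first by rewrite /= r9 o1.
  move=> _; do 2 (apply: trw_seq; apply: trw_put; sim); apply: trw_put; sim.
  rewrite rf ra r1; split=> [k f' k3 nf|s2 p2 H2 E2].
    by rewrite !ar_seta ?(negbTE nf) ?andbF //; lia.
  (* The source of the copy is present and the target is absent, so they are different records and
     the copy never reads a cell it has just written. *)
  have ne : a + v1 == f = false.
    by apply/negbTE; apply: contra npf => /eqP <-; apply: htree_pr ht.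
  apply: htree_copy ht E2 p2 _ => k k3; have kL : k < 16 by lia.
  rewrite H2 // !ar_seta ?ne ?andbF //.
  by rewrite eqxx; case: k k3 kL => [|[|[|k]]].
- apply: trw_if; rewrite /= r9 => D; last by move: D ol; lia.
  apply: trw_seq; apply: trw_put; apply: trw_seq; apply: trw_if; sim; rewrite r9 => D';
    last by rewrite D' in ol.
  do 2 (apply: trw_put; sim); rewrite rf ra r1 rb r2' r2.
  split=> [k f' k3 nf|s2 p2 H2 E2].
    by rewrite !ar_seta ?(negbTE nf) ?andbF //; lia.
  have H0 := H2 0 isT; have H1 := H2 1 isT; have H3 := H2 2 isT.
  rewrite !ar_seta // eqxx /= in H0 H1 H3.
  by rewrite ee; apply: (htree_app (f1 := a + v1) (f2 := b + v2)); auto.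
Qed.

(** [q] lists the nodes queued on the way from [s] to [s']. During saturation this shows that a
    premise of a rule is either old or pending. *)
Definition grow (q : seq nat) s s' :=
  (forall f, pr s f -> pr s' f) /\
  (forall g v, v < W -> pr s' (g * W + v) -> pr s (g * W + v) \/ g \in q).

Lemma grow_refl s : grow [::] s s.
Proof. by split=> // g v _; left. Qed.

Lemma grow_trans q1 q2 s s1 s2 :
  grow q1 s s1 -> grow q2 s1 s2 -> grow (q1 ++ q2) s s2.
Proof.
move=> [A1 A2] [B1 B2]; split=> [f /A1/B1 //|g v vW /(B2 _ _ vW)[/(A2 _ _ vW)[]|] H].
- by left.
- by right; rewrite mem_cat H.
- by right; rewrite mem_cat H orbT.
Qed.

Lemma grow_fr c s s' : fr c s s' -> 3 \notin wa c -> grow [::] s s'.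
Proof.
by move=> F n3; split=> [f|g v _]; rewrite (fr_pr _ F) //; left.
Qed.

Lemma add_spec nd q o x a b v1 v2 g e s :
  facts nd q s -> regs s 9 = o -> regs s 19 = x -> regs s 15 = a ->
  regs s 16 = b -> regs s 17 = v1 -> regs s 18 = v2 -> regs s 14 = g * W ->
  regs s 29 = val e -> g < size nd -> gen (node nd g) e ->
  witness_ready s o x (a + v1) (b + v2) e ->
  trw W add s (fun s' => exists q2,
    [/\ facts nd (q ++ q2) s', grow q2 s s' & pr s' (g * W + val e)]).
Proof.
move=> Fs r9 r19 ra rb r1 r2 rg rv gn ge wr.
have [E sound sz qu nds cnt] := Fs; case: (E) => _ e2 _ _ _.
apply: trw_seq; apply: trw_set; sim; rewrite rg rv; set f := g * W + val e.
set s1 := setr _ _ _.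
have F1 : fr (30 :== Num f) s s1 by apply: (@exec_fr _ _ _ s1) => //; apply: exec_assign.
apply: trw_if; rewrite /= aeval_Ar /= /s1 regs_setr /= -/s1 => pf.
  apply: trw_skip; exists [::]; rewrite cats0; split=> //.
    exact: facts_fr F1 _ _.
  exact: grow_fr F1 _.
have npf : ~~ pr s1 f by rewrite /pr pf.
apply: trw_seq; apply: (trw_conseq _ (wit_spec (o := o) (x := x) (a := a) (b := b)
  (v1 := v1) (v2 := v2) (f := f) (e := e) _ _ _ _ _ _ _ _ _ npf)) => //.
  case: wr => [[o0 H]|[o1 H]|[ol [e1 [e2' [ee h1 h2]]]]].
  - by apply: Or31.
  - by apply: Or32; split=> //; apply: fr_htree F1 _ _.
  - by apply: Or33; split=> //; exists e1, e2'; split=> //; apply: fr_htree F1 _ _.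
move=> s2 F2 [oth wt].
apply: trw_seq; apply: trw_put; apply: trw_seq; apply: trw_put; apply: trw_set; sim.
have -> : regs s2 30 = f by rewrite (frR F2).
have -> : regs s2 13 = size q by rewrite (frR F2) // -sz.
have -> : regs s2 14 = g * W by rewrite (frR F2) // -rg.
set s3 := setr _ _ _.
have P3 f' : pr s3 f' = (f' == f) || pr s f'.
  rewrite /pr /s3; sim; rewrite !ar_seta //=; case: (f' =P f) => //= _.
  by rewrite (frA F2) //; sim.
have AO k f' : k < 3 -> f' != f -> ar s3 k f' = ar s k f'.
  move=> k3 nf; have kL : k < 16 by lia.
  have [k10 k33] : (k == 10 = false) /\ (k == 3 = false) by lia.
  by rewrite /s3; sim; rewrite !ar_seta // k10 k33 /= oth //; sim.
have AF k : k < 3 -> ar s3 k f = ar s2 k f.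
  move=> k3; have kL : k < 16 by lia.
  have [k10 k33] : (k == 10 = false) /\ (k == 3 = false) by lia.
  by rewrite /s3; sim; rewrite !ar_seta // k10 k33.
have pfs : ~~ pr s f by rewrite -(fr_pr _ F1).
have ext f' e' : htree s f' e' -> htree s3 f' e'.
  apply: htree_ext => [f1|k f1 k3 p1]; first by rewrite P3 => ->; rewrite orbT.
  by rewrite AO //; apply: contra pfs => /eqP <-.
have ht : htree s3 f e.
  apply: wt; [by rewrite P3 eqxx | exact: AF |] => f' e' H; apply: ext.
  apply: htree_ext H => [f1|k f1 k3 _]; first by rewrite (fr_pr _ F1).
  by rewrite /s1; sim.
have G3 : grow [:: g] s s3.
  split=> [f'|g' v vW]; first by rewrite P3 => ->; rewrite orbT.
  rewrite P3 => /orP[/eqP|]; last by left.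
  by case/(idW vW (val_lt e)) => -> _; right; rewrite inE.
exists [:: g]; split=> //; last by rewrite P3 eqxx.
split.
- rewrite /s3; apply: env_setr => //; do 2 apply: env_seta.
  by apply: env_fr F2 _ _ => //; apply: env_setr.
- move=> g' v vW; rewrite P3 => /orP[/eqP H|/(sound _ _ vW)[gn' [e' [ge' ve' he']]]].
    have [-> ->] := idW vW (val_lt e) H.
    by split=> //; exists e.
  by split=> //; exists e'; split=> //; apply: ext.
- by rewrite /s3; sim; rewrite size_cat.
- move=> i; rewrite size_cat addn1 ltnS => iq; rewrite /s3; sim.
  rewrite ar_seta // eqxx nth_cat /=; case: eqP => [->|/eqP ni].
    by rewrite ltnn subnn.
  have iq' : i < size q by rewrite ltn_neqAle ni.
  by rewrite iq' ar_seta //= (frA F2) //; sim; apply: qu.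
- by move=> g'; rewrite mem_cat inE => /orP[/nds|/eqP ->].
- move=> g'; rewrite count_cat /= addn0; have := cnt g'.
  (* For the node [g] itself one summand drops from 1 to 0, which pays for the new occurrence in the
     queue; other nodes are unaffected. *)
  case: (eqVneq g g') => [<-|ng].
    rewrite addnC (bigD1 (Ordinal (val_lt e))) //= pfs => H.
    rewrite (bigD1 (Ordinal (val_lt e))) //= P3 eqxx add0n.
    under eq_bigr => v nv.
      rewrite P3 (_ : _ == f = false) /=; last first.
        apply/negbTE; apply: contra nv => /eqP /(idW (ltn_ord v) (val_lt e)) [_ H'].
        by apply/eqP/val_inj.
      over.
    by move: H; lia.
  move=> H; rewrite addn0.
  under eq_bigr => v _.
    rewrite P3 (_ : _ == f = false) /=; last first.
      apply/negbTE; apply: contra ng => /eqP /(idW (ltn_ord v) (val_lt e)) [H' _].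
      by rewrite H'.
    over.
  exact: H.
Qed.

Lemma derive_spec nd q o x a b v1 v2 g f1 f2 e s :
  facts nd q s -> o <= 6 -> regs s 9 = o -> regs s 19 = x -> regs s 15 = a ->
  regs s 16 = b -> regs s 17 = v1 -> regs s 18 = v2 -> regs s 14 = g * W ->
  v1 = encm S f1 -> v2 = encm S f2 -> val e = encm S (opm inp S o x f1 f2) ->
  g < size nd -> gen (node nd g) e -> witness_ready s o x (a + v1) (b + v2) e ->
  trw W derive s (fun s' => exists q2,
    [/\ facts nd (q ++ q2) s', grow q2 s s' & pr s' (g * W + val e)]).
Proof.
move=> Fs o6 r9 r19 ra rb r1 r2 rg ev1 ev2 ve gn ge wr.
apply: trw_seq; apply: (trw_conseq _ (calc_spec (f_env Fs) o6 r9 r19 _ _)) => //.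
- by rewrite r1; apply: ev1.
- by rewrite r2; apply: ev2.
move=> s1 F1 res; have G1 := grow_fr F1 isT.
apply: (trw_conseq _ (add_spec (nd := nd) (q := q) (o := o) (x := x) (a := a) (b := b)
   (v1 := v1) (v2 := v2) (g := g) (e := e) _ _ _ _ _ _ _ _ _ gn ge _)) => //.
- exact: facts_fr F1 _ Fs.
- by rewrite (frR F1).
- by rewrite (frR F1).
- by rewrite (frR F1).
- by rewrite (frR F1).
- by rewrite (frR F1).
- by rewrite (frR F1).
- by rewrite (frR F1).
- by rewrite res ve.
- case: wr => [H|[o1 H]|[ol [e1 [e2 [ee h1 h2]]]]]; first exact: Or31.
    by apply: Or32; split=> //; apply: fr_htree F1 _ _.
  by apply: Or33; split=> //; exists e1, e2; split=> //; apply: fr_htree F1 _ _.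
move=> s2 F2 [q2 [H1 H2 H3]]; exists q2; split=> //.
exact: grow_trans G1 H2.
Qed.

End Facts.

(** * Saturation *)

(** Rules with the same key form a linked list: array 4 holds the head at the offset of the key,
    array 9 the link. Entries are numbered from 1, so that 0, the initial content of memory, is the
    empty list. *)
Definition emit key :=
  11 :== Plus (Reg 11) (Num 1);;
  Put 5 (Reg 11) (Reg 9);;
  Put 6 (Reg 11) (Reg 14);;
  Put 7 (Reg 11) (Reg 15);;
  Put 8 (Reg 11) (Reg 16);;
  Put 9 (Reg 11) (Ar 4 (Reg key));;
  Put 4 (Reg key) (Reg 11).

(** All pairs of present values of the two arguments are combined, not only those with the popped
    fact. This costs [W * W] evaluations for each visit but lets the queue hold nodes instead of
    facts. *)
Definition process :=
  9 :== Ar 5 (Reg 31);;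
  14 :== Ar 6 (Reg 31);;
  15 :== Ar 7 (Reg 31);;
  16 :== Ar 8 (Reg 31);;
  For 17 (Reg 6)
    (If (Ar 3 (Plus (Reg 15) (Reg 17)))
      (For 18 (Reg 6) (If (Ar 3 (Plus (Reg 16) (Reg 18))) derive Skip)) Skip);;
  31 :== Ar 9 (Reg 31).

Definition pop :=
  31 :== Ar 4 (Ar 10 (Reg 12));;
  12 :== Plus (Reg 12) (Num 1).

Definition saturate :=
  While (Minus (Reg 13) (Reg 12)) (pop;; While (Reg 31) process).

(* The rule [app o a b -> g], listed among the rules to be revisited when a fact
   for the node [k] is added. *)
Definition entry := (nat * nat * nat * nat * nat)%type.
Definition entry0 : entry := (0, 0, 0, 0, 0).

(** The link of the list of [g] seen from position [n]: one plus the last position below [n] with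
    key [g], or 0. *)
Fixpoint prv (E : seq entry) g n :=
  if n is m.+1 then if (nth entry0 E m).2 == g then m.+1 else prv E g m else 0.

Lemma prv_rcons E x g n : n <= size E -> prv (rcons E x) g n = prv E g n.
Proof.
by elim: n => //= n IH nE; rewrite nth_rcons nE IH // ltnW.
Qed.

Section Saturation.
Variables (Sigma : finType) (G : rtg Sigma).
Variables (inp : nat -> nat) (S B : nat).
Implicit Types (e : ere Sigma) (nd : seq (form Sigma (nonterm G))).

Local Notation W := (2 ^ (S * S)).
Local Notation env := (env inp S B).
Local Notation val := (@val inp S Sigma).
Local Notation mt := (@mt inp S Sigma).
Local Notation facts := (@facts Sigma G inp S B).
Local Notation node nd g := (nth (Leaf (inr (start G))) nd g).
Local Notation grow := (grow S).

Record entries (E : seq entry) s : Prop := Entries {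
  e_size : regs s 11 = size E;
  e_cells : forall r o g a b k, r < size E -> nth entry0 E r = (o, g, a, b, k) ->
    [/\ ar s 5 r.+1 = o, ar s 6 r.+1 = g * W, ar s 7 r.+1 = a * W,
        ar s 8 r.+1 = b * W & ar s 9 r.+1 = prv E k r];
  e_head : forall g, ar s 4 (g * W) = prv E g (size E)
}.

Lemma entries_fr c E s s' : fr c s s' ->
  (11 \notin wr c) && all (fun k => k \notin wa c) [:: 4; 5; 6; 7; 8; 9] ->
  entries E s -> entries E s'.
Proof.
move=> F /andP[n11 /allP n] [H1 H2 H3].
have A k i : k \in [:: 4; 5; 6; 7; 8; 9] -> ar s' k i = ar s k i.
  move=> kk; rewrite (frA F) // n // andbT.
  by move: kk; rewrite !inE => /or4P[|||/or3P[]] /eqP ->.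
split=> [|r o g a b k rE H|g]; first by rewrite (frR F).
  by rewrite !A //; apply: H2.
by rewrite A.
Qed.

Lemma emit_spec E key o g a b k s :
  key \in [:: 15; 16] -> entries E s -> regs s 9 = o -> regs s 14 = g * W ->
  regs s 15 = a * W -> regs s 16 = b * W -> regs s key = k * W ->
  trw W (emit key) s (entries (rcons E (o, g, a, b, k))).
Proof.
move=> kk [H1 H2 H3] r9 rg ra rb rk.
have k11 : key == 11 = false by move: kk; rewrite !inE => /orP[] /eqP ->.
apply: trw_seq; apply: trw_set; do 5 (apply: trw_seq; apply: trw_put; sim).
apply: trw_put; sim; rewrite k11 rk r9 rg ra rb H1 addn1.
set n := (size E).+1; have W0 : W != 0 by rewrite -lt0n expn_gt0.
split.
- by sim; rewrite size_rcons.
- move=> r o' g' a' b' k'; rewrite size_rcons ltnS => rE H.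
  rewrite !ar_seta //= /n eqSS prv_rcons //; sim.
  move: H; rewrite nth_rcons; case: (ltngtP r (size E)) rE => // [rE _ H|-> _ [-> -> -> -> ->]].
    exact: H2.
  by split=> //; rewrite H3.
- move=> g'; rewrite !ar_seta //= size_rcons /= nth_rcons ltnn eqxx /= prv_rcons //.
  by rewrite eqn_mul2r (negbTE W0) /= eq_sym; case: eqP => //; sim.
Qed.

Lemma pr_setr s x v f : x != 2 -> pr (setr s x v) f = pr s f.
Proof. by move=> n2; rewrite /pr ar_setr. Qed.

Lemma facts_setr nd q s x v :
  x \notin [:: 2; 4; 5; 6; 13] -> facts nd q s -> facts nd q (setr s x v).
Proof.
move=> nx; apply: (facts_fr (c := x :== Num v)).
  apply: (exec_fr (t := 2)); last exact: exec_assign.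
  by apply: contra nx => /= /eqP ->.
move: nx; rewrite /okf /oke /= !inE !negb_or ![_ == x]eq_sym !andbT.
by case/and5P=> -> -> -> -> ->.
Qed.

Lemma entries_setr E s x v : x \notin [:: 2; 11] -> entries E s -> entries E (setr s x v).
Proof.
rewrite !inE negb_or => /andP[n2 n11] [H1 H2 H3]; split.
- by rewrite regs_setr eq_sym (negbTE n11).
- by move=> r o g a b k rE H; rewrite !ar_setr //; apply: H2.
- by move=> g; rewrite ar_setr.
Qed.

Definition valid nd (x : entry) :=
  let: (o, g, a, b, k) := x in
  [/\ 0 < o <= 6, g < size nd, a < size nd & b < size nd] /\
  forall e1 e2, gen (node nd a) e1 -> gen (node nd b) e2 ->
    gen (node nd g) (app o e1 e2).

Definition closed_for (x : entry) s s' :=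
  let: (o, g, a, b, k) := x in
  forall e1 e2, pr s (a * W + val e1) -> pr s (b * W + val e2) ->
    pr s' (g * W + val (app o e1 e2)).

(* Read off the program computing it: the value of [app o e1 e2] depends on the
   values of [e1] and [e2] only. *)
Lemma encm_opm_congr o x f1 f2 g1 g2 s :
  env s -> o <= 6 -> regs s 9 = o -> regs s 19 = x ->
  regs s 17 = encm S f1 -> regs s 18 = encm S f2 ->
  regs s 17 = encm S g1 -> regs s 18 = encm S g2 ->
  encm S (opm inp S o x f1 f2) = encm S (opm inp S o x g1 g2).
Proof.
move=> E o6 r9 r19 e1 e2 e1' e2'.
have [t [s1 [X1 _ <-]]] := calc_spec E o6 r9 r19 e1 e2.
have [t' [s2 [X2 _ <-]]] := calc_spec E o6 r9 r19 e1' e2'.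
by have [_ ->] := exec_det X1 X2.
Qed.

Lemma facts_sound nd q g v s : facts nd q s -> v < W -> pr s (g * W + v) ->
  exists e, [/\ gen (node nd g) e, v = val e & htree B s (g * W + v) e].
Proof. by move=> [_ H _ _ _ _] vW /H[]. Qed.

(** The table supplies some expressions with values [v1] and [v2]; by [encm_opm_congr] the fact
    derived from them answers for all expressions with these values. *)
Lemma derive_pair nd q o g a b k v1 v2 s :
  facts nd q s -> valid nd (o, g, a, b, k) -> regs s 9 = o ->
  regs s 14 = g * W -> regs s 15 = a * W -> regs s 16 = b * W ->
  regs s 17 = v1 -> regs s 18 = v2 -> v1 < W -> v2 < W ->
  pr s (a * W + v1) -> pr s (b * W + v2) ->
  trw W derive s (fun s' => exists q2,
    [/\ facts nd (q ++ q2) s', grow q2 s s' &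
        forall e1 e2, v1 = val e1 -> v2 = val e2 ->
          pr s' (g * W + val (app o e1 e2))]).
Proof.
move=> Fs [[/andP[o0 o6] gn an bn] vl] r9 rg ra rb r1 r2 v1W v2W p1 p2.
have [e1 [g1 E1 h1]] := facts_sound Fs v1W p1.
have [e2 [g2 E2 h2]] := facts_sound Fs v2W p2.
have o06 : 0 < o <= 6 by rewrite o0.
have ge := vl _ _ g1 g2.
apply: (trw_conseq _ (derive_spec (nd := nd) (q := q) (o := o) (x := regs s 19) (a := a * W)
  (b := b * W) (v1 := v1) (v2 := v2) (g := g) (f1 := mt e1) (f2 := mt e2)
  (e := app o e1 e2) Fs _ _ _ _ _ _ _ _ E1 E2 (val_app _ _ _ _ _ o06) gn ge _)) => //.
  have [o1|o1] : 1 < o \/ o = 1 by lia.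
    by apply: Or33; rewrite o1 o6; split=> //; exists e1, e2.
  by apply: Or32; rewrite o1; split.
move=> s' F' [q2 [H1 H2 H3]]; exists q2; split=> // e1' e2' E1' E2'.
move: H3; rewrite !(@val_app _ _ _ _ (regs s 19)) //.
rewrite (@encm_opm_congr o (regs s 19) (mt e1) (mt e2) (mt e1') (mt e2') s) ?r1 ?r2 //.
by case: Fs.
Qed.

(** Only pairs present at the beginning are promised to be treated. A fact that appears during the
    loops has its node in [q2] and is dealt with when that node is popped. *)
Lemma process_spec nd q E r o g a b k s :
  facts nd q s -> entries E s -> regs s 31 = r.+1 -> r < size E ->
  nth entry0 E r = (o, g, a, b, k) -> valid nd (o, g, a, b, k) ->
  trw W process s (fun s' => exists q2,
    [/\ facts nd (q ++ q2) s', grow q2 s s', entries E s', regs s' 31 = prv E k r &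
        closed_for (o, g, a, b, k) s s']).
Proof.
move=> Fs Es r31 rE Er vl; have [H1 H2 H3] := Es.
have [c5 c6 c7 c8 c9] := H2 _ _ _ _ _ _ rE Er.
apply: trw_seq; apply: (trw_conseq (P := fun s' => regs s' 9 = o)) => //.
  by apply: trw_set; sim; rewrite r31.
move=> s1 F1 r9.
apply: trw_seq; apply: (trw_conseq (P := fun s' => regs s' 14 = g * W)) => //.
  by apply: trw_set; sim; rewrite (frR F1) // (frA F1) // r31.
move=> s2 F2 rg.
apply: trw_seq; apply: (trw_conseq (P := fun s' => regs s' 15 = a * W)) => //.
  by apply: trw_set; sim; rewrite (frR F2) // (frA F2) // (frR F1) // (frA F1) // r31.
move=> s3 F3 ra.
apply: trw_seq; apply: (trw_conseq (P := fun s' => regs s' 16 = b * W)) => //.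
  by apply: trw_set; sim; rewrite (frR F3) // (frA F3) // (frR F2) // (frA F2) // (frR F1) // (frA F1) // r31.
move=> s4 F4 rb.
have Fs4 : facts nd q s4.
  by do 4 (apply: facts_fr; [eassumption | by [] |]).
have Es4 : entries E s4.
  by do 4 (apply: entries_fr; [eassumption | by [] |]).
have P4 f : pr s4 f = pr s f.
  by rewrite (fr_pr _ F4) // (fr_pr _ F3) // (fr_pr _ F2) // (fr_pr _ F1).
have r9' : regs s4 9 = o by rewrite (frR F4) // (frR F3) // (frR F2).
have rg' : regs s4 14 = g * W by rewrite (frR F4) // (frR F3).
have ra' : regs s4 15 = a * W by rewrite (frR F4).
have r31' : regs s4 31 = r.+1 by rewrite (frR F4) // (frR F3) // (frR F2) // (frR F1).
have r6 : regs s4 6 = W by case: Fs4 => -[_ _ _ []].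
apply: trw_seq; apply: (trw_for (n := W) (I := fun n s' => exists q2,
  [/\ facts nd (q ++ q2) s', grow q2 s4 s' & forall e1 e2, val e1 < n ->
     pr s4 (a * W + val e1) -> pr s4 (b * W + val e2) ->
     pr s' (g * W + val (app o e1 e2))])) => //.
- by move=> s5 F5; rewrite /= (frR F5).
- exists [::]; rewrite cats0; split=> //; last exact: grow_refl.
  exact: facts_setr.
- move=> v1 s5 v1W F5 r17 [q2 [Fs5 G5 C5]].
  apply: trw_if; rewrite aeval_Ar /= (frR F5) // ra' r17 => p1; last first.
    apply: trw_skip; exists q2; split=> //; first exact: facts_setr.
    move=> e1 e2; rewrite ltnS leq_eqVlt pr_setr // => /orP[/eqP E1|]; last exact: C5.
    by move=> p; have := G5.1 _ p; rewrite /pr E1 p1.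
  apply: (trw_for (n := W) (I := fun n s' => exists q3,
    [/\ facts nd (q ++ q3) s', grow q3 s4 s', forall f, pr s5 f -> pr s' f & forall e1 e2,
       val e1 = v1 -> val e2 < n ->
       pr s4 (a * W + val e1) -> pr s4 (b * W + val e2) ->
       pr s' (g * W + val (app o e1 e2))])) => //.
  + by move=> s6 F6; rewrite /= (frR F6) // (frR F5).
  + exists q2; split=> //; first exact: facts_setr.
  + move=> v2 s6 v2W F6 r18 [q3 [Fs6 G6 M6 C6]].
    have r17' : regs s6 17 = v1 by rewrite (frR F6).
    have rb6 : regs s6 16 = b * W by rewrite (frR F6) // (frR F5).
    apply: trw_if; rewrite aeval_Ar /= rb6 r18 => p2; last first.
      apply: trw_skip; exists q3; split=> //; first exact: facts_setr.
      move=> e1 e2 E1; rewrite ltnS leq_eqVlt pr_setr // => /orP[/eqP E2|]; last exact: C6.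
      by move=> _ p; have := G6.1 _ p; rewrite /pr E2 p2.
    apply: (trw_conseq _ (derive_pair (nd := nd) (q := q ++ q3) (o := o) (g := g)
      (a := a) (b := b) (k := k) Fs6 vl _ _ _ rb6 r17' r18 v1W v2W (M6 _ p1) p2)) => //.
    * by rewrite (frR F6) // (frR F5).
    * by rewrite (frR F6) // (frR F5).
    * by rewrite (frR F6) // (frR F5).
    move=> s7 F7 [q4 [Fs7 G7 C7]]; exists (q3 ++ q4); rewrite catA; split.
    * exact: facts_setr.
    * exact: grow_trans G6 G7.
    * by move=> f /M6 p; rewrite pr_setr //; apply: G7.1.
    move=> e1 e2 E1; rewrite ltnS leq_eqVlt pr_setr // => /orP[/eqP E2 _ _|L p p'].
      by apply: C7.
    by apply: G7.1; apply: C6.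
  + move=> s6 F6 [q3 [Fs6 G6 M6 C6]]; exists q3; split=> //; first exact: facts_setr.
    move=> e1 e2; rewrite ltnS leq_eqVlt pr_setr // => /orP[/eqP E1|L p p'].
      by apply: C6 => //; apply: val_lt.
    by apply: M6; apply: C5.
- move=> s5 F5 [q2 [Fs5 G5 C5]]; apply: trw_set; sim.
  rewrite (frR F5) // r31' (frA F5) //.
  have c9' : ar s4 9 r.+1 = prv E k r.
    by rewrite (frA F4) // (frA F3) // (frA F2) // (frA F1).
  exists q2; split.
  + exact: facts_setr.
  + by split=> [f|g' v vW]; rewrite pr_setr // -P4; [apply: G5.1 | apply: G5.2].
  + by apply: entries_setr => //; apply: entries_fr F5 _ _.
  + by sim.
  + move=> e1 e2; rewrite -!P4 pr_setr // => p p'; apply: C5 => //; exact: val_lt.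
Qed.

Definition keyed (E : seq entry) g := count (fun x => x.2 == g) E.

Definition process_cost := (cst W process).+2.

(** Induction on the position [c]: entries with other keys are bypassed by the links and cost
    nothing, so only those keyed by [g] are charged. The final 2 is the failing loop test. *)
Lemma entry_loop nd E g T Q c q s :
  facts nd q s -> entries E s -> (forall x, x \in E -> valid nd x) ->
  c <= size E -> regs s 31 = prv E g c ->
  (forall s' q2, facts nd (q ++ q2) s' -> grow q2 s s' -> entries E s' ->
     regs s' 12 = regs s 12 ->
     (forall r, r < c -> (nth entry0 E r).2 == g -> closed_for (nth entry0 E r) s s') ->
     Q s') ->
  T = process_cost * keyed (take c E) g + 2 ->
  tri T (While (Reg 31) process) s Q.
Proof.
move=> Fs Es vl cE r31 HQ ->.
elim: c q s Fs Es cE r31 HQ => [|c IH] q s Fs Es cE r31 HQ.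
  rewrite take0 muln0 add0n; apply: (@tri_done (Reg 31)) => //.
  by apply: (HQ s [::]) => //; [rewrite cats0|apply: grow_refl].
rewrite (take_nth entry0) // /keyed -cats1 count_cat /= addn0.
case: (boolP ((nth entry0 E c).2 == g)) (r31) => [kg /=|kg /=].
  rewrite kg => rc.
  case Ex : (nth entry0 E c) kg => [[[[o g'] a] b] k] /= /eqP kg.
  have vx : valid nd (o, g', a, b, k) by rewrite -Ex; apply/vl/mem_nth.
  have PS := process_spec Fs Es rc cE Ex vx.
  apply: tri_weak (tri_loop (T1 := cst W process)
    (T2 := process_cost * keyed (take c E) g + 2) _ _) _ (fun s H => H).
  - by rewrite /= rc.
  - apply: (trw_conseq _ PS) => // s1 F1 [q2 [Fs1 G1 Es1 r1 C1]].
    apply: (IH (q ++ q2) s1) => //; first exact: ltnW.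
      by rewrite r1 kg.
    move=> s' q3 Fs' G' Es' r12 C'.
    apply: (HQ s' (q2 ++ q3)) => //.
    + by rewrite catA.
    + exact: grow_trans G1 G'.
    + by rewrite r12 (frR F1).
    move=> r; rewrite ltnS leq_eqVlt => /orP[/eqP -> _|rc' kr].
      by rewrite Ex => e1 e2 p1 p2; apply: G'.1; apply: C1.
    move: (C' _ rc' kr); case: (nth _ _ r) => [[[[o' g''] a'] b'] k'] /= H e1 e2 p1 p2.
    by apply: H; apply: G1.1.
  - rewrite /process_cost /keyed [acost _]/=.
    by move: (cst W process) (count _ _) => n m; lia.
rewrite (negbTE kg) => rc; rewrite addn0.
apply: (IH q s) => //; first exact: ltnW.
move=> s' q2 Fs' G' Es' r12 C'; apply: (HQ s' q2) => // r.
rewrite ltnS leq_eqVlt => /orP[/eqP ->|]; last exact: C'.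
by rewrite (negbTE kg).
Qed.

(* Every rule is revisited for both of its arguments. *)
Definition full (E : seq entry) := forall o g a b k, (o, g, a, b, k) \in E ->
  (o, g, a, b, a) \in E /\ (o, g, a, b, b) \in E.

(** The invariant of saturation, with [q] the part of the queue still pending. Once that part is
    empty, the table is closed under all rules. *)
Definition closed (E : seq entry) (q : seq nat) s := forall o g a b k,
  (o, g, a, b, k) \in E -> forall e1 e2,
  pr s (a * W + val e1) -> pr s (b * W + val e2) ->
  [\/ pr s (g * W + val (app o e1 e2)), a \in q | b \in q].

(** The 6 consists of 4 for the test of the outer loop and 2 for the last test of the inner one. *)
Definition pop_cost E g := (cst W pop + 6) + process_cost * keyed E g.

(** The potential of the queue: for each node, the price of a pop times the number of pops it may
    still undergo, out of [W]. *)
Definition slack E n q h :=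
  \sum_(g < n) pop_cost E g * (W - count_mem (nat_of_ord g) (take h q)).

(** A pop spends one of the [W] chances of [g], which releases its price. Nodes appended as [q2] lie
    behind the popped prefix and do not raise the potential. *)
Lemma slack_pop E n (q q2 : seq nat) h g : h < size q -> nth 0 q h = g -> g < n ->
  count_mem g q <= W ->
  slack E n (q ++ q2) h.+1 + pop_cost E g <= slack E n q h.
Proof.
move=> hq eg gn cq.
have t1 : take h.+1 (q ++ q2) = rcons (take h q) g.
  rewrite takel_cat // (take_nth 0) ?eg //.
have c1 : count_mem g (take h.+1 q) <= W.
  apply: leq_trans cq; rewrite -{2}(cat_take_drop h.+1 q) count_cat leq_addr //.
rewrite (take_nth 0) // eg -cats1 count_cat /= eqxx in c1.
rewrite /slack (bigD1 (Ordinal gn)) // [X in _ <= X](bigD1 (Ordinal gn)) //=.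
rewrite t1 -cats1 count_cat /= eqxx addn0 addnAC leq_add //.
  rewrite -{2}[pop_cost E g]muln1 -mulnDr leq_mul2l; apply/orP; right.
  by move: c1; rewrite addn0; lia.
apply: leq_sum => i ni; rewrite count_cat /= addn0.
have -> : g == i = false; last by rewrite addn0.
by apply/negbTE; apply: contra ni => /eqP E'; apply/eqP/ord_inj.
Qed.

(** Induction on a bound [N] for the potential, which drops by the positive price of each pop. The
    additional 4 is the failing test of the outer loop. *)
Lemma pop_loop nd E N h q s Q :
  (forall x, x \in E -> valid nd x) -> full E ->
  facts nd q s -> entries E s -> regs s 12 = h -> h <= size q ->
  closed E (drop h q) s -> slack E (size nd) q h <= N ->
  (forall s' q', facts nd q' s' -> (forall f, pr s f -> pr s' f) ->
     closed E [::] s' -> Q s') ->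
  tri (N + 4) saturate s Q.
Proof.
move=> vl fl; have [n] := ubnP N; elim: n => // n IH in N h q s * => Nn.
move=> Fs Es r12 hq Cl sl HQ; have r13 : regs s 13 = size q by case: Fs.
case: (ltngtP h (size q)) hq => // [hq _|eh _]; last first.
  suff H : tri 4 saturate s Q by apply: tri_weak H _ _ => //; apply: leq_addl.
  apply: (@tri_done (Minus (Reg 13) (Reg 12))); first by rewrite /= r12 r13 eh subnn.
  by apply: (HQ s q) => //; rewrite -(drop_size q) -eh.
set g := nth 0 q h.
have gq : g \in q by rewrite mem_nth.
have gn : g < size nd by case: Fs => _ _ _ _ H _; apply: H.
have cq : count_mem g q <= W by case: Fs => _ _ _ _ _ H; apply: leq_trans (leq_addl _ _) (H g).
have sl' q2 := leq_trans (slack_pop E q2 hq (erefl g) gn cq) sl.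
have pN : pop_cost E g <= N by apply: leq_trans (sl' [::]); apply: leq_addl.
have p0 : 0 < pop_cost E g by rewrite /pop_cost; lia.
apply: tri_weak (tri_loop (T1 := cst W pop + (process_cost * keyed E g + 2))
  (T2 := N - pop_cost E g + 4) _ _) _ (fun s H => H).
- by rewrite /= r12 r13; lia.
- apply: tri_seq; apply: (trw_conseq (P := fun s' => regs s' 31 = prv E g (size E) /\
      regs s' 12 = h.+1)) => //.
    apply: trw_seq; do 2 (apply: trw_set; sim); rewrite r12 addn1; split=> //.
    case: Fs => _ _ _ H _ _; case: Es => _ _ H'.
    by rewrite H // H'.
  move=> s1 F1 [r31 r12'].
  have Fs1 : facts nd q s1 by apply: facts_fr F1 _ Fs.
  have Es1 : entries E s1 by apply: entries_fr F1 _ Es.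
  have P1 f : pr s1 f = pr s f by rewrite (fr_pr _ F1).
  apply: (entry_loop Fs1 Es1 vl (leqnn _) r31); last by rewrite take_size.
  move=> s2 q2 Fs2 G2 Es2 r12'' C2.
  apply: (IH _ h.+1 (q ++ q2)) => //.
  + by lia.
  + by rewrite r12'' r12'.
  + by rewrite size_cat ltn_addr.
  + have dr : drop h.+1 (q ++ q2) = drop h.+1 q ++ q2.
      rewrite drop_cat; case: leqP => // qh.
      have -> : h.+1 = size q by lia.
      by rewrite subnn drop0 drop_size.
    rewrite dr => o g' a b k xE e1 e2 p1 p2.
    (* A new premise has its node in [q2], hence pending. If both premises are old, the earlier
       invariant gives the conclusion or a pending argument; when that argument is the popped [g],
       [full] provides the rule under this key, and it has just been revisited. *)
    case: (G2.2 _ _ (val_lt _ _ _) p1) => [p1'|H]; last by apply: Or32; rewrite mem_cat H orbT.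
    case: (G2.2 _ _ (val_lt _ _ _) p2) => [p2'|H]; last by apply: Or33; rewrite mem_cat H orbT.
    have C g'' : g'' = g -> (o, g', a, b, g'') \in E -> pr s2 (g' * W + val (app o e1 e2)).
      move=> eg xE'; have := C2 (index (o, g', a, b, g'') E).
      rewrite index_mem nth_index //= => /(_ xE').
      by rewrite eg eqxx => /(_ isT); apply.
    have [xa xb] := fl _ _ _ _ _ xE.
    move: p1' p2'; rewrite !P1 => p1' p2'.
    have := Cl _ _ _ _ _ xE _ _ p1' p2'; rewrite (drop_nth 0) // -/g !inE.
    case=> [p|/orP[/eqP H|H]|/orP[/eqP H|H]].
    * by apply: Or31; apply: G2.1; rewrite P1.
    * by apply: Or31; apply: C xa.
    * by apply: Or32; rewrite mem_cat H.
    * by apply: Or31; apply: C xb.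
    * by apply: Or33; rewrite mem_cat H.
  + by have := sl' q2; lia.
  + move=> s3 q3 Fs3 M3; apply: (HQ s3 q3) => // f p; apply: M3; apply: G2.1.
    by rewrite P1.
- by move: pN; rewrite /pop_cost [acost _]/=; move: (cst W pop) => n'; lia.
Qed.

(** Every entry has a single key, so the numbers [keyed E g] sum to at most [size E]. This is what
    makes saturation linear in the grammar. *)
Lemma slack_le E n q h :
  slack E n q h <= W * (n * (cst W pop + 6) + process_cost * size E).
Proof.
apply: (@leq_trans (\sum_(g < n) W * pop_cost E g)).
  by apply: leq_sum => g _; rewrite mulnC leq_mul2r leq_subr orbT.
rewrite -big_distrr; apply: leq_mul => //.
rewrite /pop_cost big_split /= sum_nat_const card_ord leq_add2l.
rewrite -big_distrr; apply: leq_mul => //.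
rewrite /keyed; elim: E => [|x E IH] /=; first by rewrite big1.
rewrite big_split /= -add1n leq_add //.
case: (ltnP x.2 n) => [xn|xn].
  rewrite (bigD1 (Ordinal xn)) //= eqxx big1 ?addn0 // => i ni.
  by apply/eqP; rewrite eqb0 eq_sym; apply: contra ni => /eqP H; apply/eqP/ord_inj.
rewrite big1 // => i _; apply/eqP; rewrite eqb0.
by apply: contraL xn => /eqP ->; rewrite -ltnNge.
Qed.

End Saturation.

(** * Reading the grammar *)

(** The prefix order is parsed with a stack of node offsets in array 11, of height register 8; its
    top is the node whose symbol comes next. *)
Definition fetch :=
  8 :== Minus (Reg 8) (Num 1);;
  14 :== Ar 11 (Reg 8);;
  9 :== Deref (Reg 3).

(** The right child is pushed below the left one, whose symbols come first. A unary symbol takes the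
    same node for both arguments, so that all rules are binary. *)
Definition alloc :=
  3 :== Plus (Reg 3) (Num 1);;
  15 :== Reg 10;;
  10 :== Plus (Reg 10) (Reg 6);;
  If (Minus (Reg 9) (Num 4)) (16 :== Reg 15)
    (16 :== Reg 10;;
     10 :== Plus (Reg 10) (Reg 6);;
     Put 11 (Reg 8) (Reg 16);;
     8 :== Plus (Reg 8) (Num 1));;
  Put 11 (Reg 8) (Reg 15);;
  8 :== Plus (Reg 8) (Num 1).

Definition link := emit 15;; emit 16.

Definition scale x y := x :== Num 0;; For 35 (Reg 6) (x :== Plus (Reg x) (Reg y)).

Definition leaf_arg :=
  19 :== Deref (Plus (Reg 3) (Num 1));;
  3 :== Plus (Reg 3) (Num 2).

Definition node_step :=
  fetch;;
  If (Minus (Reg 9) (Num 1)) (alloc;; link)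
    (leaf_arg;;
     If (Reg 9) (scale 15 19;; 16 :== Reg 15;; link)
       (17 :== Num 0;; 18 :== Num 0;; derive)).

Definition forms := While (Reg 8) node_step.

Section Parsing.
Variables (Sigma : finType) (G : rtg Sigma).
Variables (inp : nat -> nat) (S B : nat).
Implicit Types (e : ere Sigma) (nd : seq (form Sigma (nonterm G))).

Local Notation W := (2 ^ (S * S)).
Local Notation env := (env inp S B).
Local Notation val := (@val inp S Sigma).
Local Notation mt := (@mt inp S Sigma).
Local Notation facts := (@facts Sigma G inp S B).
Local Notation node nd g := (nth (Leaf (inr (start G))) nd g).
Local Notation grow := (grow S).
Local Notation entries := (entries S).
Local Notation valid := (@valid Sigma G).

Lemma node_cat nd nd' g : g < size nd -> node (nd ++ nd') g = node nd g.
Proof. by move=> gn; rewrite nth_cat gn. Qed.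

Lemma facts_cat nd nd' q s : facts nd q s -> facts (nd ++ nd') q s.
Proof.
case=> H1 H2 H3 H4 H5 H6; split=> // [g v vW /(H2 _ _ vW)[gn H]|g /H5 gn].
  by rewrite size_cat ltn_addr // node_cat.
by rewrite size_cat ltn_addr.
Qed.

Lemma valid_cat nd nd' x : valid nd x -> valid (nd ++ nd') x.
Proof.
case: x => [[[[o g] a] b] k] [[H1 H2 H3 H4] H]; split.
  by rewrite size_cat !ltn_addr.
by rewrite !node_cat.
Qed.

Definition stack stk s :=
  regs s 8 = size stk /\ forall i, i < size stk -> ar s 11 i = nth 0 stk i * W.

Lemma fetch_spec stk g pos s : env s -> stack (rcons stk g) s -> regs s 3 = pos ->
  pos < B ->
  trw W fetch s (fun s' => [/\ stack stk s', regs s' 14 = g * W & regs s' 9 = inp pos]).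
Proof.
move=> [_ _ _ _ em] [r8 st] r3 pB.
apply: trw_seq; apply: trw_set; apply: trw_seq; apply: trw_set; apply: trw_set; sim.
rewrite r8 r3 size_rcons subn1 /=; rewrite size_rcons in st; split=> //.
- split; first by sim.
  by move=> i il; sim; rewrite st ?nth_rcons ?il // ltnW.
- by rewrite st // nth_rcons ltnn eqxx.
- by rewrite em.
Qed.

Lemma alloc_spec o n stk pos s : env s -> stack stk s -> regs s 3 = pos ->
  regs s 9 = o -> regs s 10 = n * W ->
  trw W alloc s (fun s' => [/\ regs s' 3 = pos.+1, regs s' 15 = n * W &
    if 4 < o then [/\ regs s' 16 = n * W, regs s' 10 = n.+1 * W & stack (rcons stk n) s']
    else [/\ regs s' 16 = n.+1 * W, regs s' 10 = n.+2 * W &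
             stack (rcons (rcons stk n.+1) n) s']]).
Proof.
move=> [_ _ _ [_ r6] _] [r8 st] r3 r9 r10.
do 3 (apply: trw_seq; apply: trw_set; sim); rewrite r3 r10 r6.
apply: trw_seq; apply: trw_if; sim; rewrite r9 => o4.
  have -> : 4 < o by lia.
  apply: trw_set; sim; apply: trw_seq; apply: trw_put; apply: trw_set; sim.
  rewrite r8 addn1; split=> //; split=> //; first by rewrite mulSnr.
  split; first by sim; rewrite size_rcons addn1.
  move=> i; rewrite size_rcons ltnS => il; sim; rewrite ar_seta //= nth_rcons.
  by case: ltngtP il => // il _; sim; apply: st.
have -> : 4 < o = false by lia.
do 2 (apply: trw_seq; apply: trw_set; sim); apply: trw_seq; apply: trw_put; sim.
apply: trw_set; sim; apply: trw_seq; apply: trw_put; apply: trw_set; sim.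
rewrite r8 r6 !addn1; split=> //; split=> //; try by rewrite !mulSnr.
split; first by sim; rewrite !size_rcons ?addn1.
move=> i; rewrite !size_rcons ltnS => il; sim; rewrite ar_seta //= !nth_rcons size_rcons.
case: ltngtP il => // il _; sim; rewrite ar_seta //= ltnS in il *.
  case: ltngtP il => // il _; sim; first by apply: st.
  by rewrite mulSnr.
Qed.

Lemma link_spec E o g a b s : entries E s -> regs s 9 = o -> regs s 14 = g * W ->
  regs s 15 = a * W -> regs s 16 = b * W ->
  trw W link s (entries (E ++ [:: (o, g, a, b, a); (o, g, a, b, b)])).
Proof.
move=> Es r9 rg ra rb; rewrite -cat_rcons cats1.
apply: trw_seq; apply: (trw_conseq _ (emit_spec (S := S) (key := 15) _ Es r9 rg ra rb ra)) => // s1 F1 Es1.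
by apply: emit_spec => //; rewrite (frR F1).
Qed.

Lemma scale_spec x y n s : env s -> x \in [:: 10; 14; 15; 30] -> y \in [:: 19; 9] ->
  regs s y = n -> trw W (scale x y) s (fun s' => regs s' x = n * W).
Proof.
move=> E xx yy ry; have [_ _ _ [_ r6] _] := E.
have nx k : k \notin [:: 10; 14; 15; 30] -> k == x = false.
  by move=> kk; apply/eqP => kx; rewrite kx xx in kk.
have ny k : k \notin [:: 19; 9] -> y == k = false.
  by move=> kk; apply/eqP => kx; rewrite -kx yy in kk.
have yx : y == x = false by apply/nx; move: yy; rewrite !inE => /orP[] /eqP ->.
apply: trw_seq; apply: trw_set; sim.
apply: (trw_for (n := W) (I := fun k s' => regs s' x = n * k)).
- by rewrite /= !andbT inE ![x == _]eq_sym !nx.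
- by [].
- by move=> s1 F1; rewrite /= (frR F1) ?stE ?nx //= !inE nx.
- by rewrite !regs_setr eqxx eq_sym nx // muln0.
- move=> k s1 kW F1 r35 rx; apply: trw_set; rewrite !regs_setr eq_sym nx //= eqxx.
  rewrite rx (frR F1); last by rewrite /= !inE yx ny.
  by rewrite regs_setr yx ry mulnS addnC.
- by [].
Qed.

Lemma leaf_arg_spec pos s : env s -> regs s 3 = pos -> pos.+1 < B ->
  trw W leaf_arg s (fun s' => regs s' 19 = inp pos.+1 /\ regs s' 3 = pos.+2).
Proof.
move=> [_ _ _ _ em] r3 pB; apply: trw_seq; do 2 (apply: trw_set; sim).
by rewrite r3 addn1 em // addn2.
Qed.

(** Nonterminals are the first nodes, numbered by [code]; subtrees of right-hand sides follow.
    Nothing is popped while parsing, so by [p_queued] every fact is pending, which makes the table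
    trivially [closed] when saturation begins. *)
Record parsed nd E q stk pos s : Prop := Parsed {
  p_facts : facts nd q s;
  p_entries : entries E s;
  p_valid : forall x, x \in E -> valid nd x;
  p_full : full E;
  p_stack : stack stk s;
  p_pos : regs s 3 = pos;
  p_next : regs s 10 = size nd * W;
  p_nonterm : forall X : nonterm G, code X < size nd /\ node nd (code X) = Leaf (inr X);
  p_queued : forall g v, v < W -> pr s (g * W + v) -> g \in q
}.

Lemma stack_fr c stk s s' : fr c s s' -> (8 \notin wr c) && (11 \notin wa c) ->
  stack stk s -> stack stk s'.
Proof.
move=> F /andP[n8 n11] [H1 H2]; split=> [|i il]; first by rewrite (frR F).
by rewrite (frA F) // H2.
Qed.

Lemma full_cat2 E o g a b : full E ->
  full (E ++ [:: (o, g, a, b, a); (o, g, a, b, b)]).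
Proof.
move=> fE o' g' a' b' k'; rewrite !mem_cat !inE => /orP[/fE[-> ->] //|].
by case/orP=> /eqP[-> -> -> -> _]; rewrite !eqxx !orbT.
Qed.

Lemma valid_cat2 nd nd' E o g a b : (forall x, x \in E -> valid nd x) ->
  valid (nd ++ nd') (o, g, a, b, a) ->
  forall x, x \in E ++ [:: (o, g, a, b, a); (o, g, a, b, b)] -> valid (nd ++ nd') x.
Proof.
move=> vl v x; rewrite mem_cat !inE => /orP[/vl|]; first exact: valid_cat.
by case/orP=> /eqP -> //; case: v.
Qed.

Lemma step_app nd E q stk pos s g o t1 t2 :
  parsed nd E q (rcons stk g) pos s -> pos < B -> inp pos = o -> 1 < o <= 6 ->
  g < size nd ->
  (forall e1 e2, gen t1 e1 -> gen t2 e2 -> gen (node nd g) (app o e1 e2)) ->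
  (4 < o -> t1 = t2) ->
  let n := size nd in let b := if 4 < o then n else n.+1 in
  trw W node_step s (fun s' =>
    (forall f, pr s' f = pr s f) /\
    parsed (nd ++ (if 4 < o then [:: t1] else [:: t1; t2]))
      (E ++ [:: (o, g, n, b, n); (o, g, n, b, b)]) q
      (if 4 < o then rcons stk n else rcons (rcons stk n.+1) n) pos.+1 s').
Proof.
case=> Fs Es vl fl st r3 r10 nt qd pB po /andP[o1 o6] gn gv tt n b.
have Ev := f_env Fs.
apply: trw_seq; apply: (trw_conseq _ (fetch_spec Ev st r3 pB)) => // s1 F1 [st1 r14 r9].
apply: trw_if; rewrite /= r9 po => D; last by lia.
have Ev1 := env_fr F1 isT Ev.
apply: trw_seq; apply: (trw_conseq _ (alloc_spec (o := o) (n := n) (pos := pos) Ev1 st1 _ _ _)) => //.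
- by rewrite (frR F1).
- by rewrite r9.
- by rewrite (frR F1).
move=> s2 F2 [r3' r15 H].
have r16 : regs s2 16 = b * W by rewrite /b; case: ifP H => _ [].
have Es2 : entries E s2 by apply: entries_fr F2 _ _ => //; apply: entries_fr F1 _ Es.
apply: (trw_conseq _ (link_spec (o := o) (g := g) (a := n) (b := b) Es2 _ _ _ _)) => //.
- by rewrite (frR F2) // r9.
- by rewrite (frR F2).
move=> s3 F3 Es3.
have P3 f : pr s3 f = pr s f by rewrite (fr_pr _ F3) // (fr_pr _ F2) // (fr_pr _ F1).
split=> //; split=> //.
- apply: facts_cat; apply: facts_fr F3 _ _ => //; apply: facts_fr F2 _ _ => //.
  exact: facts_fr F1 _ _.
- apply: valid_cat2 vl _; split.
    by rewrite size_cat /b; case: ifP => _ /=; split; rewrite ?o6 ?(ltnW o1) //; lia.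
  rewrite (node_cat _ gn) /b /n; case: (4 < o) tt => /= [/(_ isT) e12|_].
    by rewrite nth_cat ltnn subnn /=; move: gv; rewrite -e12.
  by rewrite !nth_cat ltnn subnn ltnNge leqnSn /= subSnn.
- exact: full_cat2.
- case: ifP H => _ [_ _ st2]; exact: stack_fr F3 _ st2.
- by rewrite (frR F3).
- by rewrite (frR F3) // size_cat; case: ifP H => _ [_ -> _] /=; rewrite ?addn1 ?addn2.
- by move=> X; have [XL XE] := nt X; rewrite size_cat ltn_addr // node_cat.
- by move=> g' v vW; rewrite P3; apply: qd.
Qed.

Lemma step_nonterm nd E q stk pos s g (X : nonterm G) :
  parsed nd E q (rcons stk g) pos s -> pos.+1 < B -> inp pos = 1 ->
  inp pos.+1 = code X -> g < size nd ->
  (forall e, gen (Leaf (inr X)) e -> gen (node nd g) e) ->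
  let x := (1, g, code X, code X, code X) in
  trw W node_step s (fun s' => (forall f, pr s' f = pr s f) /\
    parsed nd (E ++ [:: x; x]) q stk pos.+2 s').
Proof.
case=> Fs Es vl fl st r3 r10 nt qd pB po px gn gv x.
have Ev := f_env Fs.
apply: trw_seq; apply: (trw_conseq _ (fetch_spec Ev st r3 (ltnW pB))) => // s1 F1 [st1 r14 r9].
have Ev1 := env_fr F1 isT Ev.
apply: trw_if; rewrite /= r9 po // => _.
apply: trw_seq; apply: (trw_conseq _ (leaf_arg_spec Ev1 (pos := pos) _ pB)) => //.
  by rewrite (frR F1).
move=> s2 F2 [r19 r3']; have Ev2 := env_fr F2 isT Ev1.
apply: trw_if; rewrite /= (frR F2) // r9 po // => _.
apply: trw_seq; apply: (trw_conseq _ (scale_spec (n := code X) Ev2 _ _ _)) => //.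
  by rewrite r19.
move=> s3 F3 r15; apply: trw_seq.
apply: (trw_conseq (P := fun s' => regs s' 16 = code X * W)) => //.
  by apply: trw_set; sim.
move=> s4 F4 r16.
have Es4 : entries E s4.
  apply: entries_fr F4 _ _ => //; apply: entries_fr F3 _ _ => //.
  by apply: entries_fr F2 _ _ => //; apply: entries_fr F1 _ Es.
apply: (trw_conseq _ (link_spec (o := 1) (g := g) (a := code X) (b := code X) Es4 _ _ _ _)) => //.
- by rewrite (frR F4) // (frR F3) // (frR F2) // r9.
- by rewrite (frR F4) // (frR F3) // (frR F2).
- by rewrite (frR F4).
move=> s5 F5 Es5.
have P5 f : pr s5 f = pr s f.
  by rewrite (fr_pr _ F5) // (fr_pr _ F4) // (fr_pr _ F3) // (fr_pr _ F2) // (fr_pr _ F1).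
have [XL XE] := nt X.
split=> //; split=> //.
- apply: facts_fr F5 _ _ => //; apply: facts_fr F4 _ _ => //; apply: facts_fr F3 _ _ => //.
  by apply: facts_fr F2 _ _ => //; apply: facts_fr F1 _ _.
- rewrite -[nd]cats0; apply: valid_cat2 vl _; rewrite cats0; split=> // e1 e2 g1 _ /=.
  by apply: gv; rewrite -XE.
- exact: full_cat2.
- apply: stack_fr F5 _ _ => //; apply: stack_fr F4 _ _ => //; apply: stack_fr F3 _ _ => //.
  by apply: stack_fr F2 _ _.
- by rewrite (frR F5) // (frR F4) // (frR F3).
- by rewrite (frR F5) // (frR F4) // (frR F3) // (frR F2) // (frR F1).
- by move=> g' v vW; rewrite P5; apply: qd.
Qed.

Lemma step_letter nd E q stk pos s g (c : Sigma) :
  parsed nd E q (rcons stk g) pos s -> pos.+1 < B -> inp pos = 0 ->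
  inp pos.+1 = code c -> g < size nd -> gen (node nd g) (Leaf c) ->
  trw W node_step s (fun s' => exists q2,
    [/\ parsed nd E (q ++ q2) stk pos.+2 s', forall f, pr s f -> pr s' f &
        pr s' (g * W + val (Leaf c))]).
Proof.
case=> Fs Es vl fl st r3 r10 nt qd pB po px gn gv.
have Ev := f_env Fs.
apply: trw_seq; apply: (trw_conseq _ (fetch_spec Ev st r3 (ltnW pB))) => // s1 F1 [st1 r14 r9].
have Ev1 := env_fr F1 isT Ev.
apply: trw_if; rewrite /= r9 po // => _.
apply: trw_seq; apply: (trw_conseq _ (leaf_arg_spec Ev1 (pos := pos) _ pB)) => //.
  by rewrite (frR F1).
move=> s2 F2 [r19 r3']; have Ev2 := env_fr F2 isT Ev1.
apply: trw_if; rewrite /= (frR F2) // r9 po // => _.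
apply: trw_seq; apply: (trw_conseq (P := fun s' => regs s' 17 = 0)) => //.
  by apply: trw_set; sim.
move=> s3 F3 r17.
apply: trw_seq; apply: (trw_conseq (P := fun s' => regs s' 18 = 0)) => //.
  by apply: trw_set; sim.
move=> s4 F4 r18.
have Fs4 : facts nd q s4.
  apply: facts_fr F4 _ _ => //; apply: facts_fr F3 _ _ => //.
  by apply: facts_fr F2 _ _ => //; apply: facts_fr F1 _ _.
have P4 f : pr s4 f = pr s f.
  by rewrite (fr_pr _ F4) // (fr_pr _ F3) // (fr_pr _ F2) // (fr_pr _ F1).
(* The value 0 codes the empty matrix, the argument that [mt] gives to the operation of a letter. *)
have z0 : 0 = encm S (fun _ _ => false) by rewrite /encm enc_false.
have r17' : regs s4 17 = 0 by rewrite (frR F4).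
apply: (trw_conseq _ (derive_spec (nd := nd) (q := q) (o := 0) (x := code c)
  (a := regs s4 15) (b := regs s4 16) (v1 := 0) (v2 := 0) (g := g)
  (e := Leaf c) Fs4 _ _ _ _ _ r17' r18 _ z0 z0 _ gn gv _)) => //.
- by rewrite (frR F4) // (frR F3) // (frR F2) // r9.
- by rewrite (frR F4) // (frR F3) // r19.
- by rewrite (frR F4) // (frR F3) // (frR F2).
- by apply: Or31; split=> //; exists c.
move=> s5 F5 [q2 [Fs5 G5 p5]]; exists q2; split=> // [|f p]; last by apply: G5.1; rewrite P4.
split=> //.
- apply: entries_fr F5 _ _ => //; apply: entries_fr F4 _ _ => //.
  apply: entries_fr F3 _ _ => //.
  by apply: entries_fr F2 _ _ => //; apply: entries_fr F1 _ Es.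
- apply: stack_fr F5 _ _ => //; apply: stack_fr F4 _ _ => //; apply: stack_fr F3 _ _ => //.
  by apply: stack_fr F2 _ _.
- by rewrite (frR F5) // (frR F4) // (frR F3).
- by rewrite (frR F5) // (frR F4) // (frR F3) // (frR F2) // (frR F1).
- move=> g' v vW /(G5.2 _ _ vW) []; last by rewrite mem_cat => ->; rewrite orbT.
  by rewrite P4 => /(qd _ _ vW); rewrite mem_cat => ->.
Qed.

Definition input_at pos l :=
  pos + size l <= B /\ forall d, d < size l -> inp (pos + d) = nth 0 l d.

Lemma input_at_cons pos x l :
  input_at pos (x :: l) -> [/\ inp pos = x, input_at pos.+1 l & pos < B].
Proof.
rewrite /input_at /= => -[L H]; split; last by lia.
  by have := H 0; rewrite addn0; apply.
by split=> [|d dl]; [lia | have := H d.+1; rewrite addSnnS; apply].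
Qed.

Lemma input_at_cat pos l l' :
  input_at pos (l ++ l') -> input_at pos l /\ input_at (pos + size l) l'.
Proof.
rewrite /input_at size_cat => -[L H]; split; split; try lia => d.
  by move=> d dl; rewrite H ?nth_cat ?dl //; lia.
move=> d dl; rewrite -addnA H ?nth_cat; last by lia.
by rewrite ltnNge leq_addr /= addKn.
Qed.

(** What completeness needs from the parser: the entries spell out [t] from the node [g] downwards,
    and the facts for its letters are already in the table. *)
Fixpoint handled (E : seq entry) s g (t : form Sigma (nonterm G)) : Prop :=
  match t with
  | Leaf (inl c) => pr s (g * W + val (Leaf c))
  | Leaf (inr X) => (1, g, code X, code X, code X) \in E
  | Cat t1 t2 => exists a b, [/\ (2, g, a, b, a) \in E, handled E s a t1 & handled E s b t2]
  | Alt t1 t2 => exists a b, [/\ (3, g, a, b, a) \in E, handled E s a t1 & handled E s b t2]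
  | Cap t1 t2 => exists a b, [/\ (4, g, a, b, a) \in E, handled E s a t1 & handled E s b t2]
  | Star t1 => exists a, (5, g, a, a, a) \in E /\ handled E s a t1
  | Neg t1 => exists a, (6, g, a, a, a) \in E /\ handled E s a t1
  end.

Lemma handled_mono E E' s s' g t :
  {subset E <= E'} -> (forall f, pr s f -> pr s' f) ->
  handled E s g t -> handled E' s' g t.
Proof.
move=> sE sp; elim: t g => [[c|X]|t1 IH1 t2 IH2|t1 IH1 t2 IH2|t1 IH1 t2 IH2|t IH|t IH] g /=.
- exact: sp.
- exact: sE.
- by case=> a [b [/sE Eab /IH1 h1 /IH2 h2]]; exists a, b.
- by case=> a [b [/sE Eab /IH1 h1 /IH2 h2]]; exists a, b.
- by case=> a [b [/sE Eab /IH1 h1 /IH2 h2]]; exists a, b.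
- by case=> a [/sE Ea /IH h]; exists a.
- by case=> a [/sE Ea /IH h]; exists a.
Qed.

Definition node_cost := (cst W node_step).+2.

(** In continuation-passing style: the single loop [forms] does not stop between subtrees, so the
    rest of its run, with its time [T], is a hypothesis about the state after [t]. The new nodes are
    fewer than [ere_size t] because the root uses the given node [g]. *)
Definition parses (t : form Sigma (nonterm G)) := forall g stk pos nd E q s T Q,
  parsed nd E q (rcons stk g) pos s -> input_at pos (enc_form t) -> g < size nd ->
  (forall e, gen t e -> gen (node nd g) e) ->
  (forall s' nd' E' q',
     parsed (nd ++ nd') (E ++ E') (q ++ q') stk (pos + size (enc_form t)) s' ->
     regs s' 7 = regs s 7 -> (forall f, pr s f -> pr s' f) ->
     handled (E ++ E') s' g t -> size nd' < ere_size t ->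
     size E' <= 2 * ere_size t -> tri T forms s' Q) ->
  tri (node_cost * ere_size t + T) forms s Q.

Lemma tri_forms T n nd E q stk g pos s P Q :
  parsed nd E q (rcons stk g) pos s -> trw W node_step s P ->
  (forall s1, fr node_step s s1 -> P s1 -> tri (node_cost * n + T) forms s1 Q) ->
  tri (node_cost * n.+1 + T) forms s Q.
Proof.
move=> Ps PS H; apply: (@tri_weak (2 + cst W node_step + (node_cost * n + T)) _ _ _ Q) => //.
  apply: (@tri_loop (cst W node_step) _ (Reg 8)).
    by have [/= -> _] := p_stack Ps; rewrite size_rcons.
  exact: trw_conseq PS H.
by rewrite mulnS /node_cost; move: (cst W node_step) => k; lia.
Qed.

Lemma parses_bin o t1 t2 : 1 < o <= 4 -> parses t1 -> parses t2 -> parses (app o t1 t2).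
Proof.
move=> /andP[o1 o4] H1 H2 g stk pos nd E q s T Q Ps I gn gv HQ.
have [ee es] : enc_form (app o t1 t2) = o :: enc_form t1 ++ enc_form t2 /\
    ere_size (app o t1 t2) = (ere_size t1 + ere_size t2).+1.
  by case: o o1 o4 {I gv HQ} => [|[|[|[|[|o]]]]].
rewrite es; rewrite ee in I; have [io I' pB] := input_at_cons I.
have [I1 I2] := input_at_cat I'.
have o46 : 4 < o = false by lia.
have vg e1 e2 : gen t1 e1 -> gen t2 e2 -> gen (node nd g) (app o e1 e2).
  by move=> h1 h2; apply: gv; apply: gen_app.
have o16 : 1 < o <= 6 by lia.
have tt : 4 < o -> t1 = t2 by rewrite o46.
have := step_app Ps pB io o16 gn vg tt; rewrite o46 /= => SA.
apply: (tri_forms Ps SA) => s1 F1 [P1 Ps1]; rewrite mulnDr -addnA.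
apply: (H1 _ _ _ _ _ _ _ _ _ Ps1 I1); first by rewrite size_cat /=; lia.
  by rewrite nth_cat ltnn subnn.
move=> s2 nd2 E2 q2 Ps2 r2 M2 h2 sn2 sE2.
apply: (H2 _ _ _ _ _ _ _ _ _ Ps2 I2); first by rewrite !size_cat /=; lia.
  by rewrite -catA nth_cat ltnNge leqnSn /= subSnn.
move=> s3 nd3 E3 q3 Ps3 r3 M3 h3 sn3 sE3.
apply: (HQ s3 ([:: t1; t2] ++ nd2 ++ nd3)
  ([:: (o, g, size nd, (size nd).+1, size nd);
       (o, g, size nd, (size nd).+1, (size nd).+1)] ++ E2 ++ E3) (q2 ++ q3)).
- have -> : pos + size (enc_form (app o t1 t2)) =
      pos.+1 + size (enc_form t1) + size (enc_form t2) by rewrite ee /= size_cat; lia.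
  by rewrite !catA.
- by rewrite r3 r2 (frR F1).
- by move=> f p; apply: M3; apply: M2; rewrite P1.
- rewrite !catA; have h2' : handled (((E ++ [:: (o, g, size nd, (size nd).+1, size nd);
       (o, g, size nd, (size nd).+1, (size nd).+1)]) ++ E2) ++ E3) s3 (size nd) t1.
    by apply: handled_mono h2 => // x xE; rewrite mem_cat xE.
  have xE : (o, g, size nd, (size nd).+1, size nd) \in
     ((E ++ [:: (o, g, size nd, (size nd).+1, size nd);
       (o, g, size nd, (size nd).+1, (size nd).+1)]) ++ E2) ++ E3.
    by rewrite !mem_cat !inE eqxx !orbT.
  case: o o1 o4 {io vg o46 o16 tt SA Ps1 Ps2 Ps3 I HQ ee es gv} xE h2' h3 h2 => [|[|[|[|[|o]]]]] // _ _ xE h2' h3 _;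
  by exists (size nd), (size nd).+1.
- by rewrite es !size_cat /=; lia.
- by rewrite es !size_cat /=; lia.
Qed.

Lemma parses_un o t : 4 < o <= 6 -> parses t -> parses (app o t t).
Proof.
move=> /andP[o4 o6] H g stk pos nd E q s T Q Ps I gn gv HQ.
have [ee es] : enc_form (app o t t) = o :: enc_form t /\
    ere_size (app o t t) = (ere_size t).+1.
  by case: o o4 o6 {I gv HQ} => [|[|[|[|[|[|[|o]]]]]]].
rewrite es; rewrite ee in I; have [io I' pB] := input_at_cons I.
have vg e1 e2 : gen t e1 -> gen t e2 -> gen (node nd g) (app o e1 e2).
  by move=> h1 h2; apply: gv; apply: gen_app.
have o16 : 1 < o <= 6 by lia.
have := step_app Ps pB io o16 gn vg (fun _ => erefl); rewrite o4 => SA.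
apply: (tri_forms Ps SA) => s1 F1 [P1 Ps1].
apply: (H _ _ _ _ _ _ _ _ _ Ps1 I'); first by rewrite size_cat addn1.
  by rewrite nth_cat ltnn subnn.
move=> s2 nd2 E2 q2 Ps2 r2 M2 h2 sn2 sE2.
set x := (o, g, size nd, size nd, size nd).
apply: (HQ s2 ([:: t] ++ nd2) ([:: x; x] ++ E2) q2).
- have -> : pos + size (enc_form (app o t t)) = pos.+1 + size (enc_form t).
    by rewrite ee /=; lia.
  by rewrite !catA.
- by rewrite r2 (frR F1).
- by move=> f p; apply: M2; rewrite P1.
- rewrite !catA.
  have xE : x \in (E ++ [:: x; x]) ++ E2 by rewrite !mem_cat !inE eqxx !orbT.
  case: o @x o4 o6 {io vg o16 SA Ps1 Ps2 I HQ ee es gv} xE h2 => [|[|[|[|[|[|[|o]]]]]]] // x _ _ xE h2;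
  by exists (size nd).
- by rewrite es /=; lia.
- by rewrite es /=; lia.
Qed.

Lemma parse_form t : parses t.
Proof.
elim: t => [[c|X]|t1 IH1 t2 IH2|t1 IH1 t2 IH2|t1 IH1 t2 IH2|t IH|t IH].
- move=> g stk pos nd E q s T Q Ps I gn gv HQ; rewrite [ere_size _]/=.
  have [i0 I1 p0] := input_at_cons I; have [i1 _ p1] := input_at_cons I1.
  have SL := step_letter Ps p1 i0 i1 gn (gv _ (gen_leaf _ _)).
  apply: (tri_forms Ps SL) => s1 F1 [q2 [Ps1 M1 p]]; rewrite muln0 add0n.
  apply: (HQ s1 [::] [::] q2); rewrite ?cats0 ?addn2 //.
  by rewrite (frR F1).
- move=> g stk pos nd E q s T Q Ps I gn gv HQ; rewrite [ere_size _]/=.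
  have [i0 I1 p0] := input_at_cons I; have [i1 _ p1] := input_at_cons I1.
  have SN := step_nonterm Ps p1 i0 i1 gn gv.
  apply: (tri_forms Ps SN) => s1 F1 [P1 Ps1]; rewrite muln0 add0n.
  set x := (1, g, code X, code X, code X).
  apply: (HQ s1 [::] [:: x; x] [::]); rewrite ?cats0 ?addn2 //.
  + by rewrite (frR F1).
  + by move=> f; rewrite P1.
  + by rewrite /= mem_cat !inE eqxx !orbT.
- exact: (@parses_bin 2).
- exact: (@parses_bin 3).
- exact: (@parses_bin 4).
- exact: (@parses_un 5).
- exact: (@parses_un 6).
Qed.

End Parsing.

(** * Measuring the input *)

(** One traversal for two uses: with [chk] equal to [Skip] it measures the words, with [test] it
    examines them. When [chk] runs, the current word occupies the cells from register 33 up to, but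
    excluding, register 34. *)
Definition walk_step chk :=
  33 :== Plus (Reg 3) (Num 1);;
  34 :== Plus (Reg 33) (Deref (Reg 3));;
  chk;;
  3 :== Reg 34;;
  7 :== Minus (Reg 7) (Num 1).

Definition walk chk :=
  7 :== Deref (Reg 3);;
  3 :== Plus (Reg 3) (Num 1);;
  While (Reg 7) (walk_step chk).

Definition sizes :=
  4 :== Plus (Reg 3) (Num 1);;
  5 :== Num 0;;
  For 35 (Reg 4) (5 :== Plus (Reg 5) (Reg 4));;
  6 :== Num 1;;
  For 35 (Reg 5) (6 :== Plus (Reg 6) (Reg 6)).

(** Register 8 counts the subtrees still to be read. A count must replace the stack of the later
    parser: the base of the arrays is not known before this traversal ends. *)
Definition skip_step :=
  9 :== Deref (Reg 3);;
  3 :== Plus (Reg 3) (Num 1);;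
  If (Minus (Reg 9) (Num 1))
    (If (Minus (Reg 9) (Num 4)) Skip (8 :== Plus (Reg 8) (Num 1)))
    (3 :== Plus (Reg 3) (Num 1);; 8 :== Minus (Reg 8) (Num 1)).

Definition skip_forms := While (Reg 8) skip_step.

Definition skip_head := 3 :== Plus (Reg 3) (Num 1);; 8 :== Num 1.
Definition next_prod := 7 :== Minus (Reg 7) (Num 1).
Definition skip_prods := While (Reg 7) (skip_head;; skip_forms;; next_prod).

Definition measure_head :=
  3 :== Num 1;; walk Skip;; walk Skip;; sizes;;
  3 :== Plus (Reg 3) (Num 2);; 7 :== Deref (Reg 3);; 3 :== Plus (Reg 3) (Num 1).

Section Walk.
Variables (Sigma : finType) (inp : nat -> nat) (B : nat).
Implicit Types (w : seq Sigma) (ws : seq (seq Sigma)).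

Definition enc_word w := enc_seq (fun a => [:: code a]) w.

Lemma enc_wordE w : enc_word w = size w :: map (@code Sigma) w.
Proof. by rewrite /enc_word /enc_seq; congr (_ :: _); elim: w => //= a w ->. Qed.

Lemma input_at_located p w : input_at inp B p (map (@code Sigma) w) -> located inp p w.
Proof.
rewrite /located => -[_ H]; apply: (@eq_from_nth _ 0).
  by rewrite !size_map size_iota.
move=> d; rewrite size_map size_iota => dw.
by rewrite (nth_map 0) ?size_iota // nth_iota // H ?size_map.
Qed.

Lemma walk_spec W chk ws p s (I : seq (seq Sigma) -> state -> Prop) (Q : state -> Prop) :
  okc chk && all (fun x => x \notin wr chk) [:: 3; 7; 33; 34] ->
  size ws <= W -> regs s 3 = p -> input_at inp B p (enc_words ws) ->
  (forall s', fr (walk chk) s s' -> forall a, a < B -> mem s' a = inp a) ->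
  (forall s', (forall x, x \notin [:: 3; 7] -> regs s' x = regs s x) -> I ws s') ->
  (forall w ws' q s', fr (walk chk) s s' -> I (w :: ws') s' ->
     q + size w <= p + size (enc_words ws) -> located inp q w ->
     (forall s1, fr (33 :== Num 0;; 34 :== Num 0) s' s1 -> regs s1 33 = q ->
        regs s1 34 = q + size w ->
        trw W chk s1 (fun s2 => forall s3,
          (forall x, x \notin [:: 3; 7] -> regs s3 x = regs s2 x) -> I ws' s3))) ->
  (forall s', fr (walk chk) s s' -> I [::] s' ->
     regs s' 3 = p + size (enc_words ws) -> Q s') ->
  trw W (walk chk) s Q.
Proof.
move=> /andP[ok /allP nw] wsW r3 ip rd I0 st en.
have okw : okc (walk chk) by rewrite /= ok.
have n k : k \in [:: 3; 7; 33; 34] -> k \notin wr chk by apply: nw.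
have [i0 ip' pB] := input_at_cons ip.
have F0 : fr (walk chk) s (setr (setr s 7 (size ws)) 3 p.+1).
  split=> [x nx|k i kL nk|a La]; last by sim.
    move: nx; rewrite /= !inE !negb_or !regs_setr.
    by case/andP=> /negbTE -> /andP[/negbTE ->].
  by sim.
apply: trw_seq; apply: trw_set; apply: trw_seq; apply: trw_set; sim.
rewrite r3 (rd s (frl_refl _ _ _)) // i0 addn1.
have tr s1 : fr (While (Reg 7) (walk_step chk)) (setr (setr s 7 (size ws)) 3 p.+1) s1 ->
    fr (walk chk) s s1.
  move=> F; apply: frl_trans F0 _; first exact: okc_wr okw.
  by apply: frl_sub F => // y yw; rewrite -[wr _]/([:: 7; 3] ++ _) mem_cat yw orbT.
pose fl ws' := flatten (map enc_word ws').
have flc w ws' : fl (w :: ws') = size w :: map (@code Sigma) w ++ fl ws'.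
  by rewrite -cat_cons -enc_wordE.
apply: (@trw_while _ _ _ _ (size ws) (fun k s' => exists ws',
  [/\ size ws' = k, regs s' 7 = k, input_at inp B (regs s' 3) (fl ws'),
      regs s' 3 + size (fl ws') = p + size (enc_words ws) & I ws' s'])) => //.
- exists ws; sim; split=> //; first by rewrite addSnnS.
  apply: I0 => x; rewrite !inE negb_or => /andP[n3 n7].
  by rewrite !regs_setr (negbTE n3) (negbTE n7).
- move=> k s1 kL /tr F1 [[|w ws'] []] // [sz] r7 ip1 e1 I1; split; first by rewrite /= r7.
  rewrite flc in ip1 e1.
  have [iw ip2 qB] := input_at_cons ip1; have [il ip3] := input_at_cat ip2.
  rewrite size_map in ip3; rewrite /= size_cat size_map in e1.
  do 2 (apply: trw_seq; apply: trw_set; sim); rewrite addn1 rd // iw.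
  set s2 := setr _ _ _.
  have F2 : fr (33 :== Num 0;; 34 :== Num 0) s1 s2.
    split=> [x|k' i kL' _|a _]; rewrite /s2; sim.
    by rewrite !inE negb_or => /andP[/negbTE -> /negbTE ->].
  apply: trw_seq.
  apply: (trw_conseq ok (st w ws' (regs s1 3).+1 s1 F1 I1 _ _ s2 F2 _ _)).
  + by rewrite -e1; lia.
  + exact: input_at_located il.
  + by rewrite /s2; sim.
  + by rewrite /s2; sim.
  move=> s3 F3 I3; apply: trw_seq; do 2 (apply: trw_set; sim).
  have r34 : regs s3 34 = (regs s1 3).+1 + size w by rewrite (frR F3) ?n // /s2; sim.
  have r7' : regs s3 7 = k.+1 by rewrite (frR F3) ?n // /s2; sim.
  exists ws'; sim; rewrite r34 r7' subn1 /=; split=> //.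
  + by rewrite -e1; lia.
  + apply: I3 => x; rewrite !inE negb_or => /andP[n3 n7].
    by rewrite !regs_setr (negbTE n3) (negbTE n7).
- move=> s1 /tr F1 [[|w ws'] []] // _ r7 _ e1 I1; split; first by rewrite /= r7.
  by apply: en => //; rewrite -e1 addn0.
Qed.

Lemma sizes_spec s S : regs s 3 = S.-1 -> 0 < S ->
  trw (2 ^ (S * S)) sizes s
   (fun s' => [/\ regs s' 4 = S, regs s' 5 = S * S & regs s' 6 = 2 ^ (S * S)]).
Proof.
move=> r3 S0; have SW : S * S <= 2 ^ (S * S) by rewrite ltnW // ltn_expl.
do 2 (apply: trw_seq; apply: trw_set; sim).
have -> : regs s 3 + 1 = S by rewrite r3; lia.
apply: trw_seq; apply: (trw_for (n := S) (I := fun k s' => regs s' 5 = k * S)) => //.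
- by apply: leq_trans SW; rewrite leq_pmulr.
- by move=> s1 F1; rewrite /= (frR F1) //; sim.
- move=> k s1 kS F1 _ r5; apply: trw_set; sim.
  by rewrite r5 (frR F1) //; sim; rewrite mulSnr.
move=> s1 F1 r5; apply: trw_seq; apply: trw_set; sim.
apply: (trw_for (n := S * S) (I := fun k s' => regs s' 6 = 2 ^ k)) => //.
- by move=> s2 F2; rewrite /= (frR F2) //; sim.
- by move=> k s2 kS F2 _ r6; apply: trw_set; sim; rewrite r6 addnn -mul2n expnS.
- move=> s2 F2 r6; split=> //; rewrite (frR F2) //; sim; rewrite (frR F1) //; sim.
Qed.

End Walk.

Section Measure.
Variables (Sigma : finType) (G : rtg Sigma) (inp : nat -> nat) (B W : nat).
Local Notation input_at := (input_at inp B).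

Definition skip_cost := (cst W skip_step).+2.

Definition reads s := forall a, a < B -> mem s a = inp a.

Lemma skip_step_spec pos k s : regs s 8 = k.+1 -> regs s 3 = pos -> reads s ->
  pos < B ->
  trw W skip_step s (fun s' =>
    if inp pos <= 1 then regs s' 3 = pos.+2 /\ regs s' 8 = k
    else regs s' 3 = pos.+1 /\ regs s' 8 = (if inp pos <= 4 then k.+2 else k.+1)).
Proof.
move=> r8 r3 rd pB; do 2 (apply: trw_seq; apply: trw_set; sim).
rewrite r3 rd // addn1; apply: trw_if; sim => D.
  have -> : inp pos <= 1 = false by lia.
  apply: trw_if; sim => D'.
    by apply: trw_skip; have -> : inp pos <= 4 = false by lia.
  apply: trw_set; sim; have -> : inp pos <= 4 by lia.
  by rewrite r8 addn1.
have -> : inp pos <= 1 by lia.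
by apply: trw_seq; do 2 (apply: trw_set; sim); rewrite r8 addn1 subn1.
Qed.

(** In continuation-passing style for the same reason as [parses]. *)
Definition skips (t : form Sigma (nonterm G)) := forall pos s k T Q,
  regs s 8 = k.+1 -> regs s 3 = pos -> reads s -> input_at pos (enc_form t) ->
  (forall s', fr skip_forms s s' -> regs s' 8 = k ->
     regs s' 3 = pos + size (enc_form t) -> tri T skip_forms s' Q) ->
  tri (skip_cost * ere_size t + T) skip_forms s Q.

Lemma tri_skip T n s k P Q : regs s 8 = k.+1 -> trw W skip_step s P ->
  (forall s1, fr skip_forms s s1 -> P s1 -> tri (skip_cost * n + T) skip_forms s1 Q) ->
  tri (skip_cost * n.+1 + T) skip_forms s Q.
Proof.
move=> r8 PS H; apply: (@tri_weak (2 + cst W skip_step + (skip_cost * n + T)) _ _ _ Q) => //.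
  apply: (@tri_loop (cst W skip_step) _ (Reg 8)); first by rewrite /= r8.
  exact: trw_conseq PS H.
by rewrite mulnS /skip_cost; move: (cst W skip_step) => m; lia.
Qed.

Lemma reads_fr c s s' : fr c s s' -> wa c = [::] -> reads s -> reads s'.
Proof. by move=> F n rd a aB; rewrite (frM0 _ F n) rd. Qed.

Lemma skips_bin o t1 t2 : 1 < o <= 4 -> skips t1 -> skips t2 -> skips (app o t1 t2).
Proof.
move=> /andP[o1 o4] H1 H2 pos s k T Q r8 r3 rd I HQ.
have [ee es] : enc_form (app o t1 t2) = o :: enc_form t1 ++ enc_form t2 /\
    ere_size (app o t1 t2) = (ere_size t1 + ere_size t2).+1.
  by case: o o1 o4 {I HQ} => [|[|[|[|[|o]]]]].
rewrite es; rewrite ee in I; have [io I' pB] := input_at_cons I.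
have [I1 I2] := input_at_cat I'.
have := skip_step_spec r8 r3 rd pB; rewrite io o4 leqNgt o1 /= => SS.
apply: (tri_skip r8 SS) => s1 F1 [r3' r8']; rewrite mulnDr -addnA.
apply: (H1 _ _ _ _ _ r8' r3' _ I1) => [|s2 F2 r8'' r3'']; first exact: reads_fr F1 _ rd.
apply: (H2 _ _ _ _ _ r8'' r3'' _ I2) => [|s3 F3 r8''' r3'''].
  by apply: reads_fr F2 _ _ => //; apply: reads_fr F1 _ rd.
apply: HQ => //; last by rewrite ee /= size_cat r3'''; lia.
by apply: frl_trans F3 => //; apply: frl_trans F1 F2.
Qed.

Lemma skips_un o t : 4 < o <= 6 -> skips t -> skips (app o t t).
Proof.
move=> /andP[o4 o6] H pos s k T Q r8 r3 rd I HQ.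
have [ee es] : enc_form (app o t t) = o :: enc_form t /\
    ere_size (app o t t) = (ere_size t).+1.
  by case: o o4 o6 {I HQ} => [|[|[|[|[|[|[|o]]]]]]].
rewrite es; rewrite ee in I; have [io I' pB] := input_at_cons I.
have o1 : o <= 1 = false by lia.
have := skip_step_spec r8 r3 rd pB; rewrite io o1 leqNgt o4 /= => SS.
apply: (tri_skip r8 SS) => s1 F1 [r3' r8'].
apply: (H _ _ _ _ _ r8' r3' _ I') => [|s2 F2 r8'' r3'']; first exact: reads_fr F1 _ rd.
apply: HQ => //; last by rewrite ee /= r3''; lia.
exact: frl_trans F1 F2.
Qed.

Lemma skip_form t : skips t.
Proof.
have leafE (c : Sigma + nonterm G) : skips (Leaf c).
  move=> pos s k T Q r8 r3 rd I HQ; rewrite [ere_size _]/=.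
  have [i0 I1 p0] : [/\ inp pos <= 1, size (enc_form (Leaf c)) = 2 & pos < B].
    by case: c I {HQ} => x I; have [-> _ ->] := input_at_cons I.
  have := skip_step_spec r8 r3 rd p0; rewrite i0 => SS.
  apply: (tri_skip r8 SS) => s1 F1 [r3' r8']; rewrite muln0 add0n.
  by apply: HQ => //; rewrite I1 addn2.
elim: t => [c|t1 IH1 t2 IH2|t1 IH1 t2 IH2|t1 IH1 t2 IH2|t IH|t IH].
- exact: leafE.
- exact: (@skips_bin 2).
- exact: (@skips_bin 3).
- exact: (@skips_bin 4).
- exact: (@skips_un 5).
- exact: (@skips_un 6).
Qed.

Definition enc_prod (r : nonterm G * form Sigma (nonterm G)) := code r.1 :: enc_form r.2.

Definition weight (ps : seq (nonterm G * form Sigma (nonterm G))) :=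
  \sum_(r <- ps) (ere_size r.2).+1.

Definition skip_prod_cost := skip_cost + cst W skip_head + cst W next_prod + 4.

Lemma skip_prods_spec ps pos s Q :
  regs s 7 = size ps -> regs s 3 = pos -> reads s ->
  input_at pos (flatten (map enc_prod ps)) ->
  (forall s', fr skip_prods s s' ->
     regs s' 3 = pos + size (flatten (map enc_prod ps)) -> Q s') ->
  tri (skip_prod_cost * weight ps + 2) skip_prods s Q.
Proof.
elim: ps pos s => [|[X t] ps IH] pos s r7 r3 rd I HQ.
  rewrite /weight big_nil muln0; apply: (@tri_done (Reg 7)) => //.
  by apply: HQ; [exact: frl_refl | rewrite addn0].
rewrite /weight big_cons -/(weight ps) mulnDr -addnA.
have [iX I1 pB] := input_at_cons I; have [I2 I3] := input_at_cat I1.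
apply: (@tri_weak (2 + (cst W skip_head + ((skip_cost * ere_size t + 2) + cst W next_prod)) +
  (skip_prod_cost * weight ps + 2)) _ _ _ Q) => //.
  apply: (@tri_loop _ _ (Reg 7)); first by rewrite /= r7.
  apply: tri_seq; apply: (trw_conseq (P := fun s' => regs s' 3 = pos.+1 /\ regs s' 8 = 1)) => //.
    by apply: trw_seq; do 2 (apply: trw_set; sim); rewrite r3 addn1.
  move=> s1 F1 [r3' r8']; apply: tri_seq.
  apply: (skip_form (t := t) r8' r3' _ I2) => [|s2 F2 r8'' r3'']; first exact: reads_fr F1 _ rd.
  apply: (@tri_done (Reg 8)) => //.
  apply: (trw_conseq (P := fun s' => regs s' 7 = size ps)) => //.
    by apply: trw_set; sim; rewrite (frR F2) // (frR F1) // r7 subn1.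
  move=> s3 F3 r7'; have F : fr skip_prods s s3.
    apply: (@frl_trans _ _ _ s2) => //; last by apply: frW F3.
    by apply: (@frl_trans _ _ _ s1) => //; [apply: frW F1 | apply: frW F2].
  apply: (IH (pos.+1 + size (enc_form t))) => //.
  - by rewrite (frR F3).
  - exact: reads_fr F _ rd.
  move=> s4 F4 r3'''; apply: HQ; first exact: frl_trans F F4.
  by rewrite r3''' /= size_cat; lia.
rewrite leq_add2r /skip_prod_cost; move: (cst _ skip_head) (cst _ next_prod) skip_cost => a b c.
by rewrite /= mulnS; nia.
Qed.

End Measure.

(** * Loading the productions and completeness of the saturated table *)

Definition read_head :=
  3 :== Minus (Reg 4) (Num 1);;
  9 :== Deref (Reg 3);;
  scale 10 9;;
  3 :== Plus (Reg 4) (Num 1);;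
  7 :== Deref (Reg 3);;
  3 :== Plus (Reg 3) (Num 1);;
  8 :== Num 0.

(** The stack starts with the left-hand side, so the root symbol of the right-hand side becomes a
    rule for the nonterminal itself. *)
Definition prod_head :=
  19 :== Deref (Reg 3);;
  3 :== Plus (Reg 3) (Num 1);;
  scale 14 19;;
  Put 11 (Num 0) (Reg 14);;
  8 :== Num 1.

Definition read_prods := While (Reg 7) (prod_head;; forms;; next_prod).

Definition test (b : bool) :=
  25 :== Num 0;;
  For 35 (Reg 33) (25 :== Plus (Reg 25) (Reg 4));;
  let a := Ar 12 (Plus (Reg 25) (Reg 34)) in
  if b then If a Skip (32 :== Num 0) else If a (32 :== Num 0) Skip.

Definition check_value :=
  decode 18 12;;
  32 :== Num 1;;
  3 :== Num 1;;
  walk (test true);;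
  walk (test false);;
  If (Reg 32) (0 :== Num 1;; 1 :== Pt (Plus (Reg 30) (Reg 18))) Skip.

(** Input cell [S], two past the last word cell, holds the start symbol. All [W] values of its node
    are tried, and a later success replaces an earlier one. *)
Definition check :=
  0 :== Num 0;;
  9 :== Deref (Reg 4);;
  scale 30 9;;
  For 18 (Reg 6) (If (Ar 3 (Plus (Reg 30) (Reg 18))) check_value Skip).

Section Reading.
Variables (Sigma : finType) (G : rtg Sigma).
Variables (inp : nat -> nat) (S B : nat).
Implicit Types (e : ere Sigma) (nd : seq (form Sigma (nonterm G))).

Local Notation W := (2 ^ (S * S)).
Local Notation env := (env inp S B).
Local Notation val := (@val inp S Sigma).
Local Notation facts := (@facts Sigma G inp S B).
Local Notation node nd g := (nth (Leaf (inr (start G))) nd g).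
Local Notation parsed := (@parsed Sigma G inp S B).
Local Notation handled := (@handled Sigma G inp S).
Local Notation closed := (@closed Sigma inp S).
Local Notation input_at := (input_at inp B).

Definition read_cost :=
  node_cost S + cst W prod_head + cst W next_prod + 4.

Lemma read_prods_spec ps pos s nd E q Q :
  parsed nd E q [::] pos s -> regs s 7 = size ps ->
  input_at pos (flatten (map (@enc_prod _ _) ps)) ->
  (forall X t, List.In (X, t) ps -> List.In (X, t) (prods G)) ->
  (forall s' nd' E' q', fr read_prods s s' ->
     parsed nd' E' q' [::] (pos + size (flatten (map (@enc_prod _ _) ps))) s' ->
     (forall f, pr s f -> pr s' f) -> {subset E <= E'} ->
     (forall X t, List.In (X, t) ps -> handled E' s' (code X) t) ->
     size nd' <= size nd + weight ps -> size E' <= size E + 2 * weight ps -> Q s') ->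
  tri (read_cost * weight ps + 2) read_prods s Q.
Proof.
elim: ps pos s nd E q => [|[X t] ps IH] pos s nd E q Ps r7 I sub HQ.
  rewrite /weight big_nil muln0; apply: (@tri_done (Reg 7)) => //.
  by apply: (HQ s nd E q); rewrite ?addn0 ?leq_addr //; apply: frl_refl.
rewrite /weight big_cons -/(weight ps) mulnDr -addnA.
have [iX I1 pB] := input_at_cons I; have [I2 I3] := input_at_cat I1.
apply: (@tri_weak (2 + (cst W prod_head + ((node_cost S * ere_size t + 2) + cst W next_prod)) +
  (read_cost * weight ps + 2)) _ _ _ Q) => //.
  apply: (@tri_loop _ _ (Reg 7)); first by rewrite /= r7.
  case: (Ps) => Fs Es vl fl st r3 r10 nt qd; have Ev := f_env Fs.
  apply: tri_seq; apply: (trw_conseq (P := fun s' => regs s' 3 = pos.+1 /\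
     stack S (rcons [::] (code X)) s')) => //.
    have [_ _ _ _ em] := Ev.
    apply: trw_seq; apply: (trw_conseq (P := fun s' => regs s' 19 = code X)) => //.
      by apply: trw_set; sim; rewrite r3 em.
    move=> s1 F1 r19; apply: trw_seq; apply: (trw_conseq (P := fun s' => regs s' 3 = pos.+1)) => //.
      by apply: trw_set; sim; rewrite (frR F1) // r3 addn1.
    move=> s2 F2 r3'; have Ev2 : env s2.
      by apply: env_fr F2 _ _ => //; apply: env_fr F1 _ _.
    apply: trw_seq; apply: (trw_conseq _ (scale_spec (n := code X) Ev2 _ _ _)) => //.
      by rewrite (frR F2).
    move=> s3 F3 r14; apply: trw_seq; apply: trw_put; apply: trw_set; sim.
    rewrite (frR F3) // r3'; split=> //; split; first by sim.
    by move=> [|i] // _; sim; rewrite ar_seta //= r14.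
  move=> s1 F1 [r3' st']; have P1 f : pr s1 f = pr s f by rewrite (fr_pr _ F1).
  have Ps1 : parsed nd E q (rcons [::] (code X)) pos.+1 s1.
    split=> //.
    - exact: facts_fr F1 _ Fs.
    - exact: entries_fr F1 _ Es.
    - by rewrite (frR F1).
    - by move=> g v vW; rewrite P1; apply: qd.
  have [XL XE] := nt X.
  (* The continuation-passing statement of [parse_form] carries no frame; it is recovered from the
     execution itself. *)
  have forms_fr T s2 R : tri T forms s2 R -> tri T forms s2 (fun s' => fr forms s2 s' /\ R s').
    case=> t0 [s' [X0 L0 R0]]; exists t0, s'; split=> //; split=> //.
    exact: exec_fr X0.
  apply: tri_seq.
  pose R s' := fr forms s1 s' /\ exists nd' E' q',
    [/\ parsed (nd ++ nd') (E ++ E') (q ++ q') [::] (pos.+1 + size (enc_form t)) s',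
        (forall f, pr s1 f -> pr s' f) /\ handled (E ++ E') s' (code X) t,
        size nd' < ere_size t & size E' <= 2 * ere_size t].
  apply: (@tri_weak (node_cost S * ere_size t + 2) _ _ _ R) => //.
    apply: forms_fr; apply: (parse_form Ps1 I2 XL).
      by move=> e ge; rewrite XE; apply: gen_prod ge; apply: sub; left.
    move=> s2 nd2 E2 q2 Ps2 _ M2 h2 sn2 sE2; apply: (@tri_done (Reg 8)).
      by have [/= -> _] := p_stack Ps2.
    by exists nd2, E2, q2.
  move=> s2 [F2 [nd2 [E2 [q2 [Ps2 [M2 h2] sn2 sE2]]]]].
  apply: (trw_conseq (P := fun s' => regs s' 7 = size ps)) => //.
    by apply: trw_set; sim; rewrite (frR F2) // (frR F1) // r7 subn1.
  move=> s3 F3 r7'; have F : fr read_prods s s3.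
    apply: (@frl_trans _ _ _ s2) => //; last by apply: frW F3.
    by apply: (@frl_trans _ _ _ s1) => //; [apply: frW F1 | apply: frW F2].
  have P3 f : pr s3 f = pr s2 f by rewrite (fr_pr _ F3).
  have Ps3 : parsed (nd ++ nd2) (E ++ E2) (q ++ q2) [::] (pos.+1 + size (enc_form t)) s3.
    case: Ps2 => A1 A2 A3 A4 A5 A6 A7 A8 A9; split=> //.
    - exact: facts_fr F3 _ A1.
    - exact: entries_fr F3 _ A2.
    - exact: stack_fr F3 _ A5.
    - by rewrite (frR F3).
    - by rewrite (frR F3).
    - by move=> g v vW; rewrite P3; apply: A9.
  apply: (IH _ _ _ _ _ Ps3) => //.
    by move=> Y u H; apply: sub; right.
  move=> s4 nd4 E4 q4 F4 Ps4 M4 sE4 h4 szn szE.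
  apply: (HQ s4 nd4 E4 q4).
  - exact: frl_trans F F4.
  - have <- // : pos.+1 + size (enc_form t) + size (flatten (map (@enc_prod _ _) ps)) =
      pos + size (flatten (map (@enc_prod _ _) ((X, t) :: ps))).
    by rewrite /= size_cat; lia.
  - by move=> f p; apply: M4; rewrite P3; apply: M2; rewrite P1.
  - by move=> x xE; apply: sE4; rewrite mem_cat xE.
  - move=> Y u [[<- <-]|]; last exact: h4.
    by apply: handled_mono h2 => // f p; apply: M4; rewrite P3.
  - by move: szn; rewrite size_cat /weight big_cons /=; lia.
  - by move: szE; rewrite size_cat /weight big_cons /=; lia.
rewrite leq_add2r /read_cost; move: (cst _ prod_head) (cst _ next_prod) (node_cost S) => a b c.
by rewrite /= mulnS; nia.
Qed.

(** Induction on the derivation, in which [handled] exhibits the rule for each symbol and [closed]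
    with nothing pending yields its conclusion. Going from a nonterminal to a production starts
    afresh with the certificate of that production. *)
Lemma saturated_complete E s :
  closed E [::] s ->
  (forall X t, List.In (X, t) (prods G) -> handled E s (code X) t) ->
  forall (X : nonterm G) e, gen (G := G) (Leaf (inr X)) e -> pr s (code X * W + val e).
Proof.
move=> Cl H.
have main t e : gen (G := G) t e -> forall g, handled E s g t -> pr s (g * W + val e).
  elim=> {t e} [c|X t e Xt _ IH|t1 t2 e1 e2 _ IH1 _ IH2|t1 t2 e1 e2 _ IH1 _ IH2
    |t1 t2 e1 e2 _ IH1 _ IH2|t e _ IH|t e _ IH] g //=.
  - by move=> xE; have p := IH _ (H _ _ Xt); case: (Cl _ _ _ _ _ xE e e p p).
  - by case=> a [b [xE /IH1 p1 /IH2 p2]]; case: (Cl _ _ _ _ _ xE _ _ p1 p2).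
  - by case=> a [b [xE /IH1 p1 /IH2 p2]]; case: (Cl _ _ _ _ _ xE _ _ p1 p2).
  - by case=> a [b [xE /IH1 p1 /IH2 p2]]; case: (Cl _ _ _ _ _ xE _ _ p1 p2).
  - by case=> a [xE /IH p]; case: (Cl _ _ _ _ _ xE _ _ p p).
  - by case=> a [xE /IH p]; case: (Cl _ _ _ _ _ xE _ _ p p).
by move=> X e H'; inversion H'; subst; apply: main; [eassumption|apply: H].
Qed.

Lemma test_spec b m i j s : env s -> i < S -> j < S ->
  (forall n, n < S * S -> ar s 12 n = flat S m n) ->
  regs s 33 = i -> regs s 34 = j ->
  trw W (test b) s (fun s' =>
    (regs s' 32 != 0) = (regs s 32 != 0) && (m i j == b)).
Proof.
move=> E iS jS b1 r33 r34; have [/andP[S0 _] _ r4 _ _] := E.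
apply: trw_seq; apply: trw_set; apply: trw_seq.
apply: (trw_for (n := i) (I := fun k s' => regs s' 25 = k * S)) => //.
- apply: leq_trans (ltnW iS) _; apply: leq_trans (S_W S).
  by rewrite leq_pmulr.
- by move=> s1 F1; rewrite /= (frR F1) //; sim.
- move=> k s1 kS F1 _ r25; apply: trw_set; sim.
  by rewrite r25 (frR F1) //; sim; rewrite r4 mulSnr.
move=> s1 F1 r25.
have A : ar s1 12 (regs s1 25 + regs s1 34) = m i j.
  rewrite r25 (frR F1) //; sim; rewrite r34 (frA F1) //; sim.
  by rewrite b1 ?flatE // idx_lt.
have r32 : regs s1 32 = regs s 32 by rewrite (frR F1) //; sim.
by case: b; apply: trw_if; sim; rewrite A => D; [apply: trw_skip|apply: trw_set|
  apply: trw_set|apply: trw_skip]; sim; rewrite ?r32; case: (m i j) D; rewrite ?andbT ?andbF.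
Qed.

End Reading.

(** * From values back to languages, and the final check *)

Lemma enc_inj f g n c : enc f n c = enc g n c -> forall k, n <= k < n + c -> f k = g k.
Proof.
elim: c n => [|c IH] n /= H k Hk; first by lia.
have [fg H'] : f n = g n /\ enc f n.+1 c = enc g n.+1 c.
  by move: H; case: (f n); case: (g n) => /= H; split=> //; lia.
case: (eqVneq k n) => [->//|kn]; apply: (IH n.+1) => //; move: kn Hk; lia.
Qed.

Lemma size_enc_words (S : finType) (ws : seq (seq S)) :
  size (enc_words ws) = (size ws + \sum_(w <- ws) size w).+1.
Proof.
suff H : size (flatten (map (@enc_word S) ws)) = size ws + \sum_(w <- ws) size w.
  exact: congr1 H.
elim: ws => [|w ws IH]; first by rewrite big_nil.
rewrite big_cons (_ : flatten _ = enc_word w ++ flatten (map (@enc_word S) ws)) //.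
by rewrite size_cat IH enc_wordE /= size_map; lia.
Qed.

Section Check.
Variables (Sigma : finType) (G : rtg Sigma) (P N : seq (seq Sigma)).
Variables (inp : nat -> nat) (S B : nat).
Implicit Types (e : ere Sigma) (nd : seq (form Sigma (nonterm G))).

Local Notation W := (2 ^ (S * S)).
Local Notation env := (env inp S B).
Local Notation val := (@val inp S Sigma).
Local Notation mt := (@mt inp S Sigma).
Local Notation facts := (@facts Sigma G inp S B).
Local Notation node nd g := (nth (Leaf (inr (start G))) nd g).
Local Notation input_at := (input_at inp B).

Lemma words_located ws p (w : seq Sigma) : input_at p (enc_words ws) -> w \in ws ->
  exists2 q, q + size w <= p + size (enc_words ws) & located inp q w.
Proof.
rewrite -[enc_words ws]/(size ws :: flatten (map (@enc_word Sigma) ws)).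
case/input_at_cons=> _ I _; rewrite [size (_ :: _)]/= addnS -addSn.
move: p.+1 I => {}p; elim: ws p => // u ws IH p.
rewrite (_ : flatten _ = enc_word u ++ flatten (map (@enc_word Sigma) ws)) // enc_wordE => I.
have [_ I1 _] := input_at_cons I; have [I2 I3] := input_at_cat I1.
rewrite size_map in I3; rewrite inE /= size_cat size_map => /orP[/eqP -> |wws].
  by exists p.+1; [lia | exact: input_at_located I2].
by have [q qL ql] := IH _ I3 wws; exists q => //; move: qL; lia.
Qed.

(** The justification for keeping one expression per value: when it fails to separate, so does every
    other expression with the same value. *)
Lemma val_lang e e' i (w : seq Sigma) : val e = val e' -> i + size w < S -> located inp i w ->
  lang e w -> lang e' w.
Proof.
move=> ee iS lw /(mt_lang _ iS lw) m; apply/(mt_lang _ iS lw).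
have iS' : i < S by apply: leq_ltn_trans iS; apply: leq_addr.
have := enc_inj ee (k := i * S + (i + size w)); rewrite !flatE // m => <- //.
by rewrite /= add0n idx_lt.
Qed.

Definition okw (b : bool) e w := if b then lang e w else ~ lang e w.

Lemma walk_test b e ws p s : env s ->
  (forall n, n < S * S -> ar s 12 n = flat S (mt e) n) ->
  regs s 3 = p -> input_at p (enc_words ws) -> p + size (enc_words ws) < S ->
  trw W (walk (test b)) s (fun s' => regs s' 3 = p + size (enc_words ws) /\
    (regs s' 32 != 0 <-> regs s 32 != 0 /\ forall w, w \in ws -> okw b e w)).
Proof.
move=> E b1 r3 I pS; have [/andP[S0 _] e2 _ _ em] := E.
have okt : okc (walk (test b)) by case: b.
apply: (walk_spec (B := B) (I := fun ws' s' =>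
  (regs s' 32 != 0 /\ forall w, w \in ws' -> okw b e w) <->
  (regs s 32 != 0 /\ forall w, w \in ws -> okw b e w)) _ _ r3 I).
- by case: (b).
- apply: leq_trans (S_W S); apply: (@leq_trans S); last by rewrite leq_pmulr.
  by move: pS; rewrite size_enc_words; lia.
- by move=> s' F a aB; rewrite (frM F) ?e2 // em.
- by move=> s' H; rewrite H.
- move=> w ws' q s' F I1 qL lw s1 F1 r33 r34.
  have qS : q + size w < S by apply: leq_ltn_trans pS.
  have E1 : env s1.
    by apply: env_fr F1 _ _ => //; apply: env_fr F _ E; case: (b).
  apply: (trw_conseq _ (test_spec b (m := mt e) (i := q) (j := q + size w) E1 _ qS _ r33 r34)).
  + by case: (b).
  + by apply: leq_ltn_trans qS; apply: leq_addr.
  + move=> n nS; rewrite (frA F1) // (frA F) ?b1 //.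
    by case: (b).
  move=> s2 F2 t2 s3 H3; rewrite H3 // t2 (frR F1) //.
  have mw : (mt e q (q + size w) == b) <-> okw b e w.
    have := mt_lang e qS lw; case: (mt _ _ _); case: (b) => /= H; split=> //.
    - by move=> _; apply/H.
    - by move=> n; case: n; apply/H.
    - by move/H.
    - by move=> _ /H.
  rewrite -I1; split=> [[/andP[h1 /mw h2] h3]|[h1 h2]].
    by split=> // u; rewrite inE => /orP[/eqP ->|/h3].
  split=> [|u uw]; last by apply: h2; rewrite inE uw orbT.
  by rewrite h1; apply/mw; apply: h2; rewrite inE eqxx.
- move=> s' F I1 r3'; split=> //; rewrite -I1.
  by split=> [h|[]].
Qed.

Lemma check_value_spec nd q v e s :
  facts nd q s -> regs s 18 = v -> v = val e ->
  input_at 1 (enc_words P) -> input_at (1 + size (enc_words P)) (enc_words N) ->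
  1 + size (enc_words P) + size (enc_words N) < S ->
  trw W check_value s (fun s' =>
    (separates P N e /\ regs s' 0 = 1 /\ regs s' 1 = B + 16 * (regs s 30 + v)) \/
    (~ separates P N e /\ regs s' 0 = regs s 0 /\ regs s' 1 = regs s 1)).
Proof.
move=> Fs r18 ve IP IN hS; have E := f_env Fs; case: (E) => _ e2 _ _ _.
apply: trw_seq; apply: (trw_conseq _ (decode_spec (f := flat S (mt e)) _ _ _ E _)) => //.
  by rewrite r18.
move=> s1 F1 b1; have E1 := env_fr F1 isT E.
apply: trw_seq; apply: (trw_conseq (P := fun s' => regs s' 32 = 1)) => //.
  by apply: trw_set; sim.
move=> s2 F2 r32.
apply: trw_seq; apply: (trw_conseq (P := fun s' => regs s' 3 = 1)) => //.
  by apply: trw_set; sim.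
move=> s3 F3 r3; have E3 : env s3 by apply: env_fr F3 _ _ => //; apply: env_fr F2 _ _.
apply: trw_seq; apply: (trw_conseq _ (walk_test true (e := e) E3 _ r3 IP _)) => //.
- by move=> n nS; rewrite (frA F3) // (frA F2) // b1.
- by lia.
move=> s4 F4 [r3' H4]; have E4 := env_fr F4 isT E3.
apply: trw_seq; apply: (trw_conseq _ (walk_test false (e := e) E4 _ r3' IN _)) => //.
  by move=> n nS; rewrite (frA F4) // (frA F3) // (frA F2) // b1.
move=> s5 F5 [_ H5]; have [_ e2' _ _ _] := env_fr F5 isT E4.
have r30 : regs s5 30 = regs s 30.
  by rewrite (frR F5) // (frR F4) // (frR F3) // (frR F2) // (frR F1).
have r18' : regs s5 18 = v.
  by rewrite (frR F5) // (frR F4) // (frR F3) // (frR F2) // (frR F1).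
have sep : regs s5 32 != 0 <-> separates P N e.
  rewrite H5 H4 (frR F3) // r32; split=> [[[_ h1] h2]|[h1 h2]].
    by split=> w; [apply: h1 | apply: h2].
  by split=> [|w wN]; [split=> // w wP; apply: h1 | apply: h2].
apply: trw_if => /= [/sep h|/eqP h].
  by apply: trw_seq; do 2 (apply: trw_set; sim); left; rewrite e2' r30 r18'.
apply: trw_skip; right; split; first by move/sep; rewrite h.
by split; rewrite (frR F5) // (frR F4) // (frR F3) // (frR F2) // (frR F1).
Qed.

Lemma check_spec nd q s :
  facts nd q s -> node nd (code (start G)) = Leaf (inr (start G)) ->
  (forall e, gen (G := G) (Leaf (inr (start G))) e -> pr s (code (start G) * W + val e)) ->
  input_at 1 (enc_words P) -> input_at (1 + size (enc_words P)) (enc_words N) ->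
  1 + size (enc_words P) + size (enc_words N) < S -> S < B ->
  inp S = code (start G) ->
  trw W check s (answers P N G).
Proof.
move=> Fs nst complete IP IN hS SB iS.
have E := f_env Fs; case: (E) => _ e2 r4 [_ r6] em.
have spec e : tree_lang G e <-> gen (Leaf (inr (start G))) e := tree_lang_gen G e.
apply: trw_seq; apply: (trw_conseq (P := fun s' => regs s' 0 = 0)) => //.
  by apply: trw_set; sim.
move=> s1 F1 r0; apply: trw_seq; apply: (trw_conseq (P := fun s' => regs s' 9 = code (start G))) => //.
  by apply: trw_set; sim; rewrite (frR F1) // r4 (frM F1) ?e2 // em.
move=> s2 F2 r9; have E2 : env s2 by apply: env_fr F2 _ _ => //; apply: env_fr F1 _ _.
apply: trw_seq; apply: (trw_conseq _ (scale_spec (n := code (start G)) E2 _ _ r9)) => //.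
move=> s3 F3 r30.
have Fs3 : facts nd q s3.
  by apply: facts_fr F3 _ _ => //; apply: facts_fr F2 _ _ => //; apply: facts_fr F1 _ _.
have P3 f : pr s3 f = pr s f by rewrite (fr_pr _ F3) // (fr_pr _ F2) // (fr_pr _ F1).
have r0' : regs s3 0 = 0 by rewrite (frR F3) // (frR F2).
have [_ e23 _ [_ r63] _] := f_env Fs3.
(* Either a solution has been recorded, or no derivable expression of value below [k] is one. An
   absent value is excluded by [complete], a rejected one by [val_lang]. *)
apply: (trw_for (n := W) (I := fun k s' =>
  (regs s' 0 = 1 /\ exists f e, [/\ regs s' 1 = B + 16 * f, htree B s' f e & solution P N G e]) \/
  (regs s' 0 = 0 /\ forall e, tree_lang G e -> val e < k -> ~ separates P N e))) => //.
- by move=> s4 F4; rewrite /= (frR F4).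
- by right; sim.
- move=> v s4 vW F4 r18 I4.
  have Fs4 : facts nd q s4 by apply: facts_fr F4 _ _.
  have r30' : regs s4 30 = code (start G) * W by rewrite (frR F4).
  have P4 f : pr s4 f = pr s f by rewrite (fr_pr _ F4).
  apply: trw_if; sim; rewrite r30' r18 => p; last first.
    apply: trw_skip; case: I4 => [[h0 [f [e [h1 h2 h3]]]]|[h0 h]].
      left; sim; split=> //; exists f, e; split=> //.
      by apply: htree_ext h2 => [f'|k f' _ _]; rewrite ?pr_setr //; sim.
    right; sim; split=> // e ge; rewrite ltnS leq_eqVlt => /orP[/eqP ev|]; last exact: h.
    have := complete e; rewrite -P4 ev /pr p => H _.
    by move/spec: ge => /H.
  have [e [ge ve he]] := facts_sound Fs4 vW p; rewrite nst in ge.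
  apply: (trw_conseq _ (check_value_spec Fs4 r18 ve IP IN hS)) => // s5 F5 H5.
  case: I4 => [[h0 [f [e' [h1 h2 h3]]]]|[h0 h]].
    left; sim; case: H5 => [[sep [-> r1]]|[_ [-> r1]]]; split=> //.
      exists (code (start G) * W + v), e; split=> //; last by split=> //; apply/spec.
        by rewrite r1 r30'.
      apply: (htree_ext (s := s5)) => [f'|k f' _ _|]; rewrite ?pr_setr //; sim.
      exact: fr_htree F5 _ he.
    exists f, e'; split=> //; first by rewrite r1.
    apply: (htree_ext (s := s5)) => [f'|k f' _ _|]; rewrite ?pr_setr //; sim.
    exact: fr_htree F5 _ h2.
  case: H5 => [[sep [r0'' r1]]|[nsep [r0'' r1]]].
    left; sim; split=> //.
    exists (code (start G) * W + v), e; split=> //; last by split=> //; apply/spec.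
      by rewrite r1 r30'.
    apply: (htree_ext (s := s5)) => [f'|k f' _ _|]; rewrite ?pr_setr //; sim.
    exact: fr_htree F5 _ he.
  right; sim; rewrite r0''; split=> // e' ge'; rewrite ltnS leq_eqVlt => /orP[/eqP ev|]; last exact: h.
  move=> [sP sN]; apply: nsep; split=> w wI.
    have [q' qL ql] := words_located IP wI.
    apply: (val_lang (e := e') (i := q')) => //; first by rewrite ev.
      by lia.
    exact: sP.
  have [q' qL ql] := words_located IN wI => L; apply: (sN _ wI).
  apply: (val_lang (e := e) (i := q')) => //; first by rewrite ev.
  by lia.
- move=> s4 F4 [[h0 [f [e [h1 h2 h3]]]]|[h0 h]].
    left; split=> //; exists e; split=> //; rewrite h1; apply: htree_at => //.
    by rewrite (frR F4).
  right; split=> // -[e [ge sep]]; apply: h sep => //; exact: val_lt.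
Qed.

End Check.

(** * The whole program and its running time *)

Definition program :=
  measure_head;; skip_prods;; 2 :== Reg 3;; read_head;; read_prods;; saturate;; check.

(* A program at least as expensive as every loop body of [program]. *)
Definition bodies :=
  measure_head;; skip_step;; skip_head;; next_prod;; read_head;; node_step;;
  prod_head;; pop;; process;; check.

(** The left side is [m + 4] plus the total length of the words. If [n] is positive, [m] and the
    total length are both at most [m * n ^ 2]. If [n = 0], only the empty word can occur; absence of
    repetitions then gives [m <= 2], whence the constant 6. *)
Lemma text_length_le (Sigma : finType) (P N : seq (seq Sigma)) :
  uniq P -> uniq N ->
  (1 + size (enc_words P) + size (enc_words N)).+1 <=
  6 + 2 * ((size P + size N) * (\max_(w <- P ++ N) size w) ^ 2).
Proof.
move=> uP uN; set m := _ + size N; set n := \max_(w <- _) _; rewrite !size_enc_words.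
have le_n w : w \in P ++ N -> size w <= n by move=> wI; apply: leq_bigmax_seq.
have sum_le : \sum_(w <- P) size w + \sum_(w <- N) size w <= m * n.
  rewrite -big_cat /= /m -size_cat big_seq.
  apply: (leq_trans (leq_sum _ (fun w => le_n w))).
  by rewrite -big_seq big_const_seq count_predT iter_addn_0 mulnC.
case: (posnP n) => n0.
  have small (Q : seq (seq Sigma)) : uniq Q -> {subset Q <= P ++ N} -> size Q <= 1.
    move=> uQ sQ; apply: (@uniq_leq_size _ Q [:: [::]]) => // w /sQ /le_n.
    by rewrite n0 leqn0 inE size_eq0.
  have := small P uP; have := small N uN; move: sum_le; rewrite n0 muln0 => H1 H2 H3.
  have {}H2 : size N <= 1 by apply: H2 => w wN; rewrite mem_cat wN orbT.
  have {}H3 : size P <= 1 by apply: H3 => w wP; rewrite mem_cat wP.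
  by lia.
have : m <= m * n ^ 2 by rewrite leq_pmulr // expn_gt0 n0.
have : m * n <= m * n ^ 2 by rewrite leq_mul2l expnS expn1 leq_pmulr ?orbT.
by rewrite /m in sum_le *; lia.
Qed.

Section Run.
Variables (Sigma : finType) (P N : seq (seq Sigma)) (G : rtg Sigma).

Let input := encode P N G.
Let inp := nth 0 input.
Let B := size input.
Let S := (1 + size (enc_words P) + size (enc_words N)).+1.
Let ps := prods G.

Local Notation W := (2 ^ (S * S)).
Local Notation input_at := (input_at inp B).
Local Notation env := (env inp S B).

Lemma input_words : [/\ input_at 1 (enc_words P),
  input_at (1 + size (enc_words P)) (enc_words N) &
  input_at S.-1 (enc_rtg G)].
Proof.
have I0 : input_at 0 input by split.
have [_ I1 _] := input_at_cons I0; have [I2 I3] := input_at_cat I1.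
by have [I4 I5] := input_at_cat I3.
Qed.

Lemma input_rtg : [/\ inp S.-1 = #|nonterm G|, inp S = code (start G),
  inp S.+1 = size ps, input_at S.+2 (flatten (map (@enc_prod _ G) ps)) & S.+1 < B].
Proof.
have [_ _ I] := input_words; have [i1 I1 _] := input_at_cons I.
by have [i2 I2 _] := input_at_cons I1; have [i3 I3 H] := input_at_cons I2.
Qed.

Lemma input_size : B = S.+2 + size (flatten (map (@enc_prod _ G) ps)).
Proof.
have -> : B = (size (enc_words P ++ enc_words N ++ enc_rtg G)).+1 by [].
rewrite !size_cat.
have -> : size (enc_rtg G) = (size (flatten (map (@enc_prod _ G) ps))).+3 by [].
rewrite /S; lia.
Qed.

Lemma size_enc_words_W (ws : seq (seq Sigma)) : size (enc_words ws) < S -> size ws <= W.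
Proof.
rewrite size_enc_words => H; apply: leq_trans (S_W S).
by apply: (@leq_trans S); [lia | rewrite leq_pmulr].
Qed.

Lemma measure_head_spec : trw W measure_head (init input) (fun s =>
  [/\ regs s 4 = S, regs s 5 = S * S, regs s 6 = W, regs s 3 = S.+2 & regs s 7 = size ps]).
Proof.
have [IP IN _] := input_words; have [i1 i2 i3 I4 SB] := input_rtg.
have rd c s : fr c (init input) s -> wa c = [::] -> forall a, mem s a = inp a.
  by move=> F n a; rewrite (frM0 _ F).
apply: trw_seq; apply: (trw_conseq (P := fun s' => regs s' 3 = 1)) => //.
  by apply: trw_set; sim.
move=> s1 F1 r3; have m1 := rd _ _ F1 erefl.
apply: trw_seq; apply: (trw_conseq (P := fun s' => regs s' 3 = 1 + size (enc_words P))) => //.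
  apply: (walk_spec (B := B) (I := fun _ _ => True) _ _ r3 IP) => //.
  - by apply: size_enc_words_W; rewrite /S; lia.
  - by move=> s' F a _; rewrite (frM0 _ F).
  - by move=> *; apply: trw_skip.
move=> s2 F2 r3'; have m2 a : mem s2 a = inp a by rewrite (frM0 _ F2).
apply: trw_seq; apply: (trw_conseq (P := fun s' => regs s' 3 = S.-1)) => //.
  apply: (walk_spec (B := B) (I := fun _ _ => True) _ _ r3' IN) => //.
  - by apply: size_enc_words_W; rewrite /S; lia.
  - by move=> s' F a _; rewrite (frM0 _ F).
  - by move=> *; apply: trw_skip.
move=> s3 F3 r3''; have m3 a : mem s3 a = inp a by rewrite (frM0 _ F3).
apply: trw_seq; apply: (trw_conseq _ (sizes_spec r3'' _)) => // s4 F4 [r4 r5 r6].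
have r34 : regs s4 3 = S.-1 by rewrite (frR F4).
apply: trw_seq; apply: trw_set; apply: trw_seq; do 2 (apply: trw_set; sim).
by rewrite r34 (frM0 _ F4) // m3 addn1 addn2 i3.
Qed.

Definition total_cost :=
  let nn := #|nonterm G| + weight ps in let ne := 2 * weight ps in
  cst W measure_head + ((skip_prod_cost W * weight ps + 2) + (2 + (cst W read_head +
   ((read_cost S * weight ps + 2) +
    ((W * (nn * (cst W pop + 6) + process_cost S * ne) + 4) + cst W check))))).

(** Measuring stores nothing, and [init] yields 0 beyond the input: all arrays start as zero, that
    is, with no facts and with empty lists. *)
Lemma initial_env s : fr (measure_head;; skip_prods) (init input) s ->
  regs s 4 = S -> regs s 5 = S * S -> regs s 6 = W ->
  env (setr s 2 B) /\ forall k i, ar (setr s 2 B) k i = 0.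
Proof.
move=> F r4 r5 r6; have [_ _ _ _ SB] := input_rtg.
have m a : mem s a = inp a by rewrite (frM0 _ F).
split; first by split=> [|||//|a _]; rewrite ?stE //= ltnW // ltnW.
move=> k i; rewrite arE !stE /= m /inp nth_default // -/B; lia.
Qed.

Lemma read_head_spec s : env s -> trw W read_head s (fun s' =>
  [/\ regs s' 10 = #|nonterm G| * W, regs s' 7 = size ps, regs s' 3 = S.+2 & regs s' 8 = 0]).
Proof.
have [i1 i2 i3 I4 SB] := input_rtg; move=> E; have [_ e2 r4 _ em] := E.
apply: trw_seq; apply: (trw_conseq (P := fun s' => regs s' 3 = S.-1)) => //.
  by apply: trw_set; sim; rewrite r4 subn1.
move=> s1 F1 r3; have [_ _ _ _ em1] := env_fr F1 isT E.
apply: trw_seq; apply: (trw_conseq (P := fun s' => regs s' 9 = #|nonterm G|)) => //.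
  by apply: trw_set; sim; rewrite r3 em1 //; lia.
move=> s2 F2 r9; have E2 : env s2 by apply: env_fr F2 _ _ => //; apply: env_fr F1 _ _.
apply: trw_seq; apply: (trw_conseq _ (scale_spec E2 _ _ r9)) => // s3 F3 r10.
have [_ _ r4' _ em3] := env_fr F3 isT E2.
do 3 (apply: trw_seq; apply: trw_set; sim); apply: trw_set; sim.
by rewrite r4' r10 em3 addn1 // addn1 i3.
Qed.

Lemma initial_parsed s : env s -> (forall k i, k \in [:: 3; 4] -> ar s k i = 0) ->
  regs s 10 = #|nonterm G| * W -> regs s 3 = S.+2 -> regs s 8 = 0 ->
  regs s 11 = 0 -> regs s 13 = 0 ->
  parsed inp S B [seq Leaf (inr X) | X <- enum (nonterm G)] [::] [::] [::] S.+2 s.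
Proof.
move=> E a0 r10 r3 r8 r11 r13.
have np f : pr s f = false by rewrite /pr a0.
split=> //.
- split=> //.
  + by move=> g v _; rewrite np.
  + move=> g; rewrite addn0; under eq_bigr do rewrite np.
    by rewrite sum_nat_const card_ord muln1.
- by split=> // g; rewrite a0.
- by rewrite size_map -cardE.
- move=> X; rewrite size_map -cardE; split; first exact: ltn_ord.
  by rewrite (nth_map (start G)) -?cardE ?ltn_ord // nth_enum_rank.
- by move=> g v _; rewrite np.
Qed.

Lemma program_spec : tri total_cost program (init input) (answers P N G).
Proof.
have [IP IN _] := input_words; have [i1 i2 i3 I4 SB] := input_rtg.
apply: tri_seq; apply: (trw_conseq _ measure_head_spec) => // s1 F1 [r4 r5 r6 r3 r7].
have m1 : reads inp B s1 by move=> a _; rewrite (frM0 _ F1).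
apply: tri_seq; apply: (@skip_prods_spec _ _ _ _ W _ _ _ _ r7 r3 m1 I4) => s2 F2 r3'.
have F12 : fr (measure_head;; skip_prods) (init input) s2.
  by apply: (@frl_trans _ _ _ s1) => //; [apply: frW F1 | apply: frW F2].
have [r4' r5' r6'] : [/\ regs s2 4 = S, regs s2 5 = S * S & regs s2 6 = W].
  by rewrite !(frR F2).
have [E3 z3] := initial_env F12 r4' r5' r6'.
apply: tri_seq; exists 2, (setr s2 2 B); split=> //.
  have -> : B = aeval s2 (Reg 3) by rewrite /= r3' -input_size.
  exact: exec_assign.
move: E3 z3; set s3 := setr s2 2 B => E3 z3.
apply: tri_seq; apply: (trw_conseq _ (read_head_spec E3)) => // s4 F4 [r10 r7' r3'' r8].
have E4 := env_fr F4 isT E3.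
have Ps4 := initial_parsed E4 _ r10 r3'' r8.
have {}Ps4 : parsed inp S B [seq Leaf (inr X) | X <- enum (nonterm G)] [::] [::] [::] S.+2 s4.
  apply: Ps4 => [k i||].
  - by rewrite !inE => /orP[] /eqP ->; rewrite (frA F4).
  - by rewrite (frR F4) // /s3 stE /= (frR F12).
  - by rewrite (frR F4) // /s3 stE /= (frR F12).
apply: tri_seq; apply: (read_prods_spec Ps4 r7' I4) => //.
move=> s5 nd E q F5 Ps5 _ _ hd szn szE.
have [Fs5 Es5 vl fl _ _ _ nt qd] := Ps5.
apply: tri_seq; apply: (pop_loop (h := 0) vl fl Fs5 Es5) => //.
- by rewrite (frR F5) // (frR F4) // /s3 stE /= (frR F12).
(* The head is still 0, so the whole queue is pending and it contains the node of every fact. *)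
- rewrite drop0 => o g a b k _ e1 e2 p _; apply: Or32; apply: qd p; exact: val_lt.
- apply: (leq_trans (slack_le _ _ _ _ _)); rewrite leq_mul2l; apply/orP; right.
  apply: leq_add; apply: leq_mul => //.
  by move: szn; rewrite size_map -cardE.
move=> s6 q' Fs6 M6 Cl6; have [_ nst] := nt (start G).
have complete e : gen (G := G) (Leaf (inr (start G))) e ->
    pr s6 (code (start G) * W + val inp S e).
  apply: (saturated_complete Cl6) => X t Xt.
  by apply: handled_mono (hd _ _ Xt) => // x.
apply: (trw_conseq _ (check_spec Fs6 nst complete IP IN _ _ i2)) => //.
by rewrite ltnW.
Qed.

(** The bounds [B1] to [B4] contribute 1, 7, 7 and 13 copies of the product, and the remaining
    constants add up to 10; 50 leaves a margin. *)
Lemma total_cost_le : total_cost <= 50 * (W * cst W bodies * rtg_size G).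
Proof.
have W0 : 0 < W by rewrite expn_gt0.
have V0 : 0 < #|nonterm G| by apply/card_gt0P; exists (start G).
have -> : rtg_size G = #|nonterm G| + weight ps by [].
have -> : cst W bodies = cst W measure_head + (cst W skip_step + (cst W skip_head +
  (cst W next_prod + (cst W read_head + (cst W node_step + (cst W prod_head +
  (cst W pop + (cst W process + cst W check)))))))) by [].
rewrite /total_cost /skip_prod_cost /skip_cost /read_cost /node_cost /process_cost.
have : 0 < cst W measure_head by [].
move: (cst W measure_head) (cst W skip_step) (cst W skip_head) (cst W next_prod)
  (cst W read_head) (cst W node_step) (cst W prod_head) (cst W pop) (cst W process)
  (cst W check) (weight ps) #|_| V0 W0.
move: W => w a b c d e f g h i j r v v0 w0 a0.
set M := a + (b + (c + (d + (e + (f + (g + (h + (i + j)))))))).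
have H1 : a + e + j <= M by rewrite /M; lia.
have H2 : b + c + d <= M by rewrite /M; lia.
have H3 : f + g + d <= M by rewrite /M; lia.
have H4 : h + i <= M by rewrite /M; lia.
have M0 : 0 < M by rewrite /M; lia.
move: M H1 H2 H3 H4 M0 => M H1 H2 H3 H4 M0.
have R0 : 0 < v + r by lia.
have wMR k : k <= M * (v + r) -> k <= w * M * (v + r).
  by move=> H; apply: leq_trans H _; rewrite -mulnA leq_pmull.
have B1 : a + e + j <= w * M * (v + r).
  by apply: wMR; apply: leq_trans H1 _; rewrite leq_pmulr.
have B2 : (b.+2 + c + d + 4) * r <= 7 * (w * M * (v + r)).
  apply: (@leq_trans (7 * M * (v + r))); first by apply: leq_mul; lia.
  by rewrite -mulnA leq_mul2l /=; apply: wMR.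
have B3 : (f.+2 + g + d + 4) * r <= 7 * (w * M * (v + r)).
  apply: (@leq_trans (7 * M * (v + r))); first by apply: leq_mul; lia.
  by rewrite -mulnA leq_mul2l /=; apply: wMR.
have B4 : w * ((v + r) * (h + 6) + i.+2 * (2 * r)) <= 13 * (w * M * (v + r)).
  rewrite -mulnA [13 * _]mulnCA leq_mul2l; apply/orP; right.
  apply: (@leq_trans ((v + r) * (7 * M) + (3 * M) * (2 * (v + r)))).
    by apply: leq_add; apply: leq_mul; lia.
  by nia.
have B5 : 1 <= w * M * (v + r) by rewrite !muln_gt0 w0 M0.
by move: B1 B2 B3 B4 B5; move: (w * M * _) => K; lia.
Qed.

End Run.

Theorem theorem5p1 :
  exists (c : com) (p : {poly nat}) (C : nat),
    forall (Sigma : finType) (P N : seq (seq Sigma)) (G : rtg Sigma),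
      uniq P -> uniq N ->
      let m := size P + size N in
      let n := \max_(w <- P ++ N) size w in
      exists (t : nat) (s : state),
        [/\ exec c (init (encode P N G)) t s,
            t <= C * (2 ^ (p.[(m * n ^ 2)%N])%R * rtg_size G)
          & answers P N G s].
Proof.
(* Hiding the degree behind a variable keeps it from being computed. The successor accounts for the
   factor [W] in front of [cst W bodies]. *)
have [d ed] : exists d, d = (cst_deg bodies).+1 by eexists.
(* The polynomial is [d * (6 + 2 * x) ^ 2], from [S <= 6 + 2 * x] and [W ^ d = 2 ^ (S * S * d)]. *)
exists program, (Poly [:: d * 36; d * 24; d * 4]), (50 * cst_coef bodies).
move=> Sigma P N G uP uN m n.
have [t [s [X L A]]] := program_spec P N G.
exists t, s; split=> //; apply: leq_trans L _.
apply: (leq_trans (total_cost_le P N G)).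
have SL := text_length_le uP uN; rewrite -/m -/n in SL.
move: SL; set S := (_.+1); move: (m * n ^ 2) => x SL.
have -> : (Poly [:: d * 36; d * 24; d * 4]).[x]%R = d * 36 + (d * 24 + d * 4 * x) * x.
  rewrite horner_Poly /= GRing.mul0r GRing.add0r -[LHS]/((d * 4 * x + d * 24) * x + d * 36); lia.
have W0 : 0 < 2 ^ (S * S) by rewrite expn_gt0.
have cb := cst_le bodies W0; move: (cst_deg bodies) ed cb => k ed cb.
rewrite -[50 * cst_coef _ * _]mulnA leq_mul2l mulnA leq_mul2r; apply/orP; right.
apply/orP; right; apply: (leq_trans (leq_mul (leqnn _) cb)).
rewrite mulnCA leq_mul2l -expnS -expnM leq_exp2l // -ed; apply/orP; right.
have H : S * S <= 36 + 24 * x + 4 * x * x.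
  by apply: leq_trans (leq_mul SL SL) _; nia.
apply: leq_trans (leq_mul H (leqnn d)) _; lia.
Qed.
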